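(* Let $M$ be a $2$-nondegenerate model given by $$\Re(w)=z^TH(\zeta,\overline{\zeta})\overline{z}+\Re(\overline{z}^TS(\zeta,\overline{\zeta})\overline{z}).$$ For $a\in\mathbb{C}^s$ and $b\in\mathbb{R}$, the real part of $$X=2\left(bi+\left(\overline{a}^T\overline{H(0,\overline{\zeta})}+\left(a^T\mathbf{H}-\overline{a}^TS(\zeta,0)+\overline{a}^TS(0,0)\right)H(\zeta,0)^{-1}\overline{S(0,\overline{\zeta})}\right)z\right)\frac{\partial}{\partial w}+\left(a^T\mathbf{H}-\overline{a}^TS(\zeta,0)+\overline{a}^TS(0,0)\right)H(\zeta,0)^{-1}\frac{\partial}{\partial z}$$ is an infinitesimal symmetry of $M$, where $\mathbf{H}=H(0,0)$.
   Context: Coordinates on $\mathbb{C}^{n+1}$ are $(w,z,\zeta)\in\mathbb{C}\oplus\mathbb{C}^s\oplus\mathbb{C}^{n-s}$, with $z,a$ column vectors, and $\frac{\partial}{\partial z}$ denotes the length $s$ column vector whose $j$th entry is $\frac{\partial}{\partial z_j}$. A $2$-nondegenerate model is a real analytic CR hypersurface given near $0$ by the displayed equation, with $H,S$ respectively $s\times s$ Hermitian and symmetric (real analytic) matrix valued functions of $(\zeta,\overline\zeta)$ and $H(0,0)$ nondegenerate, which has constant rank $s$ Levi form and is $2$-nondegenerate everywhere in some neighborhood of $0$. In expressions such as $H(\zeta,0)$ and $S(0,\overline\zeta)$, $\zeta$ and $\overline\zeta$ are treated as independent variables in the power series. Here, with $\mathcal H$ the bundle of $(1,0)$-vectors tangent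 to $M$ and $\mathcal K_2\subset\mathcal H$ the kernel of the Levi form $\mathcal L^1(X_p,Y_p)=\frac1{2i}[X,\overline Y]_p\bmod\mathcal H\oplus\overline{\mathcal H}$ (constant rank $s$), $2$-nondegenerate means that $\mathcal K_2\neq0$ and the only $v\in\mathcal K_2$ with $[[V,\overline{X_1}],\overline{X_2}]_p\in\mathcal H\oplus\overline{\mathcal H}$ for all sections $X_1,X_2$ of $\mathcal H$ ($V$ a section of $\mathcal K_2$ extending $v$) is $v=0$. An infinitesimal symmetry here is the real part of a holomorphic vector field that is tangent to $M$ (near $0$). *)

(* Defs.v *)
From HB Require Import structures.
From mathcomp Require Import all_boot all_order all_algebra.
From mathcomp Require Import all_classical all_reals all_analysis.
From mathcomp Require Import complex.

Set Implicit Arguments.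
Unset Strict Implicit.
Unset Printing Implicit Defensive.

Import Order.TTheory GRing.Theory Num.Theory numFieldNormedType.Exports.

Local Open Scope ring_scope.
Local Open Scope classical_set_scope.

(* Typing R[i] as a numClosedFieldType gives 'cV[Cx R]_N the topology and the
   structure of normed space over Cx R that MathComp-Analysis attaches to
   matrices over a numFieldType. *)
Definition Cx (R : realType) : numClosedFieldType := R[i].

Definition RtoC (R : realType) (x : R) : Cx R := x%:C%C.

Definition conj_mx (R : realType) m n (A : 'M[Cx R]_(m, n)) : 'M[Cx R]_(m, n) :=
  map_mx (fun x => x^*) A.

Section VectorFields.
Variables (R : realType) (N : nat).
Local Notation C := (Cx R).
Local Notation Cn := ('cV[C]_N).

(* C^N is a normed space over C only, so derivatives along *real* multiples of
   v are taken separately on the real and imaginary parts. *)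
Definition re_line (f : Cn -> C) (v p : Cn) : R -> R :=
  fun t => complex.Re (f (p + RtoC t *: v)).

Definition im_line (f : Cn -> C) (v p : Cn) : R -> R :=
  fun t => complex.Im (f (p + RtoC t *: v)).

Definition rderivable (f : Cn -> C) (v p : Cn) : Prop :=
  derivable (re_line f v p) 0 1 /\ derivable (im_line f v p) 0 1.

Definition rderive (f : Cn -> C) (v p : Cn) : C :=
  Complex ((re_line f v p)^`() 0) ((im_line f v p)^`() 0).

Fixpoint Ck (k : nat) (U : set Cn) (f : Cn -> C) : Prop :=
  (forall p, U p -> {for p, continuous f}) /\
  (if k is k'.+1 then
     forall v, (forall p, U p -> rderivable f v p) /\ Ck k' U (rderive f v)
   else True).

Definition smooth_on (U : set Cn) (X : Cn -> Cn) : Prop :=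
  forall k j, Ck k U (fun p => X p j 0).

Definition holomorphic_on (U : set Cn) (X : Cn -> Cn) : Prop :=
  forall p, U p -> forall j, differentiable (fun q => X q j 0) p.

Definition dZ (j : 'I_N) (f : Cn -> C) (p : Cn) : C :=
  (rderive f (delta_mx j 0) p - 'i * rderive f ('i *: delta_mx j 0) p) / 2.

Definition dZbar (j : 'I_N) (f : Cn -> C) (p : Cn) : C :=
  (rderive f (delta_mx j 0) p + 'i * rderive f ('i *: delta_mx j 0) p) / 2.

(* (A1, A2) stands for sum_j A1_j d/dZ_j + A2_j d/dZbar_j. *)
Definition cvfield : Type := ((Cn -> Cn) * (Cn -> Cn))%type.

Definition cvapply (A : cvfield) (f : Cn -> C) : Cn -> C := fun p =>
  \sum_j (A.1 p j 0 * dZ j f p + A.2 p j 0 * dZbar j f p).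

Definition cvbracket (A B : cvfield) : cvfield :=
  (fun p => \col_j (cvapply A (fun q => B.1 q j 0) p
                    - cvapply B (fun q => A.1 q j 0) p),
   fun p => \col_j (cvapply A (fun q => B.2 q j 0) p
                    - cvapply B (fun q => A.2 q j 0) p)).

Definition cvscale (c : C) (A : cvfield) : cvfield :=
  (fun p => c *: A.1 p, fun p => c *: A.2 p).

Definition field10 (X : Cn -> Cn) : cvfield := (X, fun=> 0).

Definition field01 (X : Cn -> Cn) : cvfield := (fun=> 0, fun p => conj_mx (X p)).

Definition re_field (X : Cn -> Cn) : cvfield :=
  (fun p => 2^-1 *: X p, fun p => 2^-1 *: conj_mx (X p)).

End VectorFields.

Section LeviForm.
Variables (R : realType) (N : nat).
Local Notation C := (Cx R).
Local Notation Cn := ('cV[C]_N).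
Variable rho : Cn -> C.

(* The fibre of the bundle of (1,0)-vectors tangent to M = {rho = 0}. *)
Definition Hfib (p : Cn) : set Cn :=
  [set v | \sum_j v j 0 * dZ j rho p = 0].

Definition in_HHbar (A : cvfield R N) (p : Cn) : Prop :=
  Hfib p (A.1 p) /\ Hfib p (conj_mx (A.2 p)).

(* Sections over a neighbourhood of p in M, given by a smooth extension to a
   neighbourhood of p in C^N; the values on M of brackets of fields tangent to
   M do not depend on the extensions. *)
Definition local_section (F : Cn -> set Cn) (p : Cn) (X : Cn -> Cn) : Prop :=
  exists2 U : set Cn, open_nbhs p U &
    smooth_on U X /\ (forall q, U q -> rho q = 0 -> F q (X q)).

Definition levi_bracket (X Y : Cn -> Cn) : cvfield R N :=
  cvscale (2 * 'i)^-1 (cvbracket (field10 X) (field01 Y)).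

Definition Kfib (p : Cn) : set Cn :=
  [set v | Hfib p v /\
     forall X Y, local_section Hfib p X -> local_section Hfib p Y ->
       X p = v -> in_HHbar (levi_bracket X Y) p].

Definition has_dim (V : set Cn) (d : nat) : Prop :=
  exists2 A : 'M[C]_N, (forall v, V v <-> (v^T <= A)%MS) & \rank A = d.

(* The rank of a form on H_p is the codimension of its kernel in H_p. *)
Definition levi_rank (p : Cn) (k : nat) : Prop :=
  exists2 d, has_dim (Kfib p) d & has_dim (Hfib p) (k + d).

Definition two_nondegenerate_at (p : Cn) : Prop :=
  (exists2 v, Kfib p v & v != 0) /\
  (forall V, local_section Kfib p V ->
     (forall X1 X2, local_section Hfib p X1 -> local_section Hfib p X2 ->
        in_HHbar (cvbracket (cvbracket (field10 V) (field01 X1)) (field01 X2)) p) ->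
     V p = 0).

Definition infinitesimal_symmetry (X : Cn -> Cn) : Prop :=
  exists2 U : set Cn, open_nbhs (0 : Cn) U &
    holomorphic_on U X /\
    (forall p, U p -> rho p = 0 -> cvapply (re_field X) rho p = 0).

End LeviForm.

Section Analytic.
Variables (R : realType) (r : nat).
Local Notation C := (Cx R).

Definition multi_index : Type := {ffun 'I_r -> nat}.

Definition mono (x : 'cV[C]_r) (alpha : multi_index) : C :=
  \prod_i x i 0 ^+ alpha i.

Definition ps_term (c : multi_index -> multi_index -> C) (x y : 'cV[C]_r)
    (alpha beta : multi_index) : C :=
  c alpha beta * mono x alpha * mono y beta.

(* Sum of F over the pairs of multi-indices with all entries < k. *)
Definition box_sum (F : multi_index -> multi_index -> C) (k : nat) : C :=
  \sum_(alpha : {ffun 'I_r -> 'I_k}) \sum_(beta : {ffun 'I_r -> 'I_k})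
    F [ffun i => nat_of_ord (alpha i)] [ffun i => nat_of_ord (beta i)].

(* A real analytic germ f(zeta, zetabar) is represented by the function of two
   independent variables which is the sum of its power series; its values are
   then f zeta (conj_mx zeta), while f(zeta, 0) and f(0, zetabar) are
   f zeta 0 and f 0 (conj_mx zeta). *)
Definition analytic_at0 (f : 'cV[C]_r -> 'cV[C]_r -> C) : Prop :=
  exists c : multi_index -> multi_index -> C,
    \forall x \near (0 : 'cV[C]_r) & y \near (0 : 'cV[C]_r),
      (exists B : C, forall k,
         box_sum (fun alpha beta => `|ps_term c x y alpha beta|) k <= B) /\
      (box_sum (ps_term c x y) @ \oo --> f x y).

End Analytic.

Section Models.
Variables (R : realType) (s r : nat).
Local Notation C := (Cx R).
Local Notation Cn := ('cV[C]_(1 + (s + r))).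

Definition wcoord (p : Cn) : C := usubmx p 0 0.
Definition zcoord (p : Cn) : 'cV[C]_s := usubmx (dsubmx p).
Definition zetacoord (p : Cn) : 'cV[C]_r := dsubmx (dsubmx p).

Definition mk_vec (fw : C) (fz : 'cV[C]_s) (fzeta : 'cV[C]_r) : Cn :=
  col_mx fw%:M (col_mx fz fzeta).

Variables H S : 'cV[C]_r -> 'cV[C]_r -> 'M[C]_s.

Definition model_rho (p : Cn) : C :=
  let z := zcoord p in
  let zeta := zetacoord p in
  'Re (wcoord p)
  - ((z^T *m H zeta (conj_mx zeta) *m conj_mx z) 0 0
     + 'Re (((conj_mx z)^T *m S zeta (conj_mx zeta) *m conj_mx z) 0 0)).

Definition two_nondegenerate_model : Prop :=
  [/\ (forall i j, analytic_at0 (fun x y => H x y i j)) /\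
      (forall i j, analytic_at0 (fun x y => S x y i j)),
      (\forall zeta \near (0 : 'cV[C]_r),
         (conj_mx (H zeta (conj_mx zeta)))^T = H zeta (conj_mx zeta)),
      (\forall zeta \near (0 : 'cV[C]_r),
         (S zeta (conj_mx zeta))^T = S zeta (conj_mx zeta)),
      H 0 0 \in unitmx &
      \forall p \near (0 : Cn), model_rho p = 0 ->
        levi_rank model_rho p s /\ two_nondegenerate_at model_rho p].

End Models.

(* Main.v *)
Require Import Defs.
From HB Require Import structures.
From mathcomp Require Import all_boot all_order all_algebra.
From mathcomp Require Import all_classical all_reals all_analysis.
From mathcomp Require Import complex ring lra.
Import Order.TTheory GRing.Theory Num.Theory numFieldNormedType.Exports.
Set Implicit Arguments.
Unset Strict Implicit.
Unset Printing Implicit Defensive.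
Local Open Scope ring_scope.
Local Open Scope classical_set_scope.

(** Let x and y stand for zeta and its conjugate, taken as independent variables, and
    put T(x, y) = conj S(conj y, conj x), so that conj H(conj y, conj x) = H(x, y)^T.
    Let g(x) be the coefficient of d/dz in the field, and k(y) = conj g(conj y). Comparing
    the coefficients of z, the real part of the field is tangent to M as soon as
<<
      Phi(x, y) = Phi(x, 0),    where Phi = g T + k H^T,
>>
    holds for y = conj x; indeed 2 Phi(x, 0) z is the part of the coefficient of d/dw that
    depends on z, since k(0) = conj a^T (coef_identity, sym_field_symmetry).

    The rank condition enters through a Schur complement. The z-block of the Levi form is
    H, so rank s means that the Schur complement of H vanishes. It is a form of degree 2
    in z and its conjugate; these may be separated as well, and its coefficients give,
    with v a direction of x and w a direction of y (schur_identities),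
<<
      H_vw = H_v H^-1 H_w + (S_v H^-1 T_w)^T,
      S_vw = S_v H^-1 H_w + (S_v H^-1 H_w)^T,
      T_vw = H_v H^-1 T_w + (H_v H^-1 T_w)^T.
>>
    Consequently Psi_w = Phi_w and Psi'_v = Phi'_v, with Phi' = k S + g H the conjugate of
    Phi, satisfy the linear system (mdif_Psi, mdif_Psi')
<<
      (Psi_w)_v  = Psi'_v H^-1 T_w + Psi_w H^-T H_v^T,
      (Psi'_v)_w = Psi_w H^-T S_v + Psi'_v H^-1 H_w.
>>
    The formula for g makes Phi(0, y) and Phi'(x, 0) constant, that is,
    Psi_w vanishes for x = 0 and Psi'_v for y = 0. Integrating from there shows that on a
    small polydisc any common bound of Psi and Psi' can be halved (goursat_contract), so
    both vanish and Phi does not depend on y (Phi_indep).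

    The analysis rests on one class of functions, An r: sums on the polydisc of radius r
    of series of polynomial expressions whose majorants are summable on smaller polydiscs.
    It contains the given power series (analytic_An), is stable under ring operations,
    reciprocals and derivation, and has the identity principle that passes from
    y = conj x to independent x and y (An_real_slice). Restricted to y = conj x, its
    members are smooth (slice_Ck); this provides enough sections of the tangent bundle to
    show that the vectors of the Levi kernel, which is defined by brackets of sections,
    are annihilated by the mixed derivatives of the defining function (Kfib_levi). *)

(** * Real-valued modulus and limits of complex sequences *)

Section RealNorm.
Variable R : realType.
Local Notation C := (Cx R).
Implicit Types (x y c : C) (a e : R).

(** The modulus as a real number: inequalities between complex numbers only make
    sense between real ones, and the decision procedures for ordered fields need
    a total order. *)
Definition nrm x : R := complex.Re `|x|.

Lemma normE x : `|x| = RtoC (nrm x).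
Proof. by rewrite /nrm normc_def. Qed.

Lemma RtoC_le a b : (RtoC a <= RtoC b) = (a <= b).
Proof. by rewrite /RtoC lecR. Qed.

Lemma RtoC_lt a b : (RtoC a < RtoC b) = (a < b).
Proof. by rewrite /RtoC ltcR. Qed.

Lemma RtoCD a b : RtoC (a + b) = RtoC a + RtoC b.
Proof. exact: rmorphD. Qed.

Lemma RtoCM a b : RtoC (a * b) = RtoC a * RtoC b.
Proof. exact: rmorphM. Qed.

Lemma RtoC_inj : injective (@RtoC R).
Proof. by move=> a b []. Qed.

Lemma RtoC0 : RtoC (0 : R) = 0. Proof. by []. Qed.
Lemma RtoC1 : RtoC (1 : R) = 1. Proof. by []. Qed.

Lemma nrm_ge0 x : 0 <= nrm x.
Proof. by rewrite -RtoC_le -normE RtoC0. Qed.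

Lemma nrmM x y : nrm (x * y) = nrm x * nrm y.
Proof. by apply: RtoC_inj; rewrite RtoCM -!normE normrM. Qed.

Lemma ler_nrmD x y : nrm (x + y) <= nrm x + nrm y.
Proof. by rewrite -RtoC_le RtoCD -!normE ler_normD. Qed.

Lemma nrmN x : nrm (- x) = nrm x.
Proof. by apply: RtoC_inj; rewrite -!normE normrN. Qed.

Lemma ler_nrmB x y : nrm (x - y) <= nrm x + nrm y.
Proof. by rewrite -(nrmN y) ler_nrmD. Qed.

Lemma nrm_tri x y z : nrm (x - z) <= nrm (x - y) + nrm (y - z).
Proof. by rewrite -{1}(subrK y x) -addrA ler_nrmD. Qed.

Lemma nrm_distC x y : nrm (x - y) = nrm (y - x).
Proof. by rewrite -nrmN opprB. Qed.

Lemma nrm0 : nrm 0 = 0.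
Proof. by rewrite /nrm normr0. Qed.

Lemma nrm1 : nrm 1 = 1.
Proof. by rewrite /nrm normr1. Qed.

Lemma nrm_eq0 x : (nrm x == 0) = (x == 0).
Proof.
apply/eqP/eqP => [h|->]; last exact: nrm0.
by apply/eqP; rewrite -normr_eq0 normE h RtoC0.
Qed.

Lemma nrm_gt0 x : (0 < nrm x) = (x != 0).
Proof. by rewrite lt_neqAle nrm_ge0 andbT eq_sym nrm_eq0. Qed.

Lemma nrm_conj x : nrm x^* = nrm x.
Proof. by apply: RtoC_inj; rewrite -!normE norm_conjC. Qed.

Lemma nrm_RtoC a : nrm (RtoC a) = `|a|.
Proof.
apply: RtoC_inj; rewrite -normE; case: (lerP 0 a) => a0.
  by rewrite !ger0_norm // -RtoC0 RtoC_le.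
by rewrite !ltr0_norm // -?RtoC0 ?RtoC_lt //; exact/esym/rmorphN.
Qed.

Lemma nrmi : nrm 'i = 1.
Proof. by apply: RtoC_inj; rewrite -normE normCi. Qed.

Lemma ler_nrm_sum I (r : seq I) (P : pred I) (F : I -> C) :
  nrm (\sum_(i <- r | P i) F i) <= \sum_(i <- r | P i) nrm (F i).
Proof.
elim/big_rec2: _ => [|i y1 y2 _ h]; first by rewrite nrm0.
exact: le_trans (ler_nrmD _ _) (lerD (lexx _) h).
Qed.

Lemma nrm_Re x : `|complex.Re x| <= nrm x.
Proof. by rewrite -RtoC_le -normE; exact: normc_ge_Re. Qed.

Lemma ReD x y : complex.Re (x + y) = complex.Re x + complex.Re y.
Proof. by case: x y => [? ?] [? ?]. Qed.
Lemma ImD x y : complex.Im (x + y) = complex.Im x + complex.Im y.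
Proof. by case: x y => [? ?] [? ?]. Qed.
Lemma ReN x : complex.Re (- x) = - complex.Re x.
Proof. by case: x. Qed.
Lemma ImN x : complex.Im (- x) = - complex.Im x.
Proof. by case: x. Qed.

Lemma nrm_Im x : `|complex.Im x| <= nrm x.
Proof.
rewrite -(nrm_conj x) -[nrm _]mul1r -nrmi -nrmM.
suff -> : complex.Im x = complex.Re ('i * x^*) by exact: nrm_Re.
by case: x => u v /=; rewrite !mul0r mul1r opprK add0r.
Qed.

Lemma nrm_ReIm x : nrm x <= `|complex.Re x| + `|complex.Im x|.
Proof.
have -> : nrm x = nrm (RtoC (complex.Re x) + 'i * RtoC (complex.Im x)).
  congr nrm; case: x => u v; apply/eqP; rewrite eq_complex /=.
  by rewrite !(mul0r, mulr0, mul1r, subr0, addr0, add0r, eqxx).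
apply: le_trans (ler_nrmD _ _) _.
by rewrite nrmM nrmi mul1r !nrm_RtoC.
Qed.

Lemma cvgC_nrm (u : nat -> C) l :
  (u @ \oo --> l) <-> (forall e, 0 < e -> \forall n \near \oo, nrm (u n - l) < e).
Proof.
split=> [h e e0|h].
  have /cvgrPdist_lt/(_ (RtoC e)) := h; rewrite -RtoC0 RtoC_lt => /(_ e0).
  by apply: filterS => n; rewrite normE RtoC_lt nrm_distC.
apply/cvgrPdist_lt => -[e e'].
rewrite ltcE /= => /andP[/eqP -> e0].
have := h _ e0; apply: filterS => n.
by rewrite -RtoC_lt -normE distrC.
Qed.

(** Convergence in C stated with real bounds, so that no topological structure on
    C enters the computations with series. *)
Definition clim (u : nat -> C) (l : C) : Prop :=
  forall e, 0 < e -> exists N, forall n, (N <= n)%N -> nrm (u n - l) < e.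

Lemma climP (u : nat -> C) (l : C) : u @ \oo --> l <-> clim u l.
Proof.
split=> [/cvgC_nrm h e e0|h]; first by have [N _ hN] := h e e0; exists N.
by apply/cvgC_nrm => e e0; have [N hN] := h e e0; exists N.
Qed.

Lemma clim_eq (u v : nat -> C) (l : C) : (forall n, u n = v n) -> clim u l -> clim v l.
Proof. by move=> uv h e e0; have [N hN] := h e e0; exists N => n /hN; rewrite uv. Qed.

Lemma clim_bound (u : nat -> C) (l : C) B :
  clim u l -> (forall n, nrm (u n) <= B) -> nrm l <= B.
Proof.
move=> h hB; apply/ler_addgt0Pr => e e0.
have [n /(_ n (leqnn _)) hn] := h _ e0.
have -> : l = u n - (u n - l) by rewrite subKr.
by apply: le_trans (ler_nrmB _ _) _; rewrite lerD // ltW.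
Qed.

Lemma clim_uniq (u : nat -> C) (l l' : C) : clim u l -> clim u l' -> l = l'.
Proof. by move=> /climP h /climP h'; exact: cvg_unique h h'. Qed.

Lemma climD (u v : nat -> C) (l k : C) :
  clim u l -> clim v k -> clim (fun n => u n + v n) (l + k).
Proof.
move=> hu hv e e0; have e2 : 0 < e / 2 by rewrite divr_gt0.
have [N hN] := hu _ e2; have [M hM] := hv _ e2.
exists (maxn N M) => n; rewrite geq_max => /andP[/hN h1 /hM h2].
rewrite opprD addrACA; apply: le_lt_trans (ler_nrmD _ _) _; lra.
Qed.

Lemma climB (u v : nat -> C) (l k : C) :
  clim u l -> clim v k -> clim (fun n => u n - v n) (l - k).
Proof.
move=> hu hv; apply: climD => // e e0; have [N hN] := hv e e0.
by exists N => n /hN; rewrite -nrmN opprB opprK addrC.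
Qed.

Lemma climM (u v : nat -> C) (l k : C) :
  clim u l -> clim v k -> clim (fun n => u n * v n) (l * k).
Proof.
move=> hu hv e e0; pose D := nrm l + nrm k + 1.
have D0 : 0 < D by rewrite ltr_wpDl // addr_ge0 ?nrm_ge0.
pose d := Num.min 1 (e / (2 * D)).
have d0 : 0 < d by rewrite lt_min ltr01 divr_gt0 // mulr_gt0.
have dD : d * (2 * D) <= e by rewrite -ler_pdivlMr ?mulr_gt0 // ge_min lexx orbT.
have d1 : d <= 1 by rewrite ge_min lexx.
have [N hN] := hu _ d0; have [M hM] := hv _ d0.
exists (maxn N M) => n; rewrite geq_max => /andP[/hN h1 /hM h2].
have -> : u n * v n - l * k = (u n - l) * (v n - k) + (u n - l) * k + l * (v n - k).
  by ring.
apply: le_lt_trans (ler_nrmD _ _) _.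
apply: le_lt_trans (lerD (ler_nrmD _ _) (lexx _)) _; rewrite !nrmM.
have a1 : nrm (u n - l) * nrm (v n - k) <= nrm (u n - l).
  by rewrite ler_piMr ?nrm_ge0 // (le_trans (ltW h2)).
have a2 : nrm (u n - l) * nrm k <= d * nrm k by rewrite ler_wpM2r ?nrm_ge0 // ltW.
have a3 : nrm l * nrm (v n - k) <= nrm l * d by rewrite ler_wpM2l ?nrm_ge0 // ltW.
by rewrite /D in dD; nra.
Qed.

Lemma clim_cst (c : C) : clim (fun=> c) c.
Proof. by move=> e e0; exists 0%N => n _; rewrite subrr nrm0. Qed.

Definition psum (u : nat -> C) (n : nat) : C := \sum_(i < n) u i.

Lemma psumS (u : nat -> C) n : psum u n.+1 = psum u n + u n.
Proof. by rewrite /psum big_ord_recr. Qed.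

(** Completeness of C for absolutely convergent series, obtained from that of the
    real line on real and imaginary parts. *)
Lemma abs_cvgC (u : nat -> C) B : (forall n, \sum_(i < n) nrm (u i) <= B) ->
  exists l : C, clim (psum u) l.
Proof.
move=> hB.
have real_case (v : nat -> R) : (forall n, `|v n| <= nrm (u n)) ->
    cvgn (series v).
  move=> hv; apply: normed_cvg; rewrite /normed_series_of /=.
  apply: nondecreasing_is_cvgn.
    by apply/nondecreasing_seqP => n; rewrite /series /= big_nat_recr //= lerDl.
  exists B => _ [n _ <-]; apply: le_trans (hB n).
  by rewrite /series /= big_mkord; apply: ler_sum => i _; exact: hv.
have /cvg_ex[/= a ha] := real_case _ (fun n => nrm_Re (u n)).
have /cvg_ex[/= b hb] := real_case _ (fun n => nrm_Im (u n)).
exists (Complex a b); apply/climP/cvgC_nrm => e e0.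
have e2 : 0 < e / 2 by rewrite divr_gt0.
move/cvgrPdist_lt/(_ _ e2): ha => ha; move/cvgrPdist_lt/(_ _ e2): hb => hb.
near=> n.
apply: le_lt_trans (nrm_ReIm _) _.
have -> : e = e / 2 + e / 2 by rewrite -splitr.
rewrite /psum ReD ImD ReN ImN /= !(distrC _ a) !(distrC _ b).
have -> : complex.Re (\sum_(i < n) u i) = series (fun n => complex.Re (u n)) n.
  by rewrite /series /= big_mkord; elim/big_rec2: _ => // i y1 y2 _ <-; rewrite ReD.
have -> : complex.Im (\sum_(i < n) u i) = series (fun n => complex.Im (u n)) n.
  by rewrite /series /= big_mkord; elim/big_rec2: _ => // i y1 y2 _ <-; rewrite ImD.
by apply: ltrD; near: n.
Unshelve. all: by end_near.
Qed.

End RealNorm.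

(** * Formal polynomial expressions and their majorants *)

Section Terms.
Variables (R : realType).
Local Notation C := (Cx R).

(** Polynomials kept as formal expressions: everything below is bounded through the
    majorant of the expression, which is compatible with sums, products and
    derivation. *)
Inductive pterm (m : nat) : Type :=
  | Cst of C
  | Vr of 'I_m
  | Ad of pterm m & pterm m
  | Ml of pterm m & pterm m.
Arguments Cst {m}.
Arguments Vr {m}.
Arguments Ad {m}.
Arguments Ml {m}.

Fixpoint ev m (x : 'cV[C]_m) (t : pterm m) : C :=
  match t with
  | Cst c => c
  | Vr i => x i 0
  | Ad t u => ev x t + ev x u
  | Ml t u => ev x t * ev x u
  end.

(** The value at (rho, ..., rho) of the expression in which every constant has been
    replaced by its modulus. *)
Fixpoint maj m (rho : R) (t : pterm m) : R :=
  match t with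
  | Cst c => nrm c
  | Vr i => rho
  | Ad t u => maj rho t + maj rho u
  | Ml t u => maj rho t * maj rho u
  end.

(** The formal derivative in the direction v. *)
Fixpoint dt m (v : 'cV[C]_m) (t : pterm m) : pterm m :=
  match t with
  | Cst c => Cst 0
  | Vr i => Cst (v i 0)
  | Ad t u => Ad (dt v t) (dt v u)
  | Ml t u => Ad (Ml (dt v t) u) (Ml t (dt v u))
  end.

Definition dle m (rho : R) (x : 'cV[C]_m) := forall i, nrm (x i 0) <= rho.
Definition dlt m (rho : R) (x : 'cV[C]_m) := forall i, nrm (x i 0) < rho.

Section OneTerm.
Variable m : nat.
Implicit Types (t u : pterm m) (x h v : 'cV[C]_m) (a b k : R).

Lemma maj_ge0 a t : 0 <= a -> 0 <= maj a t.
Proof.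
by move=> a0; elim: t => //= [c|t ht u hu|t ht u hu];
  rewrite ?nrm_ge0 ?addr_ge0 ?mulr_ge0.
Qed.

Lemma maj_le a b t : 0 <= a -> a <= b -> maj a t <= maj b t.
Proof.
move=> a0 ab; elim: t => //= t ht u hu; first by rewrite lerD.
by rewrite ler_pM ?maj_ge0.
Qed.

Lemma ev_maj a x t : 0 <= a -> dle a x -> nrm (ev x t) <= maj a t.
Proof.
move=> a0 hx; elim: t => //= t ht u hu.
  by apply: le_trans (ler_nrmD _ _) _; rewrite lerD.
by rewrite nrmM ler_pM ?nrm_ge0.
Qed.

(** Cauchy's estimate for expressions. The majorant is a polynomial in the radius
    with nonnegative coefficients, hence convex, so that its derivative at a is
    at most its slope between a and b. By induction: for a product t u the claim
    reduces to (maj b t - maj a t) (maj b u - maj a u) >= 0. *)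
Lemma maj_dt a b k v t : 0 <= a -> a <= b -> 0 <= k -> dle k v ->
  maj a (dt v t) * (b - a) <= k * (maj b t - maj a t).
Proof.
move=> a0 ab k0 hv.
elim: t => [c|i|t ht u hu|t ht u hu] /=.
- by rewrite nrm0 mul0r subrr mulr0.
- by rewrite ler_wpM2r ?subr_ge0.
- by have := lerD ht hu; congr (_ <= _); ring.
- have := maj_ge0 t a0; have := maj_ge0 u a0.
  have := maj_le t a0 ab; have := maj_le u a0 ab.
  move: (maj a t) (maj a u) (maj b t) (maj b u) (maj a (dt v t))
    (maj a (dt v u)) ht hu => T U T' U' DT DU h1 h2 h3 h4 h5 h6.
  have h7 := ler_wpM2r h5 h1; have h8 := ler_wpM2r h6 h2.
  have h9 : 0 <= k * ((T' - T) * (U' - U)).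
    by rewrite !mulr_ge0 // subr_ge0.
  by nra.
Qed.

(** The same convexity argument without derivative: a displacement of relative
    size k <= 1 costs at most the fraction k of the growth of the majorant. *)
Lemma ev_lip a b k x h t : 0 <= a -> a <= b -> 0 <= k -> k <= 1 ->
  dle a x -> dle (k * (b - a)) h ->
  nrm (ev (x + h) t - ev x t) <= k * (maj b t - maj a t).
Proof.
move=> a0 ab k0 k1 hx hh.
have hxh : dle b (x + h).
  move=> i; rewrite !mxE; apply: le_trans (ler_nrmD _ _) _.
  have := hx i; have := hh i.
  have : k * (b - a) <= b - a by rewrite ler_piMl // subr_ge0.
  by lra.
have b0 := le_trans a0 ab.
elim: t => [c|i|t ht u hu|t ht u hu] /=.
- by rewrite !subrr nrm0 mulr0.
- by rewrite !mxE addrAC subrr add0r.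
- rewrite (_ : k * _ = k * (maj b t - maj a t) + k * (maj b u - maj a u));
    last by ring.
  rewrite opprD addrACA.
  by apply: le_trans (ler_nrmD _ _) _; rewrite lerD.
- have -> : ev (x + h) t * ev (x + h) u - ev x t * ev x u =
    (ev (x + h) t - ev x t) * ev (x + h) u + ev x t * (ev (x + h) u - ev x u).
    by ring.
  apply: le_trans (ler_nrmD _ _) _; rewrite !nrmM.
  have hU := ev_maj u b0 hxh; have hT := ev_maj t a0 hx.
  apply: (@le_trans _ _ (k * (maj b t - maj a t) * maj b u
    + maj a t * (k * (maj b u - maj a u)))).
    by rewrite lerD ?ler_pM ?nrm_ge0.
  by rewrite le_eqVlt; apply/orP; left; apply/eqP; ring.
Qed.

(** Taylor's formula to the second order. In the product t u the remainders of t and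
    u are multiplied by values at x and the product of the two increments is added;
    the three bounds add up to k^2 (maj b (t u) - maj a (t u)) exactly. *)
Lemma ev_quad a b k x h t : 0 <= a -> a <= b -> 0 <= k -> k <= 1 ->
  dle a x -> dle (k * (b - a)) h ->
  nrm (ev (x + h) t - ev x t - ev x (dt h t)) <= k ^+ 2 * (maj b t - maj a t).
Proof.
move=> a0 ab k0 k1 hx hh.
elim: t => [c|i|t ht u hu|t ht u hu] /=.
- by rewrite !subrr nrm0 mulr0.
- rewrite !mxE (_ : x i 0 + h i 0 - x i 0 - h i 0 = 0); last by ring.
  by rewrite nrm0 mulr_ge0 ?exprn_ge0 ?subr_ge0.
- rewrite (_ : k ^+ 2 * _ = k ^+ 2 * (maj b t - maj a t)
    + k ^+ 2 * (maj b u - maj a u)); last by ring.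
  have -> : forall p q r s v w : C, p + q - (r + s) - (v + w) =
    (p - r - v) + (q - s - w) by move=> *; ring.
  by apply: le_trans (ler_nrmD _ _) _; rewrite lerD.
- have lt := ev_lip t a0 ab k0 k1 hx hh; have lu := ev_lip u a0 ab k0 k1 hx hh.
  have bt := ev_maj t a0 hx; have bu := ev_maj u a0 hx.
  have -> : ev (x + h) t * ev (x + h) u - ev x t * ev x u
    - (ev x (dt h t) * ev x u + ev x t * ev x (dt h u)) =
    (ev (x + h) t - ev x t - ev x (dt h t)) * ev x u
    + ev x t * (ev (x + h) u - ev x u - ev x (dt h u))
    + (ev (x + h) t - ev x t) * (ev (x + h) u - ev x u) by ring.
  do 2?[apply: le_trans (ler_nrmD _ _) _]; rewrite !nrmM.
  apply: (@le_trans _ _ (k ^+ 2 * (maj b t - maj a t) * maj a u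
    + maj a t * (k ^+ 2 * (maj b u - maj a u))
    + k * (maj b t - maj a t) * (k * (maj b u - maj a u)))).
    apply: le_trans (lerD (ler_nrmD _ _) (lexx _)) _; rewrite !nrmM.
    by rewrite !lerD ?ler_pM ?nrm_ge0.
  by rewrite le_eqVlt; apply/orP; left; apply/eqP; ring.
Qed.

Lemma ev_dt_sym x v h t : ev x (dt v (dt h t)) = ev x (dt h (dt v t)).
Proof. by elim: t => //= [t -> u ->|t ht u hu] //; rewrite ht hu; ring. Qed.

Lemma ev_dtZ x (c : C) h t : ev x (dt (c *: h) t) = c * ev x (dt h t).
Proof.
elim: t => [d|i|t ht u hu|t ht u hu] /=; rewrite ?mulr0 ?mxE ?ht ?hu ?mulrDr //.
by congr (_ + _); ring.
Qed.

Lemma ev_dtD x h v t : ev x (dt (h + v) t) = ev x (dt h t) + ev x (dt v t).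
Proof.
by elim: t => [d|i|t ht u hu|t ht u hu] /=; rewrite ?addr0 ?mxE ?ht ?hu //; ring.
Qed.

End OneTerm.

Fixpoint subst m m' (th : 'I_m -> pterm m') (t : pterm m) : pterm m' :=
  match t with
  | Cst c => Cst c
  | Vr i => th i
  | Ad t u => Ad (subst th t) (subst th u)
  | Ml t u => Ml (subst th t) (subst th u)
  end.

Lemma ev_subst m m' (th : 'I_m -> pterm m') x t :
  ev x (subst th t) = ev (\col_i ev x (th i)) t.
Proof. by elim: t => //= [i|t -> u ->|t -> u ->]; rewrite ?mxE. Qed.

Lemma maj_subst m m' (th : 'I_m -> pterm m') a b t : 0 <= a ->
  (forall i, maj a (th i) <= b) -> maj a (subst th t) <= maj b t.
Proof.
move=> a0 h; elim: t => //= t ht u hu; first by rewrite lerD.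
by rewrite ler_pM ?maj_ge0.
Qed.

Fixpoint cjt m (t : pterm m) : pterm m :=
  match t with
  | Cst c => Cst c^*
  | Vr i => Vr i
  | Ad t u => Ad (cjt t) (cjt u)
  | Ml t u => Ml (cjt t) (cjt u)
  end.

Lemma ev_cjt m (x : 'cV[C]_m) t : ev x (cjt t) = (ev (conj_mx x) t)^*.
Proof.
elim: t => //= [i|t -> u ->|t -> u ->]; rewrite ?rmorphD ?rmorphM //.
by rewrite mxE conjCK.
Qed.

Lemma maj_cjt m a (t : pterm m) : maj a (cjt t) = maj a t.
Proof. by elim: t => //= [c|t -> u ->|t -> u ->] //; rewrite nrm_conj. Qed.

End Terms.
Arguments Cst {R m}.
Arguments Vr {R m}.
Arguments Ad {R m}.
Arguments Ml {R m}.

(** * Analytic functions on a polydisc *)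

Section AnalyticClass.
Variable R : realType.
Local Notation C := (Cx R).

Section OneArity.
Variable m : nat.
Implicit Types (t u : nat -> pterm R m) (x h v : 'cV[C]_m) (a b k r : R)
  (f g : 'cV[C]_m -> C).

Lemma dleW a b x : a <= b -> dle a x -> dle b x.
Proof. by move=> ab hx i; apply: le_trans ab. Qed.

Lemma dle_dlt a b x : a < b -> dle a x -> dlt b x.
Proof. by move=> ab hx i; apply: le_lt_trans ab. Qed.

Lemma dltW a b x : a <= b -> dlt a x -> dlt b x.
Proof. by move=> ab hx i; apply: lt_le_trans ab. Qed.

Lemma dlt_dle r x : 0 < r -> dlt r x -> exists a, [/\ 0 < a, a < r & dle a x].
Proof.
move=> r0 hx; pose a := \big[Num.max/r / 2]_i nrm (x i 0).
have r2 : r / 2 <= a.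
  by rewrite /a; elim/big_rec: _ => // i y _ h; rewrite le_max h orbT.
exists a; split.
- by apply: lt_le_trans r2; rewrite divr_gt0.
- rewrite /a; elim/big_ind: _ => //; first by rewrite gtr_pMr // invf_lt1 ?ltr1n.
  by move=> p q hp hq; rewrite gt_max hp hq.
- move=> i; rewrite /a (bigD1 i) //= le_max lexx //.
Qed.

Lemma dle_ge x : exists2 V, 0 < V & dle V x.
Proof.
exists (1 + \sum_i nrm (x i 0)).
  by rewrite ltr_wpDr // sumr_ge0 // => i _; exact: nrm_ge0.
move=> i; rewrite (bigD1 i) //= addrCA lerDl addr_ge0 //.
by rewrite sumr_ge0 // => j _; exact: nrm_ge0.
Qed.

Lemma dle0 a : 0 <= a -> dle a (0 : 'cV[C]_m).
Proof. by move=> a0 i; rewrite mxE nrm0. Qed.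

Lemma dlt0 a : 0 < a -> dlt a (0 : 'cV[C]_m).
Proof. by move=> a0 i; rewrite mxE nrm0. Qed.

Lemma dleD a b x h : dle a x -> dle b h -> dle (a + b) (x + h).
Proof.
by move=> hx hh i; rewrite mxE; apply: le_trans (ler_nrmD _ _) (lerD _ _).
Qed.

Lemma dleZ a (c : C) x : dle a x -> dle (nrm c * a) (c *: x).
Proof. by move=> hx i; rewrite mxE nrmM ler_wpM2l ?nrm_ge0. Qed.

(** f is the sum, on the polydisc of radius r, of the expressions t n, and the
    majorants of the t n are summable on every smaller polydisc. *)
Definition rep r t f := forall a, 0 < a -> a < r ->
  (exists B, forall n, \sum_(i < n) maj a (t i) <= B) /\
  (forall x, dle a x -> clim (psum (fun i => ev x (t i))) (f x)).

(** The class of analytic functions used below. Only the values on the open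
    polydisc of radius r matter. *)
Definition An r f := exists t, rep r t f.

Lemma rep_ext r t f g : (forall x, dlt r x -> f x = g x) -> rep r t f -> rep r t g.
Proof.
move=> fg hf a a0 ar; have [hB hx] := hf a a0 ar; split=> // x hax.
by rewrite -fg; [exact: hx | exact: dle_dlt hax].
Qed.

Lemma An_ext r f g : (forall x, dlt r x -> f x = g x) -> An r f -> An r g.
Proof. by move=> fg [t ht]; exists t; exact: rep_ext ht. Qed.

Lemma An_le r r' f : r' <= r -> An r f -> An r' f.
Proof. by move=> rr [t ht]; exists t => a a0 ar; apply: ht => //; apply: lt_le_trans rr. Qed.

Lemma An_cst r (c : C) : An r (fun=> c).
Proof.
exists (fun n => if n is 0 then Cst c else Cst 0) => a a0 ar; split.
  exists (nrm c) => -[|n]; first by rewrite big_ord0 nrm_ge0.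
  by rewrite big_ord_recl big1 ?addr0 //= => i _; rewrite nrm0.
move=> x _ e e0; exists 1%N => -[//|n] _.
by rewrite /psum big_ord_recl big1 //= addr0 subrr nrm0.
Qed.

Lemma An_var r (i : 'I_m) : An r (fun x => x i 0).
Proof.
exists (fun n => if n is 0 then Vr i else Cst 0) => a a0 ar; split.
  exists a => -[|n]; first by rewrite big_ord0 ltW.
  by rewrite big_ord_recl big1 ?addr0 //= => j _; rewrite nrm0.
move=> x _ e e0; exists 1%N => -[//|n] _.
by rewrite /psum big_ord_recl big1 //= addr0 subrr nrm0.
Qed.

Lemma An_add r f g : An r f -> An r g -> An r (fun x => f x + g x).
Proof.
move=> [t ht] [u hu]; exists (fun n => Ad (t n) (u n)) => a a0 ar.
have [[B hB] tx] := ht a a0 ar; have [[D hD] ux] := hu a a0 ar; split.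
  exists (B + D) => n; rewrite /= big_split /=.
  exact: lerD (hB n) (hD n).
move=> x hx; apply: clim_eq (climD (tx x hx) (ux x hx)) => n.
by rewrite /psum /= -big_split.
Qed.

Fixpoint pst t (n : nat) : pterm R m :=
  if n is k.+1 then Ad (pst t k) (t k) else Cst 0.

Lemma ev_pst x t n : ev x (pst t n) = psum (fun i => ev x (t i)) n.
Proof.
by elim: n => [|n ih]; rewrite /psum ?big_ord0 // big_ord_recr /= ih.
Qed.

Lemma maj_pst a t n : maj a (pst t n) = \sum_(i < n) maj a (t i).
Proof.
by elim: n => [|n ih]; rewrite ?big_ord0 ?big_ord_recr //= ?nrm0 // ih.
Qed.

(** With partial sums T n and U n, the products T n * U n telescope into the series of
    t n * U n.+1 + T n * u n; this avoids the Cauchy product. *)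
Lemma An_mul r f g : An r f -> An r g -> An r (fun x => f x * g x).
Proof.
move=> [t ht] [u hu].
exists (fun n => Ad (Ml (t n) (pst u n.+1)) (Ml (pst t n) (u n))) => a a0 ar.
have [[B hB] tx] := ht a a0 ar; have [[D hD] ux] := hu a a0 ar.
have a0' := ltW a0.
have B0 : 0 <= B by have := hB 0%N; rewrite big_ord0.
have D0 : 0 <= D by have := hD 0%N; rewrite big_ord0.
split.
  exists (B * D + B * D) => n.
  apply: (@le_trans _ _ (\sum_(i < n) (maj a (t i) * D + B * maj a (u i)))).
    apply: ler_sum => i _.
    rewrite [maj a (Ad _ _)]/= -[maj a (pst u i) + maj a (u i)]/(maj a (pst u i.+1)) !maj_pst.
    by rewrite lerD ?ler_wpM2l ?ler_wpM2r ?maj_ge0.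
  rewrite big_split -mulr_suml -mulr_sumr.
  by rewrite lerD ?ler_wpM2l ?ler_wpM2r.
move=> x hx; apply: clim_eq (climM (tx x hx) (ux x hx)).
elim=> [|k ih]; first by rewrite /psum !big_ord0 mulr0.
by rewrite [RHS]psumS -ih /= !ev_pst !psumS; ring.
Qed.

Lemma An_opp r f : An r f -> An r (fun x => - f x).
Proof.
move=> hf; apply: An_ext (An_mul (An_cst r (-1)) hf) => x _ /=.
by rewrite mulN1r.
Qed.

Lemma An_sub r f g : An r f -> An r g -> An r (fun x => f x - g x).
Proof. by move=> hf hg; apply: An_add => //; exact: An_opp. Qed.

Lemma An_sum r I (s : seq I) (P : pred I) (F : I -> 'cV[C]_m -> C) :
  (forall i, P i -> An r (F i)) -> An r (fun x => \sum_(i <- s | P i) F i x).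
Proof.
move=> hF; elim: s => [|i s ih].
  by apply: An_ext (An_cst r 0) => x _; rewrite big_nil.
case Pi: (P i); last by apply: An_ext ih => x _; rewrite big_cons Pi.
by apply: An_ext (An_add (hF i Pi) ih) => x _; rewrite big_cons Pi.
Qed.

Lemma An_prod r I (s : seq I) (P : pred I) (F : I -> 'cV[C]_m -> C) :
  (forall i, P i -> An r (F i)) -> An r (fun x => \prod_(i <- s | P i) F i x).
Proof.
move=> hF; elim: s => [|i s ih].
  by apply: An_ext (An_cst r 1) => x _; rewrite big_nil.
case Pi: (P i); last by apply: An_ext ih => x _; rewrite big_cons Pi.
by apply: An_ext (An_mul (hF i Pi) ih) => x _; rewrite big_cons Pi.
Qed.

Lemma An_conj r f : An r f -> An r (fun x => (f (conj_mx x))^*).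
Proof.
move=> [t ht]; exists (fun n => cjt (t n)) => a a0 ar.
have [[B hB] tx] := ht a a0 ar; split.
  by exists B => n; under eq_bigr do rewrite maj_cjt.
move=> x hx; have hcx : dle a (conj_mx x) by move=> i; rewrite mxE nrm_conj.
move=> e e0; have [N hN] := tx _ hcx e e0.
exists N => n /hN; rewrite -nrm_conj rmorphB.
have -> // : psum (fun i => ev x (cjt (t i))) n
  = (psum (fun i => ev (conj_mx x) (t i)) n)^*.
rewrite /psum rmorph_sum /=; apply: eq_bigr => i _; exact: ev_cjt.
Qed.

Lemma An_bound r f a : An r f -> 0 < a -> a < r ->
  exists2 B, 0 <= B & forall x, dle a x -> nrm (f x) <= B.
Proof.
move=> [t ht] a0 ar; have [[B hB] tx] := ht a a0 ar.
exists B; first by have := hB 0%N; rewrite big_ord0.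
move=> x hx; apply: clim_bound (tx x hx) _ => n.
apply: le_trans (hB n); apply: le_trans (ler_nrm_sum _ _ _) _.
by apply: ler_sum => i _; apply: ev_maj => //; exact: ltW.
Qed.

(** The remainder is asked to be quadratic, and not only negligible before h: power
    series have no other, and it makes the rules of calculus elementary. *)
Definition is_dif f x (l : 'cV[C]_m -> C) :=
  [/\ exists K d, [/\ 0 <= K, 0 < d & forall h k, 0 <= k -> k <= d -> dle k h ->
        nrm (f (x + h) - f x - l h) <= K * k ^+ 2],
      forall c h, l (c *: h) = c * l h & forall h v, l (h + v) = l h + l v].

Definition dif f x : 'cV[C]_m -> C := xget (fun=> 0) [set l | is_dif f x l].

Lemma is_dif_uniq f x l l' : is_dif f x l -> is_dif f x l' -> l = l'.
Proof.
move=> [[K [d [K0 d0 hl]]] hc _] [[K' [d' [K0' d0' hl']]] hc' _].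
apply/funext => h; apply/eqP; rewrite -subr_eq0 -nrm_eq0 eq_le nrm_ge0 andbT.
have [V V0 hV] := dle_ge h.
apply/ler_addgt0Pr => e e0; rewrite add0r.
pose M := (K + K') * V ^+ 2 + 1.
have M0 : 0 < M by rewrite ltr_wpDl // mulr_ge0 ?addr_ge0 ?exprn_ge0 // ltW.
pose c := Num.min (Num.min (d / V) (d' / V)) (e / M).
have c0 : 0 < c by rewrite !lt_min !divr_gt0.
have kd : c * V <= d by rewrite -ler_pdivlMr // !ge_min lexx.
have kd' : c * V <= d' by rewrite -ler_pdivlMr // !ge_min lexx orbT.
have ke : c * M <= e by rewrite -ler_pdivlMr // !ge_min lexx !orbT.
have hch : dle (c * V) (RtoC c *: h).
  by have := dleZ (RtoC c) hV; rewrite nrm_RtoC gtr0_norm.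
have cV0 : 0 <= c * V by rewrite mulr_ge0 ?ltW.
have h1 := hl _ _ cV0 kd hch; have h2 := hl' _ _ cV0 kd' hch.
have : nrm (l (RtoC c *: h) - l' (RtoC c *: h)) <= (K + K') * (c * V) ^+ 2.
  rewrite mulrDl; apply: le_trans _ (lerD h1 h2).
  rewrite addrC -(nrmN (f _ - _ - l _)); apply: le_trans _ (ler_nrmD _ _).
  by rewrite le_eqVlt; apply/orP; left; apply/eqP; congr nrm; ring.
rewrite hc hc' -mulrBr nrmM nrm_RtoC gtr0_norm //.
rewrite (_ : (K + K') * (c * V) ^+ 2 = c * (c * ((K + K') * V ^+ 2))); last by ring.
rewrite ler_pM2l // => hh; apply: le_trans hh _; apply: le_trans ke.
by rewrite ler_pM2l // /M lerDl.
Qed.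

Lemma is_difE f x l : is_dif f x l -> dif f x = l.
Proof.
move=> hl; apply: (is_dif_uniq _ hl).
by rewrite /dif; case: xgetP => [l' -> //|/(_ l)].
Qed.

Lemma is_dif_near r f g x l : 0 < r -> dlt r x -> (forall y, dlt r y -> f y = g y) ->
  is_dif f x l -> is_dif g x l.
Proof.
move=> r0 hx fg [[K [d [K0 d0 hl]]] hc hd]; split=> //.
have [a [a0 ar ha]] := dlt_dle r0 hx.
exists K, (Num.min d ((r - a) / 2)); split=> //.
  by rewrite lt_min d0 divr_gt0 // subr_gt0.
move=> h k k0; rewrite le_min => /andP[kd kr] hk.
rewrite -!fg //; first exact: hl.
by apply: dle_dlt (dleD ha hk); lra.
Qed.

(** Termwise differentiation: both the convergence of the derived series and the
    quadratic remainder come from the bounds on expressions, between a radius a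
    that contains x and a radius b that lies strictly between a and r. *)
Lemma rep_is_dif r t f x : rep r t f -> 0 < r -> dlt r x ->
  exists2 l, is_dif f x l &
    (forall h, clim (psum (fun i => ev x (dt h (t i)))) (l h)).
Proof.
move=> ht r0 hx; have [a [a0 ar ha]] := dlt_dle r0 hx.
have a0' := ltW a0.
pose b := (a + r) / 2; have ab : a < b by rewrite /b; lra.
have ab' := ltW ab.
have b0 : 0 < b by exact: lt_trans ab.
have br : b < r by rewrite /b; lra.
have [[B hB] tx] := ht b b0 br.
have B0 : 0 <= B by have := hB 0%N; rewrite big_ord0.
have hB' n : \sum_(i < n) (maj b (t i) - maj a (t i)) <= B.
  apply: le_trans (hB n); apply: ler_sum => i _.
  by rewrite lerBlDr lerDl maj_ge0.
have ba : 0 < b - a by rewrite subr_gt0.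
have /choice[l hl] : forall h, exists y : C,
    clim (psum (fun i => ev x (dt h (t i)))) y.
  move=> h; have [V V0 hV] := dle_ge h.
  apply: (@abs_cvgC _ _ (V * B / (b - a))) => n.
  rewrite ler_pdivlMr // mulr_suml.
  apply: (@le_trans _ _ (\sum_(i < n) V * (maj b (t i) - maj a (t i)))); last first.
    by rewrite -mulr_sumr ler_wpM2l // ltW.
  apply: ler_sum => i _; apply: le_trans (maj_dt _ a0' ab' (ltW V0) hV).
  by rewrite ler_wpM2r ?(ltW ba) // ev_maj.
exists l => //; split.
- exists (B / (b - a) ^+ 2), (b - a); split=> //.
    by rewrite divr_ge0 ?exprn_ge0 // ltW.
  move=> h k k0 kba hk.
  pose c := k / (b - a).
  have c0 : 0 <= c by rewrite divr_ge0 // ltW.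
  have c1 : c <= 1 by rewrite ler_pdivrMr // mul1r.
  have hc : dle (c * (b - a)) h by rewrite /c divfK // gt_eqF.
  have hxh : dle b (x + h).
    by apply: dleW (dleD ha hk); lra.
  have hxb : dle b x by exact: dleW ha.
  apply: (clim_bound (climB (climB (tx _ hxh) (tx _ hxb)) (hl h))) => n.
  rewrite /psum -!sumrB.
  apply: le_trans (ler_nrm_sum _ _ _) _.
  rewrite (_ : B / (b - a) ^+ 2 * k ^+ 2 = c ^+ 2 * B); last first.
    by rewrite /c expr_div_n; ring.
  apply: le_trans (ler_wpM2l _ (hB' n)); last by rewrite exprn_ge0.
  by rewrite mulr_sumr; apply: ler_sum => i _; exact: ev_quad.
- move=> c h; apply: clim_uniq (hl _) _.
  apply: clim_eq (climM (clim_cst c) (hl h)) => n.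
  by rewrite /psum mulr_sumr; under [RHS]eq_bigr do rewrite ev_dtZ.
- move=> h v; apply: clim_uniq (hl _) _.
  apply: clim_eq (climD (hl h) (hl v)) => n.
  by rewrite /psum -big_split; under [RHS]eq_bigr do rewrite ev_dtD.
Qed.

Lemma An_is_dif r f x : An r f -> 0 < r -> dlt r x -> is_dif f x (dif f x).
Proof.
move=> [t ht] r0 hx; have [l hl _] := rep_is_dif ht r0 hx.
by rewrite (is_difE hl).
Qed.

Lemma rep_dif r t f h : rep r t f -> 0 < r ->
  rep r (fun n => dt h (t n)) (fun x => dif f x h).
Proof.
move=> ht r0 a a0 ar; split; last first.
  move=> x hx; have hx' := dle_dlt ar hx.
  by have [l hl hL] := rep_is_dif ht r0 hx'; rewrite (is_difE hl); exact: hL.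
pose b := (a + r) / 2; have ab : a < b by rewrite /b; lra.
have br : b < r by rewrite /b; lra.
have [[B hB] _] := ht b (lt_trans a0 ab) br.
have [V V0 hV] := dle_ge h.
have ba : 0 < b - a by rewrite subr_gt0.
exists (V * B / (b - a)) => n.
rewrite ler_pdivlMr // mulr_suml.
apply: (@le_trans _ _ (\sum_(i < n) V * maj b (t i))); last first.
  by rewrite -mulr_sumr ler_wpM2l // ltW.
apply: ler_sum => i _.
apply: le_trans (maj_dt _ (ltW a0) (ltW ab) (ltW V0) hV) _.
by rewrite ler_wpM2l ?(ltW V0) // lerBlDr lerDl maj_ge0 // ltW.
Qed.

Lemma An_dif r f h : An r f -> 0 < r -> An r (fun x => dif f x h).
Proof. by move=> [t ht] r0; exists (fun n => dt h (t n)); exact: rep_dif. Qed.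

(** Second derivatives commute because they do so on expressions. *)
Lemma dif_sym r f x h v : An r f -> 0 < r -> dlt r x ->
  dif (fun y => dif f y h) x v = dif (fun y => dif f y v) x h.
Proof.
move=> [t ht] r0 hx; have [a [a0 ar ha]] := dlt_dle r0 hx.
have [_ /(_ x ha) h1] := rep_dif v (rep_dif h ht r0) r0 a0 ar.
have [_ /(_ x ha) h2] := rep_dif h (rep_dif v ht r0) r0 a0 ar.
apply: clim_uniq h1 _; apply: clim_eq h2 => n.
by rewrite /psum; under eq_bigr do rewrite ev_dt_sym.
Qed.

(** The estimates of is_dif hold with constants that are uniform on a closed
    polydisc; this is what the mean value inequality needs. *)
Lemma An_taylor r f a : An r f -> 0 < a -> a < r -> exists B d,
  [/\ 0 <= B, 0 < d,
    forall x h k, dle a x -> 0 <= k -> k <= d -> dle k h ->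
      nrm (f (x + h) - f x - dif f x h) <= B * k ^+ 2 &
    forall x h k, dle a x -> 0 <= k -> dle k h -> nrm (dif f x h) <= B * k].
Proof.
move=> [t ht] a0 ar; have r0 := lt_trans a0 ar; have a0' := ltW a0.
pose b := (a + r) / 2; have ab : a < b by rewrite /b; lra.
have ab' := ltW ab.
have b0 : 0 < b by exact: lt_trans ab.
have br : b < r by rewrite /b; lra.
have [[B hB] tx] := ht b b0 br.
have B0 : 0 <= B by have := hB 0%N; rewrite big_ord0.
have hB' n : \sum_(i < n) (maj b (t i) - maj a (t i)) <= B.
  apply: le_trans (hB n); apply: ler_sum => i _.
  by rewrite lerBlDr lerDl maj_ge0.
have ba : 0 < b - a by rewrite subr_gt0.
pose D := B / (b - a) ^+ 2 + B / (b - a).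
have D0 : 0 <= D by rewrite addr_ge0 // divr_ge0 ?exprn_ge0 // ltW.
exists D, (b - a); split=> //.
- move=> x h k hx k0 kba hk; have hx' := dle_dlt ar hx.
  pose c := k / (b - a).
  have c0 : 0 <= c by rewrite divr_ge0 // ltW.
  have c1 : c <= 1 by rewrite ler_pdivrMr // mul1r.
  have hc : dle (c * (b - a)) h by rewrite /c divfK // gt_eqF.
  have hxh : dle b (x + h) by apply: dleW (dleD hx hk); lra.
  have hxb : dle b x by exact: dleW hx.
  have [l hl hL] := rep_is_dif ht r0 hx'; rewrite (is_difE hl).
  apply: (clim_bound (climB (climB (tx _ hxh) (tx _ hxb)) (hL h))) => n.
  rewrite /psum -!sumrB.
  apply: le_trans (ler_nrm_sum _ _ _) _.
  apply: (@le_trans _ _ (c ^+ 2 * B)); last first.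
    rewrite /D mulrDl (_ : c ^+ 2 * B = B / (b - a) ^+ 2 * k ^+ 2); last first.
      by rewrite /c expr_div_n; ring.
    by rewrite lerDl mulr_ge0 ?exprn_ge0 // divr_ge0 // ltW.
  apply: le_trans (ler_wpM2l _ (hB' n)); last by rewrite exprn_ge0.
  by rewrite mulr_sumr; apply: ler_sum => i _; exact: ev_quad.
- move=> x h k hx k0 hk; have hx' := dle_dlt ar hx.
  have [l hl hL] := rep_is_dif ht r0 hx'; rewrite (is_difE hl).
  apply: (clim_bound (hL h)) => n; apply: le_trans (ler_nrm_sum _ _ _) _.
  apply: (@le_trans _ _ (B / (b - a) * k)); last first.
    by rewrite /D mulrDl lerDr mulr_ge0 // divr_ge0 ?exprn_ge0 // ltW.
  rewrite mulrAC ler_pdivlMr // mulr_suml mulrC.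
  apply: le_trans (ler_wpM2l k0 (hB' n)).
  rewrite mulr_sumr; apply: ler_sum => i _.
  apply: le_trans (maj_dt _ a0' ab' k0 hk).
  by rewrite ler_wpM2r ?(ltW ba) // ev_maj.
Qed.

(** Mean value inequality: the segment is cut into n pieces, on each of which the
    increment is the differential up to O(1/n^2), and n tends to infinity. *)
Lemma An_mvt r f x h L : An r f -> 0 < r -> dlt r x -> dlt r (x + h) ->
  (forall s, 0 <= s <= 1 -> nrm (dif f (x + RtoC s *: h) h) <= L) ->
  nrm (f (x + h) - f x) <= L.
Proof.
move=> hf r0 hx hxh hL.
have [a1 [a10 a1r ha1]] := dlt_dle r0 hx.
have [a2 [a20 a2r ha2]] := dlt_dle r0 hxh.
pose a := Num.max a1 a2.
have a0 : 0 < a by rewrite lt_max a10.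
have ar : a < r by rewrite gt_max a1r.
have hs s : 0 <= s <= 1 -> dle a (x + RtoC s *: h).
  move=> /andP[s0 s1] i.
  have -> : (x + RtoC s *: h) i 0 = RtoC (1 - s) * x i 0 + RtoC s * (x + h) i 0.
    by rewrite !mxE /RtoC rmorphB rmorph1; ring.
  apply: le_trans (ler_nrmD _ _) _; rewrite !nrmM !nrm_RtoC.
  rewrite !ger0_norm ?subr_ge0 //.
  have h1 : nrm (x i 0) <= a by apply: le_trans (ha1 i) _; rewrite le_max lexx.
  have h2 : nrm ((x + h) i 0) <= a.
    by apply: le_trans (ha2 i) _; rewrite le_max lexx orbT.
  have h3 := ler_wpM2l s0 h2.
  have h4 : (1 - s) * nrm (x i 0) <= (1 - s) * a by rewrite ler_wpM2l ?subr_ge0.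
  by lra.
have [B [d [B0 d0 hB _]]] := An_taylor hf a0 ar.
have [V V0 hV] := dle_ge h.
apply/ler_addgt0Pr => e e0.
pose M := Num.max (V / d) (B * V ^+ 2 / e).
have [n0 hn0] : exists n, M < n.+1%:R.
  by exists (Num.truncn M); exact: truncnS_gt.
pose n := n0.+1; have n_gt0 : 0 < n%:R :> R by rewrite ltr0n.
pose q : R := n%:R^-1.
have q0 : 0 < q by rewrite invr_gt0.
have kd : q * V <= d.
  rewrite /q mulrC ler_pdivrMr // mulrC -ler_pdivrMr //.
  by apply: le_trans (ltW hn0); rewrite le_max lexx.
have ke : B * V ^+ 2 * q <= e.
  rewrite /q ler_pdivrMr // [e * _]mulrC -ler_pdivrMr //.
  by apply: le_trans (ltW hn0); rewrite le_max lexx orbT.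
have step j : (j < n)%N -> nrm (f (x + RtoC (j.+1%:R * q) *: h)
    - f (x + RtoC (j%:R * q) *: h)) <= q * (L + e).
  move=> jn; set y := x + RtoC (j%:R * q) *: h.
  have h01 : 0 <= j%:R * q <= 1.
    rewrite mulr_ge0 ?ler0n ?(ltW q0) //= /q ler_pdivrMr // mul1r ler_nat.
    exact: ltnW.
  have -> : x + RtoC (j.+1%:R * q) *: h = y + RtoC q *: h.
    by rewrite /y -addrA -scalerDl -RtoCD -natr1 mulrDl mul1r.
  have hq : dle (q * V) (RtoC q *: h).
    by have := dleZ (RtoC q) hV; rewrite nrm_RtoC gtr0_norm.
  have h1 := hB y _ _ (hs _ h01) (mulr_ge0 (ltW q0) (ltW V0)) kd hq.
  have [_ hlin _] := An_is_dif hf r0 (dle_dlt ar (hs _ h01)).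
  have h2 : nrm (dif f y (RtoC q *: h)) <= q * L.
    by rewrite hlin nrmM nrm_RtoC gtr0_norm // ler_pM2l // hL.
  have -> : f (y + RtoC q *: h) - f y =
    (f (y + RtoC q *: h) - f y - dif f y (RtoC q *: h)) + dif f y (RtoC q *: h).
    by rewrite subrK.
  apply: le_trans (ler_nrmD _ _) _; apply: le_trans (lerD h1 h2) _.
  rewrite mulrDr addrC lerD2l exprMn.
  rewrite (_ : B * (q ^+ 2 * V ^+ 2) = q * (B * V ^+ 2 * q)); last by ring.
  by rewrite ler_pM2l.
have H j : (j <= n)%N -> nrm (f (x + RtoC (j%:R * q) *: h) - f x) <= j%:R * (q * (L + e)).
  elim: j => [|j ih] jn; first by rewrite !mul0r RtoC0 scale0r addr0 subrr nrm0.
  apply: le_trans (nrm_tri _ (f (x + RtoC (j%:R * q) *: h)) _) _.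
  rewrite (_ : j.+1%:R * (q * (L + e)) = q * (L + e) + j%:R * (q * (L + e))).
    by apply: lerD; [exact: step | apply: ih; exact: ltnW].
  by rewrite -natr1; ring.
have := H n (leqnn _); rewrite /q !mulrA divff ?gt_eqF // mul1r.
by rewrite RtoC1 scale1r.
Qed.

End OneArity.

Lemma An_subst m m' r r' (th : 'I_m -> pterm R m') f :
  (forall a, 0 < a -> a < r' -> exists b, [/\ 0 < b, b < r &
     forall i, maj a (th i) <= b]) ->
  An r f -> An r' (fun x => f (\col_i ev x (th i))).
Proof.
move=> hth [t ht]; exists (fun n => subst th (t n)) => a a0 ar.
have [b [b0 br hb]] := hth a a0 ar; have [[B hB] tx] := ht b b0 br; split.
  exists B => n; apply: le_trans (hB n); apply: ler_sum => i _.
  by apply: maj_subst => //; exact: ltW.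
move=> x hx; have hc : dle b (\col_i ev x (th i)).
  by move=> i; rewrite mxE; exact: le_trans (ev_maj _ (ltW a0) hx) (hb i).
apply: clim_eq (tx _ hc) => n.
by rewrite /psum; under [RHS]eq_bigr do rewrite ev_subst.
Qed.

Lemma dle_col m1 m2 b (x : 'cV[C]_m1) (y : 'cV[C]_m2) :
  dle b x -> dle b y -> dle b (col_mx x y).
Proof.
move=> hx hy i; rewrite -(splitK i); case: (fintype.split i) => j /=.
  by rewrite col_mxEu.
by rewrite col_mxEd.
Qed.

Lemma dlt_col m1 m2 b (x : 'cV[C]_m1) (y : 'cV[C]_m2) :
  dlt b x -> dlt b y -> dlt b (col_mx x y).
Proof.
move=> hx hy i; rewrite -(splitK i); case: (fintype.split i) => j /=.
  by rewrite col_mxEu.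
by rewrite col_mxEd.
Qed.

End AnalyticClass.

(** * Division by the variables and the identity principle *)

Section Limits.
Variable R : realType.
Local Notation C := (Cx R).

Lemma clim_unshift (u : nat -> C) (l : C) : clim (fun n => u n.+1) l -> clim u l.
Proof. by move=> h e e0; have [N hN] := h e e0; exists N.+1 => -[//|n] Nn; exact: hN. Qed.

Lemma clim_sum I (s : seq I) (u : I -> nat -> C) (l : I -> C) :
  (forall i, clim (u i) (l i)) ->
  clim (fun n => \sum_(i <- s) u i n) (\sum_(i <- s) l i).
Proof.
move=> h; elim: s => [|i s ih].
  by rewrite big_nil; apply: clim_eq (clim_cst 0) => n; rewrite big_nil.
by rewrite big_cons; apply: clim_eq (climD (h i) ih) => n; rewrite big_cons.
Qed.

End Limits.

Section Quotient.
Variables (R : realType) (m : nat).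
Local Notation C := (Cx R).
Implicit Types (t : nat -> pterm R m) (x h : 'cV[C]_m) (a b r : R)
  (f g : 'cV[C]_m -> C).

(** Division by the i-th variable: t(x) = t(0) + sum_i x_i (qt i t)(x). For a product,
    t u - t(0) u(0) = (t - t(0)) u + t(0) (u - u(0)). *)
Fixpoint qt (i : 'I_m) (t : pterm R m) : pterm R m :=
  match t with
  | Cst c => Cst 0
  | Vr j => Cst (i == j)%:R
  | Ad t u => Ad (qt i t) (qt i u)
  | Ml t u => Ad (Ml (qt i t) u) (Ml (Cst (ev 0 t)) (qt i u))
  end.

Lemma ev_qt x (t : pterm R m) :
  ev x t = ev 0 t + \sum_i x i 0 * ev x (qt i t).
Proof.
elim: t => [c|j|t ht u hu|t ht u hu] /=.
- by rewrite big1 ?addr0 // => i _; rewrite mulr0.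
- rewrite mxE add0r (bigD1 j) //= eqxx mulr1 big1 ?addr0 // => i /negbTE ->.
  by rewrite mulr0.
- rewrite {1}ht {1}hu addrACA -big_split /=; congr (_ + _).
  by apply: eq_bigr => i _; rewrite mulrDr.
- have -> : \sum_i x i 0 * (ev x (qt i t) * ev x u + ev 0 t * ev x (qt i u))
    = (\sum_i x i 0 * ev x (qt i t)) * ev x u
      + ev 0 t * (\sum_i x i 0 * ev x (qt i u)).
    rewrite mulr_suml mulr_sumr -big_split /=; apply: eq_bigr => i _; ring.
  move: hu; set s := \sum_i _ * ev x (qt i u) => hu.
  by rewrite {1}ht {1}mulrDl {1}hu; ring.
Qed.

(** The point of qt: division by a variable divides the majorant by the radius. *)
Lemma maj_qt a i (t : pterm R m) : 0 <= a ->
  a * maj a (qt i t) <= maj a t - maj 0 t.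
Proof.
move=> a0; elim: t => [c|j|t ht u hu|t ht u hu] /=.
- by rewrite nrm0 mulr0 subrr.
- rewrite subr0; case: (i == j); rewrite ?nrm1 ?nrm0 ?mulr1 ?mulr0 //.
- by rewrite mulrDr; lra.
- have h1 : nrm (ev 0 t) <= maj 0 t by apply: ev_maj => //; exact: dle0.
  have h2 := maj_ge0 u a0; have h3 := maj_ge0 (qt i u) a0.
  have h4 : 0 <= maj 0 t by exact: maj_ge0.
  have h5 := ler_wpM2r h2 ht; have h6 := ler_wpM2l h4 hu.
  have h7 := ler_wpM2r (mulr_ge0 a0 h3) h1.
  by nra.
Qed.

Lemma maj_qt_le a i (t : pterm R m) : 0 < a -> maj a (qt i t) <= maj a t / a.
Proof.
move=> a0; rewrite ler_pdivlMr // mulrC.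
apply: le_trans (maj_qt i t (ltW a0)) _.
by rewrite lerBlDr lerDl maj_ge0.
Qed.

Lemma rep_qt r t f : rep r t f -> 0 < r ->
  exists q : 'I_m -> 'cV[C]_m -> C, (forall i, rep r (fun n => qt i (t n)) (q i)) /\
    forall x, dlt r x -> f x = f 0 + \sum_i x i 0 * q i x.
Proof.
move=> ht r0.
have bnd a i : 0 < a -> a < r -> exists B, forall n, \sum_(j < n) maj a (qt i (t j)) <= B.
  move=> a0 ar; have [[B hB] _] := ht a a0 ar; exists (B / a) => n.
  apply: (@le_trans _ _ ((\sum_(j < n) maj a (t j)) / a)).
    by rewrite mulr_suml; apply: ler_sum => j _; exact: maj_qt_le.
  by rewrite ler_pM2r ?invr_gt0.
have /choice[q hq] : forall p : 'I_m * 'cV[C]_m, exists y : C,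
    dlt r p.2 -> clim (psum (fun n => ev p.2 (qt p.1 (t n)))) y.
  move=> [i x] /=; have [hx|hx] := pselect (dlt r x); last by exists 0.
  have [a [a0 ar ha]] := dlt_dle r0 hx; have [B hB] := bnd a i a0 ar.
  have [|l hl] := @abs_cvgC _ (fun n => ev x (qt i (t n))) B; last by exists l.
  move=> n; apply: le_trans (hB n); apply: ler_sum => j _.
  by apply: ev_maj => //; exact: ltW.
exists (fun i x => q (i, x)); split.
  move=> i a a0 ar; split; first exact: bnd.
  by move=> x hx; apply: (hq (i, x)); exact: dle_dlt hx.
move=> x hx.
have [a [a0 ar ha]] := dlt_dle r0 hx; have [_ tx] := ht a a0 ar.
apply: clim_uniq (tx x ha) _.
have lim_sum : clim (fun n => \sum_i x i 0 * psum (fun n => ev x (qt i (t n))) n)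
    (\sum_i x i 0 * q (i, x)).
  apply: clim_sum => i.
  by apply: climM; [exact: clim_cst | exact: (hq (i, x))].
have l0 := tx 0 (dle0 (ltW a0)).
apply: clim_eq (climD l0 lim_sum) => n; rewrite /psum.
under [RHS]eq_bigr do rewrite ev_qt.
rewrite big_split /=; congr (_ + _).
by rewrite exchange_big /=; apply: eq_bigr => i _; rewrite mulr_sumr.
Qed.

Lemma An_lip r f a : An r f -> 0 < a -> a < r -> exists B d,
  [/\ 0 <= B, 0 < d & forall x h k, dle a x -> 0 <= k -> k <= d -> dle k h ->
      nrm (f (x + h) - f x) <= B * k].
Proof.
move=> hf a0 ar; have [B [d [B0 d0 h1 h2]]] := An_taylor hf a0 ar.
exists (2 * B), (Num.min 1 d); split; rewrite ?mulr_ge0 ?lt_min ?ltr01 //.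
move=> x h k hx k0; rewrite le_min => /andP[k1 kd] hk.
have := h1 _ _ _ hx k0 kd hk; have := h2 _ _ _ hx k0 hk => e1 e2.
rewrite -(subrK (dif f x h) (f (x + h) - f x)).
apply: le_trans (ler_nrmD _ _) _.
have : B * k ^+ 2 <= B * k by rewrite ler_wpM2l // expr2 ler_piMl.
by lra.
Qed.

End Quotient.

Section Identity.
Variable R : realType.
Local Notation C := (Cx R).

(** A function of one variable that vanishes on the positive reals near 0 vanishes at
    0 by continuity, so it is the variable times a quotient that again vanishes there.
    Each division gains a factor |x| / a. *)
Lemma one_var_vanish_iter n r a d t (f : 'cV[C]_1 -> C) B : 0 < a -> a < r -> 0 < d ->
  d <= r -> rep r t f -> (forall k, \sum_(i < k) maj a (t i) <= B) ->
  (forall s : R, 0 < s -> s < d -> f (const_mx (RtoC s)) = 0) ->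
  forall x, dle a x -> nrm (f x) <= (nrm (x 0 0) / a) ^+ n * B.
Proof.
move=> a0 ar d0 dr; elim: n t f B => [|n ih] t f B ht hB hf x hx.
  have [_ /(_ x hx) tx] := ht a a0 ar; rewrite expr0 mul1r.
  apply: clim_bound tx _ => n; apply: le_trans (hB n).
  apply: le_trans (ler_nrm_sum _ _ _) _; apply: ler_sum => i _.
  by apply: ev_maj => //; exact: ltW.
have r0 := lt_trans a0 ar.
have f0 : f 0 = 0.
  have [L [k0 [L0 k00 hL]]] := An_lip (ex_intro _ t ht) a0 ar.
  apply/eqP; rewrite -nrm_eq0 eq_le nrm_ge0 andbT; apply/ler_addgt0Pr => e e0.
  rewrite add0r; pose s := Num.min (Num.min k0 (d / 2)) (e / (L + 1)).
  have L1 : 0 < L + 1 by lra.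
  have s0 : 0 < s by rewrite !lt_min k00 !divr_gt0.
  have sk : s <= k0 by rewrite !ge_min lexx.
  have sd : s <= d / 2 by rewrite !ge_min lexx orbT.
  have se : s * (L + 1) <= e by rewrite -ler_pdivlMr // !ge_min lexx !orbT.
  have hs : dle s (const_mx (RtoC s) : 'cV[C]_1).
    by move=> i; rewrite mxE nrm_RtoC gtr0_norm.
  have := hL 0 _ s (dle0 (ltW a0)) (ltW s0) sk hs.
  rewrite add0r hf //; last by lra.
  rewrite sub0r nrmN => h; apply: le_trans h _; apply: le_trans se.
  by rewrite mulrDr mulr1 mulrC lerDl ltW.
have [q [hq hfq]] := rep_qt ht r0.
have fE y : dlt r y -> f y = y 0 0 * q 0 y.
  by move=> hy; rewrite hfq // f0 add0r big_ord1.
have bq k : \sum_(i < k) maj a (qt 0 (t i)) <= B / a.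
  apply: (@le_trans _ _ ((\sum_(j < k) maj a (t j)) / a)).
    by rewrite mulr_suml; apply: ler_sum => j _; exact: maj_qt_le.
  by rewrite ler_pM2r ?invr_gt0.
have q0 s : 0 < s -> s < d -> q 0 (const_mx (RtoC s)) = 0.
  move=> s0 sd; have := fE (const_mx (RtoC s)).
  rewrite hf // mxE => /(_ _)/esym/eqP.
  rewrite mulf_eq0 -nrm_eq0 nrm_RtoC gtr0_norm // gt_eqF //= => h.
  apply/eqP/h => i; rewrite mxE nrm_RtoC gtr0_norm //.
  exact: lt_le_trans dr.
have h := ih _ _ _ (hq 0) bq q0 x hx.
rewrite fE ?nrmM; last exact: dle_dlt hx.
apply: le_trans (ler_wpM2l (nrm_ge0 _) h) _.
by rewrite le_eqVlt exprS; apply/orP; left; apply/eqP; field; rewrite gt_eqF.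
Qed.

Lemma one_var_vanish r d (f : 'cV[C]_1 -> C) : 0 < r -> 0 < d -> An r f ->
  (forall s : R, 0 < s -> s < d -> f (const_mx (RtoC s)) = 0) ->
  forall x, dlt r x -> f x = 0.
Proof.
move=> r0 d0 [t ht] hf x hx; have [a1 [a10 a1r ha1]] := dlt_dle r0 hx.
pose a := (a1 + r) / 2; have a0 : 0 < a by rewrite /a; lra.
have ar : a < r by rewrite /a; lra.
have a1a : a1 < a by rewrite /a; lra.
have [[B hB] _] := ht a a0 ar.
have B0 : 0 <= B by have := hB 0%N; rewrite big_ord0.
pose d' := Num.min d r.
have d'0 : 0 < d' by rewrite lt_min d0.
have d'r : d' <= r by rewrite ge_min lexx orbT.
have hf' s : 0 < s -> s < d' -> f (const_mx (RtoC s)) = 0.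
  by move=> s0; rewrite lt_min => /andP[sd _]; exact: hf.
have H n := @one_var_vanish_iter n r a d' t f B a0 ar d'0 d'r ht hB hf' x
  (dleW (ltW a1a) ha1).
pose q := nrm (x 0 0) / a.
have q0 : 0 <= q by rewrite divr_ge0 ?nrm_ge0 // ltW.
have q1 : q < 1 by rewrite ltr_pdivrMr // mul1r; exact: le_lt_trans (ha1 0) _.
apply/eqP; rewrite -nrm_eq0 eq_le nrm_ge0 andbT; apply/ler_addgt0Pr => e e0.
rewrite add0r.
have B1 : 0 < B + 1 by lra.
have : (fun n => q ^+ n) @ \oo --> 0 by apply: cvg_expr; rewrite ger0_norm.
move=> /cvgrPdist_lt/(_ (e / (B + 1))); rewrite divr_gt0 // => /(_ isT).
case=> N _ /(_ N (leqnn _)); rewrite sub0r normrN ger0_norm ?exprn_ge0 //.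
rewrite ltr_pdivlMr // => /ltW h; apply: le_trans (H N) _; apply: le_trans h.
by rewrite ler_wpM2l ?exprn_ge0 // lerDl.
Qed.

(** Identity principle on the totally real slice y = conj x. Writing x = s + i t and
    y = s - i t, a point (x, y) near 0 is the value at lambda = i of the complex line
    s = Re s + lambda Im s, t = Re t + lambda Im t, and real lambda give points of the
    slice; the principle in one variable applies to the restriction to that line. *)
Lemma An_real_slice m r d (f : 'cV[C]_(m + m) -> C) : 0 < r -> 0 < d -> An r f ->
  (forall x, dlt d x -> f (col_mx x (conj_mx x)) = 0) ->
  forall X, dlt (Num.min r d / 8) X -> f X = 0.
Proof.
move=> r0 d0 hf hfx X hX; pose e := Num.min r d / 8.
have e0 : 0 < e by rewrite divr_gt0 // lt_min r0.
have er : e * 8 <= r by rewrite divfK ?pnatr_eq0 // ge_min lexx.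
have ed : e * 8 <= d by rewrite divfK ?pnatr_eq0 // ge_min lexx orbT.
pose x := usubmx X; pose y := dsubmx X.
have hx i : nrm (x i 0) <= e by rewrite mxE ltW.
have hy i : nrm (y i 0) <= e by rewrite mxE ltW.
pose s i : C := (x i 0 + y i 0) / 2; pose t i : C := (x i 0 - y i 0) / (2 * 'i).
have n2 : nrm (2 : C) = 2.
  by rewrite -[2]/(1 + 1) -RtoC1 -RtoCD nrm_RtoC ger0_norm.
have inv2 : nrm (2^-1 : C) = 2^-1.
  have h : nrm (2 * 2^-1 : C) = 1 by rewrite divff ?pnatr_eq0 // nrm1.
  by move: h; rewrite nrmM n2 => h; apply: (@mulfI _ 2); rewrite ?pnatr_eq0 // h divff ?pnatr_eq0.
have inv2i : nrm ((2 * 'i)^-1 : C) = 2^-1.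
  rewrite invfM nrmM inv2; have h : nrm ('i * 'i^-1 : C) = 1.
    by rewrite divff ?neq0Ci // nrm1.
  by move: h; rewrite nrmM nrmi mul1r => ->; rewrite mulr1.
have hs i : nrm (s i) <= e.
  rewrite nrmM inv2 ler_pdivrMr //; apply: le_trans (ler_nrmD _ _) _.
  by have := hx i; have := hy i; lra.
have ht i : nrm (t i) <= e.
  rewrite nrmM inv2i ler_pdivrMr //; apply: le_trans (ler_nrmB _ _) _.
  by have := hx i; have := hy i; lra.
pose re (z : C) : C := RtoC (complex.Re z); pose im (z : C) : C := RtoC (complex.Im z).
have zE (z : C) : z = re z + 'i * im z.
  by case: z => u v; apply/eqP; rewrite eq_complex /=;
     rewrite !(mul0r, mulr0, mul1r, subr0, addr0, add0r, eqxx).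
have hre z : nrm (re z) <= nrm z by rewrite nrm_RtoC nrm_Re.
have him z : nrm (im z) <= nrm z by rewrite nrm_RtoC nrm_Im.
pose A := col_mx (\col_i (re (s i) + 'i * re (t i))) (\col_i (re (s i) - 'i * re (t i)))
  : 'cV[C]_(m + m).
pose B := col_mx (\col_i (im (s i) + 'i * im (t i))) (\col_i (im (s i) - 'i * im (t i)))
  : 'cV[C]_(m + m).
have hA i : nrm (A i 0) <= 2 * e.
  rewrite -(splitK i); case: (fintype.split i) => j /=.
    rewrite col_mxEu mxE; apply: le_trans (ler_nrmD _ _) _; rewrite nrmM nrmi mul1r.
    by have := hre (s j); have := hre (t j); have := hs j; have := ht j; lra.
  rewrite col_mxEd mxE; apply: le_trans (ler_nrmB _ _) _; rewrite nrmM nrmi mul1r.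
  by have := hre (s j); have := hre (t j); have := hs j; have := ht j; lra.
have hB i : nrm (B i 0) <= 2 * e.
  rewrite -(splitK i); case: (fintype.split i) => j /=.
    rewrite col_mxEu mxE; apply: le_trans (ler_nrmD _ _) _; rewrite nrmM nrmi mul1r.
    by have := him (s j); have := him (t j); have := hs j; have := ht j; lra.
  rewrite col_mxEd mxE; apply: le_trans (ler_nrmB _ _) _; rewrite nrmM nrmi mul1r.
  by have := him (s j); have := him (t j); have := hs j; have := ht j; lra.
(* A + lambda B is the complex line through (x, y). *)
pose th (i : 'I_(m + m)) : pterm R 1 := Ad (Cst (A i 0)) (Ml (Cst (B i 0)) (Vr 0)).
have hg : An 2 (fun l : 'cV[C]_1 => f (\col_i ev l (th i))).
  apply: An_subst hf => a a0 a2; exists (6 * e); split; [lra|lra|].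
  move=> i /=; have := hA i; have := hB i; have := nrm_ge0 (B i 0).
  move: (nrm _) (nrm _) => p q p0 p1 q1.
  have : q * a <= 2 * e * 2 by rewrite ler_pM // ltW.
  by lra.
have g0 : forall l, dlt 2 l -> f (\col_i ev l (th i)) = 0.
  apply: (one_var_vanish _ ltr01 hg) => // u u0 u1.
  pose z : 'cV[C]_m := \col_i (re (s i) + RtoC u * im (s i)
     + 'i * (re (t i) + RtoC u * im (t i))).
  have -> : \col_i ev (const_mx (RtoC u)) (th i) = col_mx z (conj_mx z).
    have conjR (v : R) : (RtoC v)^* = RtoC v :> C.
      by apply/eqP; rewrite eq_complex /= oppr0 !eqxx.
    apply/colP => i; rewrite !mxE /=; rewrite -{1 2}(splitK i).
    case: (fintype.split i) => j /=; rewrite ?col_mxEu ?col_mxEd !mxE; first by ring.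
    rewrite !(rmorphD, rmorphM) /= !conjR conjCi; ring.
  apply: hfx => i; rewrite mxE.
  apply: (@le_lt_trans _ _ (4 * e)); last by lra.
  have hu : nrm (RtoC u) <= 1 by rewrite nrm_RtoC gtr0_norm // ltW.
  apply: le_trans (ler_nrmD _ _) _; rewrite nrmM nrmi mul1r.
  have bb w : nrm w <= e -> nrm (re w + RtoC u * im w) <= 2 * e.
    move=> hw; apply: le_trans (ler_nrmD _ _) _; rewrite nrmM.
    have h1 := hre w; have h2 := him w.
    have : nrm (RtoC u) * nrm (im w) <= 1 * nrm (im w) by rewrite ler_wpM2r ?nrm_ge0.
    lra.
  by have := bb _ (hs i); have := bb _ (ht i); lra.
have -> : X = \col_i ev (const_mx 'i) (th i).
  apply/colP => i; rewrite [RHS]mxE /= [const_mx _ _ _]mxE.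
  have := splitK i; case: (fintype.split i) => j /= <-.
    rewrite !col_mxEu ![(\col_i0 _) j _]mxE.
    have -> : X (lshift m j) 0 = s j + 'i * t j.
      by rewrite /s /t /x /y !mxE; field; rewrite neq0Ci.
    by rewrite {1}(zE (s j)) {1}(zE (t j)); ring.
  rewrite !col_mxEd ![(\col_i0 _) j _]mxE.
  have -> : X (rshift m j) 0 = s j - 'i * t j.
    by rewrite /s /t /x /y !mxE; field; rewrite neq0Ci.
  by rewrite {1}(zE (s j)) {1}(zE (t j)); ring.
by apply: g0 => i; rewrite mxE nrmi ltr1n.
Qed.

End Identity.

(** * Reciprocals of analytic functions *)

Section Inverse.
Variables (R : realType) (m : nat).
Local Notation C := (Cx R).
Implicit Types (s t : nat -> pterm R m) (x h : 'cV[C]_m) (a b r : R)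
  (e f g : 'cV[C]_m -> C).

(** The pair (G n, d n): G n is the n-th iterate from 0 of G |-> 1 + e G, in which e is
    replaced at the n-th step by the n-th partial sum of s, and d n = G n.+1 - G n. *)
Fixpoint geom s n : pterm R m * pterm R m :=
  if n is k.+1 then
    let: (G, d) := geom s k in
    (Ad G d, Ad (Ml (s k) (Ad G d)) (Ml (pst s k) d))
  else (Cst 0, Cst 1).

Lemma ev_geom1S s x n :
  ev x (geom s n.+1).1 = ev x (geom s n).1 + ev x (geom s n).2.
Proof. by rewrite /=; case: (geom s n). Qed.

Lemma ev_geom2S s x n : ev x (geom s n.+1).2 =
  ev x (s n) * ev x (geom s n.+1).1 + ev x (pst s n) * ev x (geom s n).2.
Proof. by rewrite /=; case: (geom s n). Qed.

Lemma maj_geom1S s a n :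
  maj a (geom s n.+1).1 = maj a (geom s n).1 + maj a (geom s n).2.
Proof. by rewrite /=; case: (geom s n). Qed.

Lemma maj_geom2S s a n : maj a (geom s n.+1).2 =
  maj a (s n) * maj a (geom s n.+1).1 + maj a (pst s n) * maj a (geom s n).2.
Proof. by rewrite /=; case: (geom s n). Qed.

Arguments geom : simpl never.

Lemma ev_geom s x n : ev x (geom s n).1 = psum (fun i => ev x (geom s i).2) n.
Proof. by elim: n => [|n ih]; rewrite ?psumS -?ih ?ev_geom1S // /psum big_ord0. Qed.

Lemma maj_geom s a n : maj a (geom s n).1 = \sum_(i < n) maj a (geom s i).2.
Proof.
elim: n => [|n ih]; first by rewrite big_ord0 /geom /= nrm0.
by rewrite big_ord_recr -ih maj_geom1S.
Qed.

Lemma ev_geomS s x n :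
  ev x (geom s n.+1).1 = 1 + ev x (pst s n) * ev x (geom s n).1.
Proof.
elim: n => [|n ih]; first by rewrite /geom /= mul0r addr0 add0r.
by rewrite (ev_geom1S s x n.+1) {1}ih ev_geom2S ev_geom1S /=; ring.
Qed.

(** The bound 2 is stable under one step because 1 + 2/4 + 2/4 = 2. *)
Lemma maj_geom_le s a n : 0 <= a -> (forall n, \sum_(i < n) maj a (s i) <= 1 / 4) ->
  maj a (geom s n.+1).1 <= 1 + 2 * (\sum_(i < n) maj a (s i)) + maj a (geom s n).1 / 4
  /\ maj a (geom s n).1 <= 2.
Proof.
move=> a0 hs; elim: n => [|n [ih1 ih2]].
  by rewrite big_ord0 /geom /= nrm0 nrm1; split; lra.
have h2 : maj a (geom s n.+1).1 <= 2.
  by apply: le_trans ih1 _; have := hs n; lra.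
split=> //.
rewrite (maj_geom1S s a n.+1) maj_geom2S big_ord_recr /= maj_pst.
have p0 := maj_geom1S s a n.
have p1 := maj_ge0 (s n) a0; have p2 := maj_ge0 (geom s n).2 a0.
have p3 := ler_wpM2r p2 (hs n); have p4 := ler_wpM2l p1 h2.
by lra.
Qed.

(** The geometric series 1/(1 - e), for a series s of small majorant. *)
Lemma rep_geom r s e : 0 < r -> rep r s e ->
  (forall a n, 0 < a -> a < r -> \sum_(i < n) maj a (s i) <= 1 / 4) ->
  exists2 g, An r g & forall x, dlt r x -> (1 - e x) * g x = 1.
Proof.
move=> r0 hs hb.
have bnd a n : 0 < a -> a < r -> \sum_(i < n) maj a (geom s i).2 <= 2.
  move=> a0 ar; rewrite -maj_geom.
  by have [] := maj_geom_le n (ltW a0) (fun n => hb a n a0 ar).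
have /choice[g hg] : forall x, exists y : C,
    dlt r x -> clim (psum (fun n => ev x (geom s n).2)) y.
  move=> x; have [hx|hx] := pselect (dlt r x); last by exists 0.
  have [a [a0 ar ha]] := dlt_dle r0 hx.
  have [|l hl] := @abs_cvgC _ (fun n => ev x (geom s n).2) 2; last by exists l.
  move=> n; apply: le_trans (bnd a n a0 ar); apply: ler_sum => j _.
  by apply: ev_maj => //; exact: ltW.
exists g.
  exists (fun n => (geom s n).2) => a a0 ar; split.
    by exists 2 => n; exact: bnd.
  by move=> x hx; apply: hg; exact: dle_dlt hx.
move=> x hx; have [a [a0 ar ha]] := dlt_dle r0 hx.
have [_ /(_ x ha) ex] := hs a a0 ar; have gx := hg x hx.
have : clim (psum (fun n => ev x (geom s n).2)) (1 + e x * g x).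
  apply: clim_unshift.
  apply: clim_eq (climD (clim_cst 1) (climM ex gx)) => n.
  by rewrite -!ev_geom ev_geomS ev_pst.
by move=> /(clim_uniq gx) h; rewrite mulrBl mul1r {1}h addrK.
Qed.

(** Up to the factor f(0), f is 1 - e with e = sum_i x_i q_i, whose majorant is small
    on a small polydisc because each term has a factor x_i. *)
Lemma An_inv r f : 0 < r -> An r f -> f 0 != 0 ->
  exists r', [/\ 0 < r', r' <= r, An r' (fun x => (f x)^-1) &
     forall x, dlt r' x -> f x != 0].
Proof.
move=> r0 [t ht] f0; have [q [hq hfq]] := rep_qt ht r0.
pose b := r / 2; have b0 : 0 < b by rewrite divr_gt0.
have br : b < r by rewrite /b; lra.
pose c := (f 0)^-1; pose k := nrm c.
have k0 : 0 < k by rewrite nrm_gt0 invr_eq0.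
have /choice[Q hQ] : forall i, exists B, forall n, \sum_(j < n) maj b (qt i (t j)) <= B.
  by move=> i; have [] := hq i b b0 br.
have Q0 i : 0 <= Q i by have := hQ i 0%N; rewrite big_ord0.
pose M := k * (\sum_i Q i) + 1.
have M0 : 0 < M by rewrite ltr_wpDl // mulr_ge0 ?sumr_ge0 // ltW.
pose r' := Num.min b (1 / 4 / M).
have r'0 : 0 < r' by rewrite lt_min b0 !divr_gt0.
have r'b : r' <= b by rewrite ge_min lexx.
have r'M : r' * M <= 1 / 4 by rewrite -ler_pdivlMr // ge_min lexx orbT.
pose s n : pterm R m :=
  foldr (fun i u => Ad (Ml (Cst (- c)) (Ml (Vr i) (qt i (t n)))) u) (Cst 0) (enum 'I_m).
pose e x := - c * \sum_i x i 0 * q i x.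
have evs x n : ev x (s n) = - c * \sum_i x i 0 * ev x (qt i (t n)).
  rewrite /s mulr_sumr -[index_enum _]enumT.
  by elim: (enum _) => [|i l ih]; rewrite ?big_nil //= big_cons ih.
have majs a n : maj a (s n) = k * (a * \sum_i maj a (qt i (t n))).
  rewrite /s !mulr_sumr -[index_enum _]enumT.
  by elim: (enum _) => [|i l ih]; rewrite ?big_nil //= ?nrm0 // big_cons ih nrmN.
have bnds a n : 0 < a -> a < r' -> \sum_(i < n) maj a (s i) <= 1 / 4.
  move=> a0 ar; apply: le_trans r'M.
  under eq_bigr do rewrite majs.
  rewrite -mulr_sumr -mulr_sumr exchange_big /=.
  have h : \sum_i \sum_(j < n) maj a (qt i (t j)) <= \sum_i Q i.
    apply: ler_sum => i _; apply: le_trans (hQ i n); apply: ler_sum => j _.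
    by apply: maj_le; [exact: ltW | exact: ltW (lt_le_trans ar r'b)].
  have h0 : 0 <= \sum_i Q i by rewrite sumr_ge0.
  apply: (@le_trans _ _ (k * (r' * \sum_i Q i))).
    apply: ler_wpM2l; first exact: ltW.
    apply: (@le_trans _ _ (a * \sum_i Q i)); first by rewrite ler_wpM2l // ltW.
    by rewrite ler_wpM2r // ltW.
  by rewrite /M mulrDr mulr1 mulrCA lerDl ltW.
have hrs : rep r' s e.
  move=> a a0 ar; split; first by exists (1 / 4) => n; exact: bnds.
  move=> x hx; have ar' : a < r by apply: lt_trans ar (le_lt_trans r'b br).
  have lim_sum : clim (fun n => \sum_i x i 0 * psum (fun n => ev x (qt i (t n))) n)
      (\sum_i x i 0 * q i x).
    apply: clim_sum => i; have [_ hi] := hq i a a0 ar'.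
    by apply: climM; [exact: clim_cst | exact: hi].
  apply: clim_eq (climM (clim_cst (- c)) lim_sum) => n; rewrite /psum.
  under [RHS]eq_bigr do rewrite evs.
  rewrite -[RHS]mulr_sumr exchange_big /=; congr (_ * _).
  by apply: eq_bigr => i _; rewrite mulr_sumr.
have [g hg hge] := rep_geom r'0 hrs bnds.
have r'r : r' <= r by apply: le_trans r'b (ltW br).
have fE x : dlt r' x -> f x * (c * g x) = 1.
  move=> hx; rewrite -(hge x hx) hfq; last exact: dltW hx.
  by rewrite /e /c; field.
have fn0 x : dlt r' x -> f x != 0.
  move=> hx; apply/eqP => fx0; have := fE x hx; rewrite fx0 mul0r => /esym/eqP.
  by rewrite oner_eq0.
exists r'; split=> //.
apply: (@An_ext _ _ _ (fun x => c * g x)); last exact: An_mul (An_cst m r' c) hg.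
by move=> x hx; apply: (mulfI (fn0 x hx)); rewrite fE // divff // fn0.
Qed.

End Inverse.

(** * Power series as analytic functions *)

Section Balls.
Variables (R : realType) (n : nat).
Local Notation C := (Cx R).

Lemma ball_dlt (p q : 'cV[C]_n) (e : R) :
  ball p (RtoC e) q <-> 0 < e /\ dlt e (q - p).
Proof.
split=> -[e0 h]; split; rewrite -?RtoC0 ?RtoC_lt // in e0 *.
  move=> i; have := h i 0; rewrite -ball_normE /= normE RtoC_lt nrm_distC.
  by rewrite !mxE.
move=> i j; rewrite (ord1 j) -ball_normE /= normE RtoC_lt nrm_distC.
by have := h i; rewrite !mxE.
Qed.

Lemma nbhs_dlt (p : 'cV[C]_n) (P : 'cV[C]_n -> Prop) :
  (\forall x \near p, P x) <-> exists2 e : R, 0 < e & forall x, dlt e (x - p) -> P x.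
Proof.
split=> [/nbhs_ballP[[e e'] /=]|[e e0 h]].
  rewrite ltcE /= => /andP[/eqP -> e0] h.
  by exists e => // x hx; apply: h; apply/ball_dlt.
apply/nbhs_ballP; exists (RtoC e) => /=; first by rewrite -RtoC0 RtoC_lt.
by move=> x /ball_dlt[_]; exact: h.
Qed.

Lemma nbhs0_dlt (P : 'cV[C]_n -> Prop) :
  (\forall x \near (0 : 'cV[C]_n), P x) -> exists2 e : R, 0 < e & forall x, dlt e x -> P x.
Proof.
by move=> /nbhs_dlt[e e0 h]; exists e => // x hx; apply: h; rewrite subr0.
Qed.

End Balls.

Section PowerSeries.
Variables (R : realType) (r : nat).
Local Notation C := (Cx R).
Local Notation mi := (multi_index r).

Definition in_box k (q : mi * mi) := [forall i, (q.1 i < k)%N && (q.2 i < k)%N].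

Definition box k : seq (mi * mi) :=
  [seq ([ffun i => nat_of_ord (p.1 i)], [ffun i => nat_of_ord (p.2 i)])
    | p : {ffun 'I_r -> 'I_k} * {ffun 'I_r -> 'I_k}
       <- enum {: {ffun 'I_r -> 'I_k} * {ffun 'I_r -> 'I_k}}].

Lemma box_sumE (F : mi -> mi -> C) k : box_sum F k = \sum_(q <- box k) F q.1 q.2.
Proof.
rewrite /box_sum pair_big /= /box big_map big_enum /=.
by apply: eq_bigl.
Qed.

Lemma mem_box k q : (q \in box k) = in_box k q.
Proof.
apply/mapP/forallP => [[p _ ->] i|h]; first by rewrite /= !ffunE !ltn_ord.
have h1 i : (q.1 i < k)%N by have /andP[] := h i.
have h2 i : (q.2 i < k)%N by have /andP[] := h i.
exists ([ffun i => Ordinal (h1 i)], [ffun i => Ordinal (h2 i)]).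
  by rewrite mem_enum.
by case: q {h} h1 h2 => q1 q2 h1 h2; congr (_, _); apply/ffunP => i; rewrite !ffunE.
Qed.

Lemma uniq_box k : uniq (box k).
Proof.
rewrite map_inj_uniq ?enum_uniq // => -[p1 p2] [q1 q2] [] /ffunP h1 /ffunP h2.
by congr (_, _); apply/ffunP => i; apply: val_inj; have := h1 i; have := h2 i; rewrite !ffunE.
Qed.

(** The pairs of multi-indices that enter when the box grows from size k - 1 to size
    k, so that the limit of box sums becomes a series. The box of size 0 is a shell of
    its own: it is not empty when there are no variables. *)
Definition shell k : seq (mi * mi) :=
  if k is j.+1 then [seq q <- box j.+1 | ~~ in_box j q] else box 0.

Lemma sum_shell (V : nmodType) (F : mi * mi -> V) k :
  \sum_(i < k.+1) \sum_(q <- shell i) F q = \sum_(q <- box k) F q.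
Proof.
elim: k => [|k ih]; first by rewrite big_ord1.
rewrite big_ord_recr /= ih [RHS](bigID (in_box k)) /= -[in RHS]big_filter.
congr (_ + _); last by rewrite big_filter.
apply: perm_big; apply: uniq_perm; rewrite ?filter_uniq ?uniq_box // => q.
rewrite mem_filter !mem_box; apply/idP/andP => [h|[]//]; split=> //.
by apply/forallP => i; have /forallP/(_ i)/andP[h1 h2] := h; apply/andP; split; exact: leqW.
Qed.

Definition powt (i : 'I_(r + r)) n : pterm R (r + r) := iter n (Ml (Vr i)) (Cst 1).

Definition prodt (s : seq (pterm R (r + r))) := foldr Ml (Cst 1) s.
Definition sumt (s : seq (pterm R (r + r))) := foldr Ad (Cst 0) s.

Definition mont (c : mi -> mi -> C) (q : mi * mi) : pterm R (r + r) :=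
  Ml (Ml (Cst (c q.1 q.2)) (prodt [seq powt (lshift r i) (q.1 i) | i <- enum 'I_r]))
     (prodt [seq powt (rshift r i) (q.2 i) | i <- enum 'I_r]).

Lemma ev_powt x i n : ev x (powt i n) = x i 0 ^+ n.
Proof. by elim: n => [|n ih] //=; rewrite exprS ih. Qed.

Lemma maj_powt a i n : maj a (powt i n) = a ^+ n.
Proof. by elim: n => [|n ih] /=; rewrite ?nrm1 // exprS ih. Qed.

Lemma ev_mont c (x y : 'cV[C]_r) q : ev (col_mx x y) (mont c q) = ps_term c x y q.1 q.2.
Proof.
rewrite /= /ps_term /mono; congr (_ * _ * _); rewrite -[index_enum _]enumT.
  by elim: (enum _) => [|i s ih]; rewrite ?big_nil //= big_cons ih ev_powt col_mxEu.
by elim: (enum _) => [|i s ih]; rewrite ?big_nil //= big_cons ih ev_powt col_mxEd.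
Qed.

Lemma maj_mont c a q : 0 <= a ->
  RtoC (maj a (mont c q)) = `|ps_term c (const_mx (RtoC a)) (const_mx (RtoC a)) q.1 q.2|.
Proof.
move=> a0; rewrite /= /ps_term /mono !normrM !RtoCM -normE !normr_prod -[index_enum _]enumT.
have ha n : `|(RtoC a) ^+ n| = RtoC (a ^+ n).
  by rewrite normrX normE nrm_RtoC ger0_norm // /RtoC rmorphXn.
congr (_ * _ * _).
  elim: (enum _) => [|i s ih]; first by rewrite big_nil /= nrm1.
  by rewrite big_cons /= RtoCM ih mxE ha maj_powt.
elim: (enum _) => [|i s ih]; first by rewrite big_nil /= nrm1.
by rewrite big_cons /= RtoCM ih mxE ha maj_powt.
Qed.

(** The bound on the majorants is the absolute convergence at the point all of whose
    coordinates are equal to the radius. *)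
Lemma analytic_An (f : 'cV[C]_r -> 'cV[C]_r -> C) : analytic_at0 f ->
  exists2 e : R, 0 < e & An e (fun X : 'cV[C]_(r + r) => f (usubmx X) (dsubmx X)).
Proof.
move=> [c hc].
have [e e0 he] : exists2 e : R, 0 < e & forall x y : 'cV[C]_r, dlt e x -> dlt e y ->
    (exists B : C, forall k,
        box_sum (fun alpha beta => `|ps_term c x y alpha beta|) k <= B) /\
    box_sum (ps_term c x y) @ \oo --> f x y.
  case: hc => -[U V] /= [/nbhs0_dlt[a a0 ha] /nbhs0_dlt[b b0 hb]] hUV.
  exists (Num.min a b); first by rewrite lt_min a0.
  move=> x y hx hy; apply: (hUV (x, y)); split => /=.
    by apply: ha; apply: dltW hx; rewrite ge_min lexx.
  by apply: hb; apply: dltW hy; rewrite ge_min lexx orbT.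
exists e => //; exists (fun k => sumt [seq mont c q | q <- shell k]) => a a0 ae.
have ev_sumt X s : ev X (sumt [seq mont c q | q <- s]) = \sum_(q <- s) ev X (mont c q).
  by elim: s => [|q s ih]; rewrite ?big_nil //= big_cons ih.
have maj_sumt s : maj a (sumt [seq mont c q | q <- s]) = \sum_(q <- s) maj a (mont c q).
  by elim: s => [|q s ih]; rewrite ?big_nil /= ?nrm0 // big_cons ih.
split.
  have ha : dlt e (const_mx (RtoC a) : 'cV[C]_r).
    by move=> i; rewrite mxE nrm_RtoC gtr0_norm.
  have [[B hB] _] := he _ _ ha ha.
  exists (complex.Re B) => n.
  apply: (@le_trans _ _ (\sum_(i < n.+1) maj a (sumt [seq mont c q | q <- shell i]))).
    rewrite big_ord_recr /= lerDl maj_sumt sumr_ge0 // => q _.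
    by apply: maj_ge0; exact: ltW.
  under eq_bigr do rewrite maj_sumt.
  rewrite sum_shell; have := hB n; rewrite box_sumE.
  under eq_bigr do rewrite -(maj_mont c _ (ltW a0)).
  rewrite -[\sum_(q <- _) RtoC _]rmorph_sum /= => h.
  by move: h; case: (B) => u v; rewrite lecE /= => /andP[_].
move=> X hX; have hu : dlt e (usubmx X) by move=> i; rewrite mxE; exact: le_lt_trans (hX _) ae.
have hd : dlt e (dsubmx X) by move=> i; rewrite mxE; exact: le_lt_trans (hX _) ae.
have [_ /climP hl] := he _ _ hu hd.
apply: clim_unshift; apply: clim_eq hl => n.
rewrite box_sumE /psum; under [RHS]eq_bigr do rewrite ev_sumt.
rewrite sum_shell; apply: eq_bigr => q _.
by rewrite -ev_mont vsubmxK.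
Qed.

End PowerSeries.

(** * Calculus of matrix-valued analytic functions *)

Section CoordinateMaps.
Variable R : realType.
Local Notation C := (Cx R).

(** Maps that copy coordinates or put 0 instead. All linear substitutions needed below
    (projections, (x, y) |-> (x, 0), exchange of x and y) are of this form, and they
    increase neither coordinates nor majorants. *)
Definition selmap m m' (sel : 'I_m -> option 'I_m') (x : 'cV[C]_m') : 'cV[C]_m :=
  \col_i (if sel i is Some j then x j 0 else 0).

Definition is_sel m m' (L : 'cV[C]_m' -> 'cV[C]_m) :=
  exists sel, forall x, L x = selmap sel x.

Lemma is_sel_id m : is_sel (fun x : 'cV[C]_m => x).
Proof. by exists some => x; apply/colP => i; rewrite mxE. Qed.

Lemma is_sel0 m m' : is_sel (fun x : 'cV[C]_m' => 0 : 'cV[C]_m).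
Proof. by exists (fun=> None) => x; apply/colP => i; rewrite !mxE. Qed.

Lemma is_sel_usub m m1 m2 (L : 'cV[C]_m -> 'cV[C]_(m1 + m2)) :
  is_sel L -> is_sel (fun x => usubmx (L x)).
Proof.
move=> [sel h]; exists (fun i => sel (lshift m2 i)) => x.
by apply/colP => i; rewrite h !mxE.
Qed.

Lemma is_sel_dsub m m1 m2 (L : 'cV[C]_m -> 'cV[C]_(m1 + m2)) :
  is_sel L -> is_sel (fun x => dsubmx (L x)).
Proof.
move=> [sel h]; exists (fun i => sel (rshift m1 i)) => x.
by apply/colP => i; rewrite h !mxE.
Qed.

Lemma is_sel_col m m1 m2 (L1 : 'cV[C]_m -> 'cV[C]_m1) (L2 : 'cV[C]_m -> 'cV[C]_m2) :
  is_sel L1 -> is_sel L2 -> is_sel (fun x => col_mx (L1 x) (L2 x)).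
Proof.
move=> [s1 h1] [s2 h2].
exists (fun i => match fintype.split i with inl j => s1 j | inr j => s2 j end) => x.
apply/colP => i; rewrite [RHS]mxE -{1}(splitK i).
by case: (fintype.split i) => j /=; rewrite ?col_mxEu ?col_mxEd ?h1 ?h2 mxE.
Qed.

Section OneMap.
Variables (m m' : nat) (L : 'cV[C]_m' -> 'cV[C]_m).
Hypothesis hL : is_sel L.

Lemma selD x h : L (x + h) = L x + L h.
Proof.
have [sel hs] := hL; rewrite !hs; apply/colP => i; rewrite !mxE.
by case: (sel i) => [j|]; rewrite ?mxE ?addr0.
Qed.

Lemma selZ c h : L (c *: h) = c *: L h.
Proof.
have [sel hs] := hL; rewrite !hs; apply/colP => i; rewrite !mxE.
by case: (sel i) => [j|]; rewrite ?mxE ?mulr0.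
Qed.

Lemma dle_sel k h : 0 <= k -> dle k h -> dle k (L h).
Proof.
have [sel hs] := hL; rewrite !hs => k0 hh i; rewrite !mxE.
by case: (sel i) => [j|]; rewrite ?nrm0.
Qed.

Lemma dlt_sel k h : 0 < k -> dlt k h -> dlt k (L h).
Proof.
have [sel hs] := hL; rewrite !hs => k0 hh i; rewrite !mxE.
by case: (sel i) => [j|]; rewrite ?nrm0.
Qed.

Lemma An_sel r (f : 'cV[C]_m -> C) : An r f -> An r (fun x => f (L x)).
Proof.
move=> hf; have [sel hs] := hL.
pose th i : pterm R m' := if sel i is Some j then Vr j else Cst 0.
apply: (@An_ext _ _ _ (fun x => f (\col_i ev x (th i)))).
  move=> x _; congr f; rewrite hs; apply/colP => i; rewrite !mxE /th.
  by case: (sel i).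
apply: An_subst hf => a a0 ar; exists a; split=> // i.
by rewrite /th; case: (sel i) => //=; rewrite nrm0 ltW.
Qed.

End OneMap.
End CoordinateMaps.

Section DifRules.
Variables (R : realType) (m : nat).
Local Notation C := (Cx R).
Implicit Types (f g l : 'cV[C]_m -> C) (x h : 'cV[C]_m).

Lemma is_dif_sum f x l I (s : seq I) (F : I -> 'cV[C]_m) : is_dif f x l ->
  l (\sum_(i <- s) F i) = \sum_(i <- s) l (F i).
Proof.
move=> [_ hZ hD]; have l0 : l 0 = 0 by rewrite -(scale0r 0) hZ mul0r.
by elim: s => [|i s ih]; rewrite ?big_nil // !big_cons hD ih.
Qed.

Lemma is_dif_bnd f x l : is_dif f x l ->
  exists2 K, 0 <= K & forall h k, dle k h -> nrm (l h) <= K * k.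
Proof.
move=> hl; exists (\sum_i nrm (l (delta_mx i 0))).
  by apply: sumr_ge0 => i _; exact: nrm_ge0.
move=> h k hk.
have -> : h = \sum_i h i 0 *: delta_mx i 0.
  by rewrite {1}(matrix_sum_delta h); apply: eq_bigr => i _; rewrite big_ord1.
rewrite (is_dif_sum _ _ hl) mulr_suml.
apply: le_trans (ler_nrm_sum _ _ _) _; apply: ler_sum => i _.
have [_ -> _] := hl; rewrite nrmM mulrC ler_wpM2l ?nrm_ge0 //.
Qed.

Lemma is_dif_cst (c : C) x : is_dif (fun=> c) x (fun=> 0).
Proof.
split=> [|d h|h v]; rewrite ?mulr0 ?addr0 //.
exists 0, 1; split=> // h k _ _ _.
by rewrite !subrr nrm0 mul0r.
Qed.

Lemma is_dif_coord i x : is_dif (fun x => x i 0) x (fun h => h i 0).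
Proof.
split=> [|d h|h v]; rewrite ?mxE //.
exists 0, 1; split=> // h k _ _ _.
rewrite mxE (_ : _ - _ - _ = 0) ?nrm0 ?mul0r //; ring.
Qed.

Lemma is_difD f g l l' x : is_dif f x l -> is_dif g x l' ->
  is_dif (fun y => f y + g y) x (fun h => l h + l' h).
Proof.
move=> [[K [d [K0 d0 h1]]] hZ hD] [[K' [d' [K0' d0' h2]]] hZ' hD'].
split=> [|c h|h v]; last 2 first.
- by rewrite hZ hZ' mulrDr.
- by rewrite hD hD' addrACA.
exists (K + K'), (Num.min d d'); split; rewrite ?addr_ge0 ?lt_min ?d0 //.
move=> h k k0; rewrite le_min => /andP[kd kd'] hk.
rewrite mulrDl (_ : _ - _ - _ = (f (x + h) - f x - l h) + (g (x + h) - g x - l' h)).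
  by apply: le_trans (ler_nrmD _ _) _; rewrite lerD ?h1 ?h2.
by ring.
Qed.

Lemma is_difM f g l l' x : is_dif f x l -> is_dif g x l' ->
  is_dif (fun y => f y * g y) x (fun h => l h * g x + f x * l' h).
Proof.
move=> hl hl'; have [B B0 hB] := is_dif_bnd hl; have [B' B0' hB'] := is_dif_bnd hl'.
move: hl hl' => [[K [d [K0 d0 h1]]] hZ hD] [[K' [d' [K0' d0' h2]]] hZ' hD'].
split=> [|c h|h v]; last 2 first.
- by rewrite hZ hZ'; ring.
- by rewrite hD hD'; ring.
exists (K * nrm (g x) + nrm (f x) * K' + (K + B) * (K' + B')),
  (Num.min 1 (Num.min d d')); split; rewrite ?lt_min ?ltr01 ?d0 //.
  by rewrite !addr_ge0 ?mulr_ge0 ?nrm_ge0 ?addr_ge0.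
move=> h k k0; rewrite !le_min => /and3P[k1 kd kd'] hk.
have e1 := h1 h k k0 kd hk; have e2 := h2 h k k0 kd' hk.
have kk : k ^+ 2 <= k by rewrite expr2 ler_piMl.
have e3 : nrm (f (x + h) - f x) <= (K + B) * k.
  rewrite -(subrK (l h) (_ - _)); apply: le_trans (ler_nrmD _ _) _.
  by have := hB h k hk; have := ler_wpM2l K0 kk; lra.
have e4 : nrm (g (x + h) - g x) <= (K' + B') * k.
  rewrite -(subrK (l' h) (_ - _)); apply: le_trans (ler_nrmD _ _) _.
  by have := hB' h k hk; have := ler_wpM2l K0' kk; lra.
rewrite (_ : f (x + h) * g (x + h) - f x * g x - (l h * g x + f x * l' h) =
  (f (x + h) - f x - l h) * g x + f x * (g (x + h) - g x - l' h)
  + (f (x + h) - f x) * (g (x + h) - g x)); last by ring.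
apply: le_trans (ler_nrmD _ _) _.
apply: le_trans (lerD (ler_nrmD _ _) (lexx _)) _; rewrite !nrmM.
rewrite (_ : _ * k ^+ 2 = K * k ^+ 2 * nrm (g x) + nrm (f x) * (K' * k ^+ 2)
   + (K + B) * k * ((K' + B') * k)); last by ring.
by rewrite !lerD ?ler_wpM2r ?ler_wpM2l ?ler_pM ?nrm_ge0.
Qed.

Lemma is_dif_comp m' (L : 'cV[C]_m -> 'cV[C]_m') (f l : 'cV[C]_m' -> C) x :
  is_sel L -> is_dif f (L x) l -> is_dif (fun y => f (L y)) x (fun h => l (L h)).
Proof.
move=> hL [[K [d [K0 d0 h1]]] hZ hD].
split=> [|c h|h v]; rewrite ?(selD hL) ?(selZ hL) //.
exists K, d; split=> // h k k0 kd hk; rewrite (selD hL).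
by apply: h1 => //; exact: dle_sel.
Qed.

End DifRules.

Section MatrixDefs.
Variables (R : realType) (m : nat).
Local Notation C := (Cx R).
Implicit Types (x h : 'cV[C]_m) (r : R).

Definition mAn r p q (F : 'cV[C]_m -> 'M[C]_(p, q)) :=
  forall i j, An r (fun x => F x i j).

Definition mdif p q (F : 'cV[C]_m -> 'M[C]_(p, q)) x h : 'M[C]_(p, q) :=
  \matrix_(i, j) dif (fun y => F y i j) x h.

Definition is_mdif p q (F : 'cV[C]_m -> 'M[C]_(p, q)) x (l : 'cV[C]_m -> 'M[C]_(p, q)) :=
  forall i j, is_dif (fun y => F y i j) x (fun h => l h i j).

End MatrixDefs.

Section MatrixCalculus.
Variables (R : realType) (m : nat).
Local Notation C := (Cx R).
Implicit Types (x h v : 'cV[C]_m) (r : R).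

Lemma mAn_le r r' p q (F : 'cV[C]_m -> 'M[C]_(p, q)) : r' <= r -> mAn r F -> mAn r' F.
Proof. by move=> rr hF i j; exact: An_le (hF i j). Qed.

Lemma mAn_ext r p q (F G : 'cV[C]_m -> 'M[C]_(p, q)) :
  (forall x, dlt r x -> F x = G x) -> mAn r F -> mAn r G.
Proof. by move=> FG hF i j; apply: An_ext (hF i j) => x hx; rewrite FG. Qed.

Lemma mAn_cst r p q (A : 'M[C]_(p, q)) : mAn r (fun _ : 'cV[C]_m => A).
Proof. by move=> i j; exact: An_cst. Qed.

Lemma mAnD r p q (F G : 'cV[C]_m -> 'M[C]_(p, q)) :
  mAn r F -> mAn r G -> mAn r (fun x => F x + G x).
Proof.
move=> hF hG i j; apply: An_ext (An_add (hF i j) (hG i j)) => x _.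
by rewrite mxE.
Qed.

Lemma mAnN r p q (F : 'cV[C]_m -> 'M[C]_(p, q)) : mAn r F -> mAn r (fun x => - F x).
Proof. by move=> hF i j; apply: An_ext (An_opp (hF i j)) => x _; rewrite mxE. Qed.

Lemma mAnZ r p q (c : C) (F : 'cV[C]_m -> 'M[C]_(p, q)) :
  mAn r F -> mAn r (fun x => c *: F x).
Proof.
by move=> hF i j; apply: An_ext (An_mul (An_cst m r c) (hF i j)) => x _; rewrite mxE.
Qed.

Lemma mAnM r p q n (F : 'cV[C]_m -> 'M[C]_(p, q)) (G : 'cV[C]_m -> 'M[C]_(q, n)) :
  mAn r F -> mAn r G -> mAn r (fun x => F x *m G x).
Proof.
move=> hF hG i j; apply: (@An_ext _ _ _ (fun x => \sum_k F x i k * G x k j)).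
  by move=> x _; rewrite mxE.
by apply: An_sum => k _; exact: An_mul.
Qed.

Lemma mAn_tr r p q (F : 'cV[C]_m -> 'M[C]_(p, q)) : mAn r F -> mAn r (fun x => (F x)^T).
Proof. by move=> hF i j; apply: An_ext (hF j i) => x _; rewrite mxE. Qed.

Lemma mAn_sel r m' (L : 'cV[C]_m -> 'cV[C]_m') : is_sel L -> mAn r L.
Proof.
move=> hL i j; rewrite (ord1 j).
exact: (An_sel hL (An_var r i)).
Qed.

Lemma mAn_comp r m' (L : 'cV[C]_m -> 'cV[C]_m') p q (F : 'cV[C]_m' -> 'M[C]_(p, q)) :
  is_sel L -> mAn r F -> mAn r (fun x => F (L x)).
Proof. by move=> hL hF i j; exact: (An_sel hL (hF i j)). Qed.

Lemma mAn_det r p (F : 'cV[C]_m -> 'M[C]_p) : mAn r F -> An r (fun x => \det (F x)).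
Proof.
move=> hF; apply: An_sum => s _; apply: An_mul; first exact: An_cst.
by apply: An_prod => i _; exact: hF.
Qed.

Lemma mAn_adj r p (F : 'cV[C]_m -> 'M[C]_p) : mAn r F -> mAn r (fun x => \adj (F x)).
Proof.
move=> hF i j; apply: (@An_ext _ _ _ (fun x => cofactor (F x) j i)).
  by move=> x _; rewrite mxE.
apply: An_mul; first exact: An_cst.
apply: mAn_det => k l; apply: (@An_ext _ _ _ (fun x => F x (lift j k) (lift i l))) => //.
by move=> x _; rewrite !mxE.
Qed.

(** Cramer's formula reduces the inverse matrix to the reciprocal of the determinant. *)
Lemma mAn_inv r p (F : 'cV[C]_m -> 'M[C]_p) : 0 < r -> mAn r F -> F 0 \in unitmx ->
  exists r', [/\ 0 < r', r' <= r, mAn r' (fun x => invmx (F x)) &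
     forall x, dlt r' x -> F x \in unitmx].
Proof.
move=> r0 hF u0.
have [|r' [r'0 r'r hd hn]] := An_inv r0 (mAn_det hF).
  by rewrite -unitfE -unitmxE.
have hu x : dlt r' x -> F x \in unitmx by move=> hx; rewrite unitmxE unitfE hn.
exists r'; split=> //.
apply: (@mAn_ext _ _ _ (fun x => (\det (F x))^-1 *: \adj (F x))).
  by move=> x hx; rewrite /invmx hu.
move=> i j; apply: (@An_ext _ _ _ (fun x => (\det (F x))^-1 * \adj (F x) i j)).
  by move=> x _; rewrite [RHS]mxE.
by apply: An_mul => //; apply: mAn_adj => k l; exact: An_le (hF k l).
Qed.

Lemma mAn_mdif r p q (F : 'cV[C]_m -> 'M[C]_(p, q)) h :
  0 < r -> mAn r F -> mAn r (fun x => mdif F x h).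
Proof.
by move=> r0 hF i j; apply: An_ext (An_dif h (hF i j) r0) => x _; rewrite mxE.
Qed.

Lemma is_mdifE p q (F : 'cV[C]_m -> 'M[C]_(p, q)) x l : is_mdif F x l -> mdif F x = l.
Proof.
by move=> hl; apply/funext => h; apply/matrixP => i j; rewrite mxE (is_difE (hl i j)).
Qed.

Lemma mAn_is_mdif r p q (F : 'cV[C]_m -> 'M[C]_(p, q)) x :
  mAn r F -> 0 < r -> dlt r x -> is_mdif F x (mdif F x).
Proof.
move=> hF r0 hx i j; have -> : (fun h => mdif F x h i j) = dif (fun y => F y i j) x.
  by apply/funext => h; rewrite mxE.
exact: An_is_dif (hF i j) r0 hx.
Qed.

Lemma is_mdif_ext r p q (F G : 'cV[C]_m -> 'M[C]_(p, q)) x l : 0 < r -> dlt r x ->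
  (forall y, dlt r y -> F y = G y) -> is_mdif F x l -> is_mdif G x l.
Proof.
move=> r0 hx FG hl i j; apply: is_dif_near r0 hx _ (hl i j) => y hy.
by rewrite FG.
Qed.

Lemma is_mdif_cst p q (A : 'M[C]_(p, q)) x : is_mdif (fun=> A) x (fun=> 0).
Proof.
move=> i j; have -> : (fun h : 'cV[C]_m => (0 : 'M[C]_(p, q)) i j) = fun=> 0.
  by apply/funext => h; rewrite mxE.
exact: is_dif_cst.
Qed.

Lemma is_mdif_sel m' (L : 'cV[C]_m -> 'cV[C]_m') x : is_sel L -> is_mdif L x L.
Proof. by move=> hL i j; rewrite (ord1 j); exact: (is_dif_comp hL (is_dif_coord i (L x))). Qed.

Lemma is_mdifD p q (F G : 'cV[C]_m -> 'M[C]_(p, q)) x l l' :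
  is_mdif F x l -> is_mdif G x l' ->
  is_mdif (fun y => F y + G y) x (fun h => l h + l' h).
Proof.
move=> hl hl' i j; have := is_difD (hl i j) (hl' i j).
by congr is_dif; apply/funext => y; rewrite mxE.
Qed.

Lemma is_mdifZ p q (F : 'cV[C]_m -> 'M[C]_(p, q)) (c : C) x l :
  is_mdif F x l -> is_mdif (fun y => c *: F y) x (fun h => c *: l h).
Proof.
move=> hl i j; have := is_difM (is_dif_cst c x) (hl i j).
by congr is_dif; apply/funext => y; rewrite mxE // mul0r add0r.
Qed.

Lemma is_mdifN p q (F : 'cV[C]_m -> 'M[C]_(p, q)) x l :
  is_mdif F x l -> is_mdif (fun y => - F y) x (fun h => - l h).
Proof.
move=> hl; have := is_mdifZ (-1) hl.
by congr is_mdif; apply/funext => y; rewrite scaleN1r.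
Qed.

Lemma is_mdif_tr p q (F : 'cV[C]_m -> 'M[C]_(p, q)) x l :
  is_mdif F x l -> is_mdif (fun y => (F y)^T) x (fun h => (l h)^T).
Proof.
move=> hl i j; have := hl j i.
by congr is_dif; apply/funext => y; rewrite mxE.
Qed.

Lemma is_mdifM p q n (F : 'cV[C]_m -> 'M[C]_(p, q)) (G : 'cV[C]_m -> 'M[C]_(q, n)) x l l' :
  is_mdif F x l -> is_mdif G x l' ->
  is_mdif (fun y => F y *m G y) x (fun h => l h *m G x + F x *m l' h).
Proof.
move=> hl hl' i j.
have -> : (fun h => (l h *m G x + F x *m l' h) i j) =
    (fun h => \sum_k (l h i k * G x k j + F x i k * l' h k j)).
  by apply/funext => h; rewrite !mxE -big_split.
have -> : (fun y => (F y *m G y) i j) = (fun y => \sum_k (F y i k * G y k j)).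
  by apply/funext => y; rewrite mxE.
elim: (index_enum _) => [|k s ih].
  have := is_dif_cst 0 x.
  by congr is_dif; apply/funext => y; rewrite big_nil.
have := is_difD (is_difM (hl i k) (hl' k j)) ih.
by congr is_dif; apply/funext => y; rewrite big_cons.
Qed.

Lemma is_mdif_comp m' (L : 'cV[C]_m -> 'cV[C]_m') p q (F : 'cV[C]_m' -> 'M[C]_(p, q)) l x :
  is_sel L -> is_mdif F (L x) l ->
  is_mdif (fun y => F (L y)) x (fun h => l (L h)).
Proof. by move=> hL hl i j; exact: (is_dif_comp hL (hl i j)). Qed.

Section Differential.
Variables (r : R) (p q : nat) (F : 'cV[C]_m -> 'M[C]_(p, q)).
Hypotheses (r0 : 0 < r) (hF : mAn r F).

Lemma mdif_sym x h v : dlt r x ->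
  mdif (fun y => mdif F y h) x v = mdif (fun y => mdif F y v) x h.
Proof.
move=> hx; apply/matrixP => i j; rewrite !mxE.
have E w : (fun y => mdif F y w i j) = (fun y => dif (fun z => F z i j) y w).
  by apply/funext => y; rewrite mxE.
by rewrite !E; exact: dif_sym (hF i j) r0 hx.
Qed.

Lemma mdifZ x (c : C) h : dlt r x -> mdif F x (c *: h) = c *: mdif F x h.
Proof.
move=> hx; apply/matrixP => i j; have [_ hZ _] := mAn_is_mdif hF r0 hx i j.
by rewrite [RHS]mxE -hZ.
Qed.

Lemma mAn_bound a : 0 < a -> a < r ->
  exists2 B, 0 <= B & forall x i j, dle a x -> nrm (F x i j) <= B.
Proof.
move=> a0 ar; have h i : exists B, forall j x, dle a x -> nrm (F x i j) <= B.
  have /choice[B hB] : forall j, exists B, forall x, dle a x -> nrm (F x i j) <= B.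
    by move=> j; have [B _ hB] := An_bound (hF i j) a0 ar; exists B.
  exists (\sum_j `|B j|) => j x hx; apply: le_trans (hB j x hx) _.
  rewrite (bigD1 j) //=; apply: le_trans (ler_norm _) _.
  by rewrite lerDl sumr_ge0.
have /choice[B hB] := h; exists (\sum_i `|B i|); first by rewrite sumr_ge0.
move=> x i j hx; apply: le_trans (hB i j x hx) _.
rewrite (bigD1 i) //=; apply: le_trans (ler_norm _) _.
by rewrite lerDl sumr_ge0.
Qed.

Lemma mdif_bound a : 0 < a -> a < r -> exists2 B, 0 <= B &
  forall x h k i j, dle a x -> 0 <= k -> dle k h -> nrm (mdif F x h i j) <= B * k.
Proof.
move=> a0 ar; have h i : exists B, forall j, 0 <= B /\ forall x h k, dle a x ->
    0 <= k -> dle k h -> nrm (mdif F x h i j) <= B * k.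
  have /choice[B hB] : forall j, exists B, forall x h k, dle a x ->
      0 <= k -> dle k h -> nrm (mdif F x h i j) <= B * k.
    move=> j; have [B [d [_ _ _ hB]]] := An_taylor (hF i j) a0 ar; exists B.
    by move=> x h k; rewrite mxE; exact: hB.
  exists (\sum_j `|B j|) => j; split; first by rewrite sumr_ge0.
  move=> x h k hx k0 hk; apply: le_trans (hB j x h k hx k0 hk) _.
  rewrite ler_wpM2r // (bigD1 j) //=; apply: le_trans (ler_norm _) _.
  by rewrite lerDl sumr_ge0.
have /choice[B hB] := h; exists (\sum_i `|B i|); first by rewrite sumr_ge0.
move=> x v k i j hx k0 hk; have [_ hBi] := hB i j; apply: le_trans (hBi x v k hx k0 hk) _.
rewrite ler_wpM2r // (bigD1 i) //=; apply: le_trans (ler_norm _) _.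
by rewrite lerDl sumr_ge0.
Qed.

Lemma mAn_mvt x h L : dlt r x -> dlt r (x + h) ->
  (forall s i j, 0 <= s <= 1 -> nrm (mdif F (x + RtoC s *: h) h i j) <= L) ->
  forall i j, nrm ((F (x + h) - F x) i j) <= L.
Proof.
move=> hx hxh hL i j; rewrite !mxE.
apply: An_mvt (hF i j) r0 hx hxh _ => s hs.
by have := hL s i j hs; rewrite mxE.
Qed.

Lemma mdif_line0 x h : dlt r x ->
  (forall s : R, dlt r (x + RtoC s *: h) -> F (x + RtoC s *: h) = F x) ->
  mdif F x h = 0.
Proof.
move=> hx hs; apply/matrixP => i j; rewrite [RHS]mxE.
have [[K [d [K0 d0 hK]]] hZ _] := mAn_is_mdif hF r0 hx i j.
have [a [a0 ar ha]] := dlt_dle r0 hx; have [V V0 hV] := dle_ge h.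
apply/eqP; rewrite -nrm_eq0 eq_le nrm_ge0 andbT; apply/ler_addgt0Pr => e e0.
rewrite add0r; pose D := Num.min d ((r - a) / 2).
have D0 : 0 < D by rewrite lt_min d0 divr_gt0 // subr_gt0.
have M0 : 0 < K * V ^+ 2 + 1 by rewrite ltr_wpDl // mulr_ge0 ?exprn_ge0 // ltW.
pose s := Num.min (D / V) (e / (K * V ^+ 2 + 1)).
have s0 : 0 < s by rewrite lt_min !divr_gt0.
have sD : s * V <= D by rewrite -ler_pdivlMr // ge_min lexx.
have se : s * (K * V ^+ 2 + 1) <= e by rewrite -ler_pdivlMr // ge_min lexx orbT.
have hsh : dle (s * V) (RtoC s *: h).
  by have := dleZ (RtoC s) hV; rewrite nrm_RtoC gtr0_norm.
have hD1 : s * V <= d by apply: le_trans sD _; rewrite ge_min lexx.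
have hD2 : s * V <= (r - a) / 2 by apply: le_trans sD _; rewrite ge_min lexx orbT.
have := hK _ _ (mulr_ge0 (ltW s0) (ltW V0)) hD1 hsh.
rewrite hs; last by apply: dle_dlt (dleD ha hsh); lra.
rewrite subrr sub0r nrmN hZ nrmM nrm_RtoC gtr0_norm //.
rewrite (_ : K * (s * V) ^+ 2 = s * (s * (K * V ^+ 2))); last by ring.
rewrite ler_pM2l // => h1; apply: le_trans h1 _; apply: le_trans se.
by rewrite ler_pM2l // lerDl.
Qed.

End Differential.

Section Local.
Variable r : R.
Hypothesis r0 : 0 < r.

Lemma dif_near (f g : 'cV[C]_m -> C) x : An r f -> dlt r x ->
  (forall y, dlt r y -> f y = g y) -> dif f x = dif g x.
Proof.
by move=> hf hx fg; rewrite (is_difE (is_dif_near r0 hx fg (An_is_dif hf r0 hx))).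
Qed.

Lemma mdif_near p q (F G : 'cV[C]_m -> 'M[C]_(p, q)) x : mAn r F -> dlt r x ->
  (forall y, dlt r y -> F y = G y) -> mdif F x = mdif G x.
Proof.
move=> hF hx FG.
by rewrite (is_mdifE (is_mdif_ext r0 hx FG (mAn_is_mdif hF r0 hx))).
Qed.

Lemma mdif0 p q (F : 'cV[C]_m -> 'M[C]_(p, q)) x :
  mAn r F -> dlt r x -> mdif F x 0 = 0.
Proof. by move=> hF hx; rewrite -(scale0r 0) (mdifZ r0 hF) // scale0r. Qed.

Lemma sym_mdif n (F : 'cV[C]_m -> 'M[C]_n) x h : mAn r F -> dlt r x ->
  (forall y, dlt r y -> (F y)^T = F y) -> (mdif F x h)^T = mdif F x h.
Proof.
move=> hF hx hsym; have hd := mAn_is_mdif hF r0 hx.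
exact: (congr1 (@^~ h) (esym (is_mdifE (is_mdif_ext r0 hx hsym (is_mdif_tr hd))))).
Qed.

End Local.
End MatrixCalculus.

(** * Restriction to the totally real slice *)

Section LibraryCriteria.

Lemma differentiable_littleo (K : numFieldType) (V W : normedModType K)
    (f : V -> W) (x : V) (df : {linear V -> W}) : continuous df ->
  (forall eps : K, 0 < eps ->
     \forall h \near (0 : V), `|f (h + x) - f x - df h| <= eps * `|h|) ->
  differentiable f x.
Proof.
move=> cdf h.
have E : f \o shift x = cst (f x) + df +o_ (0 : V) id.
  apply/eqaddoP => eps e0; have := h eps e0; apply: filterS => y.
  by rewrite /= -![(_ - _ : _ -> _) _]/(_ - _) -![(_ + _ : _ -> _) _]/(_ + _) opprD addrA.
have dE : 'd f x = df :> (V -> W) := diff_unique cdf E.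
by apply/diff_locallyP; rewrite dE.
Qed.

Lemma is_derive_quad (R : realType) (g : R -> R) (x D K d : R) : 0 < d -> 0 <= K ->
  (forall t, `|t| <= d -> `|g (x + t) - g x - t * D| <= K * t ^+ 2) ->
  is_derive x 1 g D.
Proof.
move=> d0 K0 h.
have hl : (fun t => t^-1 *: ((g \o shift x) (t *: 1) - g x)) @ 0^' --> D.
  apply/cvgrPdist_le => e e0; near=> t.
  have t0 : t != 0 by near: t; exact: nbhs_dnbhs_neq.
  have td : `|t| <= Num.min d (e / (K + 1)).
    by near: t; apply: dnbhs0_le; rewrite lt_min d0 divr_gt0 // ltr_wpDl.
  move: td; rewrite le_min => /andP[td te].
  have -> : D - t^-1 *: ((g \o shift x) (t *: 1) - g x)
      = - t^-1 * (g (x + t) - g x - t * D).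
    by rewrite /= -mulr_algl scaler1 /GRing.scale /= mulr1 (addrC t x); field.
  rewrite normrM normrN normfV ler_pdivrMl ?normr_gt0 //.
  apply: le_trans (h t td) _.
  rewrite (_ : K * t ^+ 2 = `|t| * (K * `|t|)); last first.
    by rewrite -(real_normK (num_real t)); ring.
  rewrite ler_wpM2l //.
  apply: (@le_trans _ _ ((K + 1) * `|t|)); first by rewrite ler_wpM2r // lerDl.
  by rewrite mulrC -ler_pdivlMr // ltr_wpDl.
split; first by apply/cvg_ex; exists D.
exact: cvg_lim hl.
Unshelve. all: by end_near.
Qed.

End LibraryCriteria.

Section ConjMatrix.
Variable R : realType.
Local Notation C := (Cx R).

Lemma conj_mxD m n (A B : 'M[C]_(m, n)) : conj_mx (A + B) = conj_mx A + conj_mx B.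
Proof. exact: map_mxD. Qed.

Lemma conj_mxZ m n (c : C) (A : 'M[C]_(m, n)) : conj_mx (c *: A) = c^* *: conj_mx A.
Proof. by apply/matrixP => i j; rewrite !mxE rmorphM. Qed.

Lemma conj_mxK m n (A : 'M[C]_(m, n)) : conj_mx (conj_mx A) = A.
Proof. by apply/matrixP => i j; rewrite !mxE conjCK. Qed.

Lemma conj_mx0 m n : conj_mx (0 : 'M[C]_(m, n)) = 0.
Proof. by apply/matrixP => i j; rewrite !mxE conjC0. Qed.

Lemma conj_mxN m n (A : 'M[C]_(m, n)) : conj_mx (- A) = - conj_mx A.
Proof. by apply/matrixP => i j; rewrite !mxE rmorphN. Qed.

Lemma conj_mxM m n p (A : 'M[C]_(m, n)) (B : 'M[C]_(n, p)) :
  conj_mx (A *m B) = conj_mx A *m conj_mx B.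
Proof.
apply/matrixP => i j; rewrite !mxE rmorph_sum; apply: eq_bigr => k _.
by rewrite rmorphM !mxE.
Qed.

Lemma conj_mxT m n (A : 'M[C]_(m, n)) : conj_mx A^T = (conj_mx A)^T.
Proof. by apply/matrixP => i j; rewrite !mxE. Qed.

Lemma conj_invmx n (A : 'M[C]_n) : A \in unitmx -> conj_mx (invmx A) = invmx (conj_mx A).
Proof.
move=> uA; have e : conj_mx A *m conj_mx (invmx A) = 1%:M.
  rewrite -conj_mxM mulmxV //.
  by apply/matrixP => i j; rewrite !mxE conjC_nat.
have [u _] := mulmx1_unit e.
by rewrite -[LHS](mulKmx u) e mulmx1.
Qed.

Lemma conjRtoC (t : R) : (RtoC t)^* = RtoC t :> C.
Proof. by apply/eqP; rewrite eq_complex /= oppr0 !eqxx. Qed.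

End ConjMatrix.

Section Bridge.
Variables (R : realType) (N : nat).
Local Notation C := (Cx R).
Implicit Types (p v : 'cV[C]_N) (r : R) (k : nat).

Lemma mx_norm_coord (K : numFieldType) m n (A : 'M[K]_(m, n)) i j : `|A i j| <= `|A|.
Proof.
rewrite [leRHS]mx_normE; have -> : `|A i j| = `|A i j|%:nng%:num by [].
by rewrite num_le; exact: (le_bigmax _ (fun ij => `|A ij.1 ij.2|%:nng) (i, j)).
Qed.

Lemma normcV n (h : 'cV[C]_n) : exists2 k : R, `|h| = RtoC k &
  [/\ 0 <= k, dle k h & forall e, 0 < e -> dlt e h -> k < e].
Proof.
have : 0 <= `|h| by [].
have hc i := mx_norm_coord h i 0.
have hn : `|h| != 0 -> exists i, `|h| = `|h i 0|.
  move=> /mx_norm_neq0[[i j] /= hij]; exists i.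
  by rewrite -[LHS]/(mx_norm h) hij (ord1 j).
case: (`|h|) hc hn => k k' hc hn; rewrite lecE /= => /andP[/eqP k'0 k0].
exists k; first by rewrite k'0.
split=> // [i|e e0 he]; first by have := hc i; rewrite normE k'0 RtoC_le.
have [k00|kn0] := eqVneq k 0; first by rewrite k00.
have [|i] := hn; first by rewrite eq_complex /= negb_and kn0.
by rewrite normE => -[-> _]; exact: he.
Qed.

Lemma continuous_dlt n (f : 'cV[C]_n -> C) x :
  (forall e : R, 0 < e -> exists2 d : R, 0 < d &
    forall z, dlt d (z - x) -> nrm (f z - f x) < e) -> {for x, continuous f}.
Proof.
move=> h A /nbhs_ballP[[e e'] /=]; rewrite ltcE /= => /andP[/eqP -> e0] hA.
have [d d0 hd] := h e e0; apply/nbhs_dlt; exists d => // z hz.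
by apply: hA; rewrite -ball_normE /= distrC normE RtoC_lt; exact: hd.
Qed.

Lemma differentiable_quad n (f : 'cV[C]_n -> C) x l : is_dif f x l -> differentiable f x.
Proof.
move=> hl; have [B B0 hB] := is_dif_bnd hl.
move: hl => [[K [d [K0 d0 hK]]] hZ hD].
have lin : linear l by move=> a u v; rewrite hD hZ.
pose lM := GRing.isLinear.Build _ _ _ _ _ lin.
pose L : {linear 'cV[C]_n -> C} := HB.pack l lM.
have cL : continuous L.
  move=> y; apply: continuous_dlt => e e0.
  exists (e / (B + 1)); first by rewrite divr_gt0 // ltr_wpDl.
  move=> z hz.
  have -> : l z - l y = l (z - y).
    by rewrite hD -[in RHS](scaleN1r y) hZ mulN1r.
  apply: le_lt_trans (hB _ _ (fun i => ltW (hz i))) _.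
  rewrite mulrA ltr_pdivrMr ?ltr_wpDl // mulrC ltr_pM2l //.
  by rewrite ltrDl.
apply: (differentiable_littleo cL) => -[e e']; rewrite ltcE /= => /andP[/eqP -> e0].
have K1 : 0 < K + 1 by rewrite ltr_wpDl.
apply/nbhs_dlt; exists (Num.min d (e / (K + 1))).
  by rewrite lt_min d0 divr_gt0.
move=> h; rewrite subr0 => hh.
have [k hk [k0 hkh hlt]] := normcV h.
have kd : k < Num.min d (e / (K + 1)) by apply: hlt => //; rewrite lt_min d0 divr_gt0.
move: kd; rewrite lt_min => /andP[kd ke].
rewrite hk -/(RtoC e) -RtoCM normE RtoC_le (addrC h).
apply: le_trans (hK h k k0 (ltW kd) hkh) _; rewrite expr2 mulrA ler_wpM2r //.
apply: (@le_trans _ _ ((K + 1) * k)); first by rewrite ler_wpM2r // lerDl.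
by rewrite mulrC -ler_pdivlMr // ltW.
Qed.

(** The point (p, conj p) of the totally real slice of C^N x C^N. A real analytic
    function of p is an analytic function of 2N variables composed with pb. *)
Definition pb p : 'cV[C]_(N + N) := col_mx p (conj_mx p).

Lemma pbD p v : pb (p + v) = pb p + pb v.
Proof. by rewrite /pb conj_mxD add_col_mx. Qed.

Lemma pbZ (t : R) v : pb (RtoC t *: v) = RtoC t *: pb v.
Proof. by rewrite /pb conj_mxZ conjRtoC scale_col_mx. Qed.

Lemma dlt_pb r p : dlt r p -> dlt r (pb p).
Proof. by move=> hp; apply: dlt_col => // i; rewrite mxE nrm_conj. Qed.

Lemma dle_pb r p : dle r p -> dle r (pb p).
Proof. by move=> hp; apply: dle_col => // i; rewrite mxE nrm_conj. Qed.

Lemma open_dlt r : open [set p : 'cV[C]_N | dlt r p].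
Proof.
rewrite openE => p /= hp.
have [r0|r0] := ltP 0 r; last first.
  apply/nbhs_dlt; exists 1 => // x _; case: N p hp x => [|n] p hp x; first by case.
  by have := hp 0; have := nrm_ge0 (p 0 0); lra.
have [a [a0 ar ha]] := dlt_dle r0 hp.
apply/nbhs_dlt; exists (r - a); first by rewrite subr_gt0.
move=> x hx i; have -> : x i 0 = (x - p) i 0 + p i 0 by rewrite !mxE subrK.
apply: le_lt_trans (ler_nrmD _ _) _.
by have := hx i; have := ha i; lra.
Qed.

Section Slice.
Variables (r : R) (F : 'cV[C]_(N + N) -> C) (f : 'cV[C]_N -> C).
Hypotheses (r0 : 0 < r) (hF : An r F) (fF : forall p, dlt r p -> f p = F (pb p)).

(** Along a real line the restriction of F to the slice moves in the direction
    (v, conj v). *)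
Lemma slice_line p v : dlt r p ->
  is_derive (0 : R) (1 : R) (re_line f v p) (complex.Re (dif F (pb p) (pb v))) /\
  is_derive (0 : R) (1 : R) (im_line f v p) (complex.Im (dif F (pb p) (pb v))).
Proof.
move=> hp.
have [[K [d [K0 d0 hK]]] hZ _] := An_is_dif hF r0 (dlt_pb hp).
have [a [a0 ar ha]] := dlt_dle r0 hp.
have [V V0 hV] := dle_ge v.
pose e := Num.min (d / V) ((r - a) / 2 / V).
have e0 : 0 < e by rewrite lt_min !divr_gt0 // subr_gt0.
have main t : `|t| <= e -> nrm (f (p + RtoC (0 + t) *: v) - f (p + RtoC 0 *: v)
    - RtoC t * dif F (pb p) (pb v)) <= K * V ^+ 2 * t ^+ 2.
  rewrite le_min !ler_pdivlMr // => /andP[td tr].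
  rewrite add0r RtoC0 scale0r addr0.
  have htv : dle (`|t| * V) (RtoC t *: v).
    by have := dleZ (RtoC t) hV; rewrite nrm_RtoC.
  rewrite !fF //; last by apply: dle_dlt (dleD ha htv); lra.
  rewrite pbD pbZ -hZ -mulrA (_ : V ^+ 2 * t ^+ 2 = (`|t| * V) ^+ 2); last first.
    by rewrite exprMn real_normK ?num_real // mulrC.
  apply: hK => //; first by rewrite mulr_ge0 // ltW.
  by rewrite -pbZ; exact: dle_pb.
have K2 : 0 <= K * V ^+ 2 by rewrite mulr_ge0 // exprn_ge0 // ltW.
split; apply: (is_derive_quad e0 K2) => t /main h; apply: le_trans h;
  rewrite /re_line /im_line.
- apply: le_trans (nrm_Re _).
  rewrite !ReD !ReN (_ : complex.Re (RtoC t * _) = t * complex.Re (dif F (pb p) (pb v))) //.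
  by case: (dif _ _ _) => u w /=; rewrite mul0r subr0.
- apply: le_trans (nrm_Im _).
  rewrite !ImD !ImN (_ : complex.Im (RtoC t * _) = t * complex.Im (dif F (pb p) (pb v))) //.
  by case: (dif _ _ _) => u w /=; rewrite mul0r addr0.
Qed.

Lemma slice_rderivable p v : dlt r p -> rderivable f v p.
Proof. by move=> hp; have [h1 h2] := slice_line v hp; split; exact: ex_derive. Qed.

Lemma slice_rderive p v : dlt r p -> rderive f v p = dif F (pb p) (pb v).
Proof.
move=> hp; have [h1 h2] := slice_line v hp.
rewrite /rderive !derive1E !derive_val.
by case: (dif _ _ _).
Qed.

Lemma slice_continuous p : dlt r p -> {for p, continuous f}.
Proof.
move=> hp; have hl := An_is_dif hF r0 (dlt_pb hp).
have [B B0 hB] := is_dif_bnd hl; have [[K [d [K0 d0 hK]]] _ _] := hl.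
have [a [a0 ar ha]] := dlt_dle r0 hp.
apply: continuous_dlt => e e0.
pose k := Num.min (Num.min 1 d) (Num.min ((r - a) / 2) (e / (2 * (K + B + 1)))).
have KB : 0 < K + B + 1 by rewrite ltr_wpDl // addr_ge0.
have k0 : 0 < k by rewrite !lt_min ltr01 d0 !divr_gt0 ?mulr_gt0 // subr_gt0.
exists k => // x hx.
have kd : k <= d by rewrite !ge_min lexx !orbT.
have k1 : k <= 1 by rewrite !ge_min lexx.
have kr : k <= (r - a) / 2 by rewrite !ge_min lexx !orbT.
have ke : k <= e / (2 * (K + B + 1)) by rewrite !ge_min lexx !orbT.
have hxk : dle k (x - p) by move=> i; exact: ltW.
have -> : x = p + (x - p) by rewrite addrC subrK.
rewrite !fF //; last by apply: dle_dlt (dleD ha hxk); lra.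
rewrite pbD -(subrK (dif F (pb p) (pb (x - p))) (F _ - _)).
apply: le_lt_trans (ler_nrmD _ _) _.
have h1 := hK _ _ (ltW k0) kd (dle_pb hxk); have h2 := hB _ _ (dle_pb hxk).
have h3 : K * k ^+ 2 <= K * k by rewrite ler_wpM2l // expr2 ler_piMl // ltW.
move: ke; rewrite ler_pdivlMr ?mulr_gt0 //; move: h1 h2 h3 k0 e0; nra.
Qed.

(** On the slice, the Wirtinger derivatives are the partial derivatives with respect to
    the first and to the second group of variables. *)
Lemma slice_dZ p j : dlt r p -> dZ j f p = dif F (pb p) (col_mx (delta_mx j 0) 0).
Proof.
move=> hp; have [_ hZ hD] := An_is_dif hF r0 (dlt_pb hp).
have de : conj_mx (delta_mx j 0 : 'cV[C]_N) = delta_mx j 0.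
  by apply/matrixP => i k; rewrite !mxE conjC_nat.
rewrite /dZ !slice_rderive // /pb conj_mxZ conjCi de.
set u := col_mx (delta_mx j 0) 0; set w := col_mx 0 (delta_mx j 0) : 'cV[C]_(N + N).
have -> : col_mx (delta_mx j 0) (delta_mx j 0) = u + w.
  by rewrite /u /w add_col_mx addr0 add0r.
have -> : col_mx ('i *: delta_mx j 0) (- 'i *: delta_mx j 0) = 'i *: u + (- 'i) *: w.
  by rewrite /u /w !scale_col_mx !scaler0 add_col_mx addr0 add0r.
rewrite !hD !hZ; have ii : 'i * 'i = -1 :> C by rewrite -expr2 sqrCi.
set A := dif _ _ u; set B := dif _ _ w.
have -> : A + B - 'i * ('i * A + - 'i * B) = A + B - ('i * 'i) * (A - B) by ring.
by rewrite ii; field.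
Qed.

Lemma slice_dZbar p j : dlt r p -> dZbar j f p = dif F (pb p) (col_mx 0 (delta_mx j 0)).
Proof.
move=> hp; have [_ hZ hD] := An_is_dif hF r0 (dlt_pb hp).
have de : conj_mx (delta_mx j 0 : 'cV[C]_N) = delta_mx j 0.
  by apply/matrixP => i k; rewrite !mxE conjC_nat.
rewrite /dZbar !slice_rderive // /pb conj_mxZ conjCi de.
set u := col_mx (delta_mx j 0) 0 : 'cV[C]_(N + N); set w := col_mx 0 (delta_mx j 0).
have -> : col_mx (delta_mx j 0) (delta_mx j 0) = u + w.
  by rewrite /u /w add_col_mx addr0 add0r.
have -> : col_mx ('i *: delta_mx j 0) (- 'i *: delta_mx j 0) = 'i *: u + (- 'i) *: w.
  by rewrite /u /w !scale_col_mx !scaler0 add_col_mx addr0 add0r.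
rewrite !hD !hZ; have ii : 'i * 'i = -1 :> C by rewrite -expr2 sqrCi.
set A := dif _ _ u; set B := dif _ _ w.
have -> : A + B + 'i * ('i * A + - 'i * B) = A + B + ('i * 'i) * (A - B) by ring.
by rewrite ii; field.
Qed.

End Slice.

(** All derivatives of an analytic function live on the same polydisc, so the
    induction on k does not shrink the domain. *)
Lemma slice_Ck r k (F : 'cV[C]_(N + N) -> C) (f : 'cV[C]_N -> C) : 0 < r -> An r F ->
  (forall p, dlt r p -> f p = F (pb p)) -> Ck k [set p | dlt r p] f.
Proof.
move=> r0; elim: k F f => [|k ih] F f hF fF /=.
  by split=> // p hp; exact: slice_continuous r0 hF fF _ hp.
split=> [p hp|v]; first exact: slice_continuous r0 hF fF _ hp.
split=> [p hp|]; first exact: slice_rderivable r0 hF fF _ _ hp.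
apply: (ih (fun X => dif F X (pb v))); first exact: An_dif.
by move=> p hp; exact: slice_rderive r0 hF fF _ _ hp.
Qed.

End Bridge.

(** * The Levi kernel of a real analytic hypersurface *)

Section LeviKernel.
Variables (R : realType) (N : nat).
Local Notation C := (Cx R).
Implicit Types (p v : 'cV[C]_N) (r : R).
Variables (r : R) (F : 'cV[C]_(N + N) -> C) (rho : 'cV[C]_N -> C).
Hypotheses (r0 : 0 < r) (hF : An r F) (rhoF : forall p, dlt r p -> rho p = F (pb p)).
Variables (j0 : 'I_N) (c : C).
Hypothesis F_w : forall X, dlt r X -> dif F X (col_mx (delta_mx j0 0) 0) = 2^-1.
Hypothesis F_wbar : forall X, dlt r X -> dif F X (col_mx 0 (delta_mx j0 0)) = c.

Lemma sum_col_delta v : v = \sum_j v j 0 *: delta_mx j 0.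
Proof. by rewrite {1}(matrix_sum_delta v); apply: eq_bigr => i _; rewrite big_ord1. Qed.

Lemma dif_hol (G : 'cV[C]_(N + N) -> C) X v : An r G -> dlt r X ->
  dif G X (col_mx v 0) = \sum_j v j 0 * dif G X (col_mx (delta_mx j 0) 0).
Proof.
move=> hG hX; have hl := An_is_dif hG r0 hX; have [_ hZ _] := hl.
have -> : col_mx v 0 = \sum_j v j 0 *: (col_mx (delta_mx j 0) 0 : 'cV[C]_(N + N)).
  rewrite {1}(sum_col_delta v) -[RHS]/(\sum_j (v j 0 *: _)).
  elim/big_rec2: _ => [|j A B _ <-]; first by rewrite col_mx0.
  by rewrite scale_col_mx scaler0 add_col_mx addr0.
by rewrite (is_dif_sum _ _ hl); apply: eq_bigr => j _; rewrite hZ.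
Qed.

Lemma dif_antihol (G : 'cV[C]_(N + N) -> C) X v : An r G -> dlt r X ->
  dif G X (col_mx 0 v) = \sum_j v j 0 * dif G X (col_mx 0 (delta_mx j 0)).
Proof.
move=> hG hX; have hl := An_is_dif hG r0 hX; have [_ hZ _] := hl.
have -> : col_mx 0 v = \sum_j v j 0 *: (col_mx 0 (delta_mx j 0) : 'cV[C]_(N + N)).
  rewrite {1}(sum_col_delta v) -[RHS]/(\sum_j (v j 0 *: _)).
  elim/big_rec2: _ => [|j A B _ <-]; first by rewrite col_mx0.
  by rewrite scale_col_mx scaler0 add_col_mx addr0.
by rewrite (is_dif_sum _ _ hl); apply: eq_bigr => j _; rewrite hZ.
Qed.

Lemma HfibE p v : dlt r p -> Hfib rho p v <-> dif F (pb p) (col_mx v 0) = 0.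
Proof.
move=> hp; rewrite (dif_hol v hF (dlt_pb hp)).
have -> : \sum_j v j 0 * dif F (pb p) (col_mx (delta_mx j 0) 0)
    = \sum_j v j 0 * dZ j rho p.
  by apply: eq_bigr => j _; rewrite (slice_dZ r0 hF rhoF j hp).
by [].
Qed.

(** The tangential (1,0)-field that differs from the constant field v only in the j0-th
    component; rho has a constant derivative in that direction. *)
Definition tan_field v (q : 'cV[C]_N) : 'cV[C]_N :=
  v + (- 2 * dif F (pb q) (col_mx v 0)) *: delta_mx j0 0.

Lemma tan_field_coord v j : exists2 G, An r G &
  [/\ forall q, tan_field v q j 0 = G (pb q) &
      forall X h, dlt r X ->
        dif G X h = - 2 * dif (fun Y => dif F Y (col_mx v 0)) X h * (j == j0)%:R].
Proof.
have hd := An_dif (col_mx v 0) hF r0.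
exists (fun X => v j 0 + (- 2 * dif F X (col_mx v 0)) * (j == j0)%:R).
  by do ![apply: An_add || apply: An_mul || exact: An_cst].
split=> [q|X h hX]; first by rewrite !mxE eqxx andbT.
have h1 := is_difM (is_dif_cst (-2) X) (An_is_dif hd r0 hX).
have h2 := is_difM h1 (is_dif_cst (j == j0)%:R X).
rewrite (is_difE (is_difD (is_dif_cst (v j 0) X) h2)) /=.
by rewrite mul0r add0r mulr0 addr0 add0r.
Qed.

Lemma dif_coldelta X v (a : C) : dlt r X ->
  dif F X (col_mx (v + a *: delta_mx j0 0) 0) = dif F X (col_mx v 0) + a / 2.
Proof.
move=> hX; have [_ hZ hD] := An_is_dif hF r0 hX.
have -> : col_mx (v + a *: delta_mx j0 0) 0
    = col_mx v 0 + a *: (col_mx (delta_mx j0 0) 0 : 'cV[C]_(N + N)).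
  by rewrite scale_col_mx scaler0 add_col_mx addr0.
by rewrite hD hZ F_w.
Qed.

Lemma tan_field_section v p : dlt r p -> local_section rho (Hfib rho) p (tan_field v).
Proof.
move=> hp; exists [set q | dlt r q]; first by split; [exact: open_dlt|].
split=> [k j|q hq _].
  have [G hG [hj _]] := tan_field_coord v j.
  by apply: (slice_Ck k r0 hG) => q _; exact: hj.
apply/(HfibE _ hq); rewrite dif_coldelta; last exact: dlt_pb.
by field.
Qed.

(** The bracket of the fields of v and of conj y has its (1,0)-part in the j0-th
    direction only, with coefficient proportional to the second derivative of F in
    the directions v and y. The j0-th component of the second field does not count,
    since the derivative of F in the direction conj w is constant. *)
Lemma Kfib_levi p v (y : 'cV[C]_N) : dlt r p -> Kfib rho p v ->
  dif (fun X => dif F X (col_mx v 0)) (pb p) (col_mx 0 y) = 0.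
Proof.
move=> hp [hv hK]; have hP := dlt_pb hp.
have hvF : dif F (pb p) (col_mx v 0) = 0 by apply/(HfibE v hp).
have Xp : tan_field v p = v by rewrite /tan_field hvF mulr0 scale0r addr0.
pose u := conj_mx y.
have hd := An_dif (col_mx v 0) hF r0.
have [hB _] := hK _ _ (tan_field_section v hp) (tan_field_section u hp) Xp.
set D := dif (fun X => dif F X (col_mx v 0)) (pb p) in hB *.
have [_ DZ DD] := An_is_dif hd r0 hP; rewrite -/D in DZ DD.
have Dw : D (col_mx 0 (delta_mx j0 0)) = 0.
  rewrite /D (dif_sym _ _ hF r0 hP).
  rewrite (_ : dif _ _ _ = 0) //; apply: (congr1 (fun l => l _) (is_difE (l := fun=> 0) _)).
  apply: is_dif_near r0 hP _ (is_dif_cst c _) => Y hY.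
  by rewrite F_wbar.
have hY : D (col_mx 0 (conj_mx (tan_field u p))) = D (col_mx 0 y).
  have -> : col_mx 0 (conj_mx (tan_field u p)) = col_mx 0 y
     + (- 2 * dif F (pb p) (col_mx u 0))^* *: (col_mx 0 (delta_mx j0 0) : 'cV[C]_(N + N)).
    rewrite /tan_field conj_mxD conj_mxZ /u conj_mxK scale_col_mx scaler0 add_col_mx addr0.
    congr (col_mx _ (_ + _ *: _)).
    by apply/matrixP => i k; rewrite !mxE conjC_nat.
  by rewrite DD DZ Dw mulr0 addr0.
have E j : (levi_bracket (tan_field v) (tan_field u)).1 p j 0
   = (2 * 'i)^-1 * (2 * D (col_mx 0 y) * (j == j0)%:R).
  rewrite !mxE; congr (_ * _).
  have [G hG [hj hGd]] := tan_field_coord v j.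
  have -> : cvapply (field10 (tan_field v)) (fun q => (field01 (tan_field u)).1 q j 0) p = 0.
    rewrite /cvapply big1 // => k _ /=.
    have h0 : forall q : 'cV[C]_N, dlt r q -> (0 : 'cV[C]_N) j 0 = (fun=> 0) (pb q).
      by move=> q _; rewrite mxE.
    rewrite (slice_dZ r0 (An_cst _ r 0) h0 k hp) (is_difE (is_dif_cst _ _)).
    by rewrite mulr0 add0r mxE mul0r.
  rewrite sub0r /cvapply.
  have -> : \sum_k ((field01 (tan_field u)).1 p k 0 * dZ k (fun q => (field10 (tan_field v)).1 q j 0) p
     + (field01 (tan_field u)).2 p k 0 * dZbar k (fun q => (field10 (tan_field v)).1 q j 0) p)
     = dif G (pb p) (col_mx 0 (conj_mx (tan_field u p))).
    rewrite (dif_antihol _ hG hP); apply: eq_bigr => k _ /=.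
    rewrite mxE mul0r add0r; congr (_ * _).
    by apply: (slice_dZbar r0 hG _ k hp) => q _; exact: hj.
  by rewrite hGd // -/D hY -!mulNr opprK.
move: hB; rewrite /Hfib /= (bigD1 j0) //= big1; last first.
  by move=> j jj0; rewrite E (negbTE jj0) !mulr0 mul0r.
rewrite addr0 E eqxx mulr1 (slice_dZ r0 hF rhoF j0 hp) F_w // => /eqP.
rewrite !mulf_eq0 invr_eq0 mulf_eq0 invr_eq0 pnatr_eq0 /= (negbTE (neq0Ci _)) /= orbF.
by move=> /eqP.
Qed.

Lemma dim_Hfib p d : dlt r p -> has_dim (Hfib rho p) d -> d = N.-1.
Proof.
move=> hp [A hA <-].
pose w : 'cV[C]_N := \col_j dZ j rho p.
have hw v : Hfib rho p v <-> v^T *m w = 0.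
  split=> [hv|/matrixP/(_ 0 0)].
    apply/matrixP => i j; rewrite (ord1 i) (ord1 j) !mxE.
    by rewrite -[RHS]hv; apply: eq_bigr => k _; rewrite !mxE.
  by rewrite !mxE => h; rewrite /Hfib /= -[RHS]h; apply: eq_bigr => k _; rewrite !mxE.
have eqA : (A :=: kermx w)%MS.
  apply/eqmxP/andP; split; apply/row_subP => i.
    apply/sub_kermxP; rewrite -[row i A]trmxK; apply: (hw _).1; apply: (hA _).2.
    by rewrite trmxK row_sub.
  rewrite -[row i _]trmxK; apply: (hA _).1; apply: (hw _).2.
  by rewrite trmxK; apply/sub_kermxP; exact: row_sub.
rewrite eqA mxrank_ker; suff -> : \rank w = 1%N by rewrite subn1.
apply/eqP; rewrite eqn_leq rank_leq_col lt0n mxrank_eq0.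
apply/eqP => /matrixP/(_ j0 0); rewrite !mxE (slice_dZ r0 hF rhoF j0 hp) F_w //; last exact: dlt_pb.
by move/eqP; rewrite invr_eq0 pnatr_eq0.
Qed.

(** The rank of the Levi form fixes the dimension of its kernel, so a projection that
    is injective on the kernel and has a target of that dimension is onto. *)
Lemma Kfib_surj p k n (P : 'M[C]_(N, n)) : N.-1 = (k + n)%N -> dlt r p ->
  levi_rank rho p k -> (forall v, Kfib rho p v -> v^T *m P = 0 -> v = 0) ->
  forall u : 'rV[C]_n, exists2 v, Kfib rho p v & v^T *m P = u.
Proof.
move=> hN hp [d [A hA dA] /(dim_Hfib hp)] hd hinj u.
have {hd}dn : d = n by apply: (@addnI k); rewrite hd hN.
have rP : \rank (A *m P) = n.
  have := mxrank_mul_ker A P; rewrite dA dn.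
  suff -> : (A :&: kermx P)%MS = 0 by rewrite mxrank0 addn0.
  apply/eqP; rewrite -submx0; apply/row_subP => i.
  set x := row i _; have hx : (x <= A :&: kermx P)%MS by exact: row_sub.
  rewrite sub_capmx in hx; have /andP[xA /sub_kermxP xP] := hx.
  have := hinj x^T; rewrite trmxK => h; have {h}-> : x = 0.
    by apply/trmx_inj; rewrite trmx0; apply: h => //; apply/hA; rewrite trmxK.
  exact: sub0mx.
have /row_fullP[D hD] : row_full (A *m P) by rewrite /row_full rP.
exists (u *m D *m A)^T; rewrite ?trmxK; first by apply/hA; rewrite trmxK submxMl.
by rewrite -!mulmxA hD mulmx1.
Qed.

End LeviKernel.

(** * The Levi form of a model *)

Section OneByOne.
Variable K : comNzRingType.
Implicit Types A B : 'M[K]_1.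

Lemma mx1D A B : (A + B) 0 0 = A 0 0 + B 0 0. Proof. by rewrite mxE. Qed.
Lemma mx1N A : (- A) 0 0 = - A 0 0. Proof. by rewrite mxE. Qed.
Lemma mx1Z c A : (c *: A) 0 0 = c * A 0 0. Proof. by rewrite mxE. Qed.

Lemma mx1_eq0 A : A 0 0 = 0 -> A = 0.
Proof. by move=> h; apply/matrixP => i j; rewrite (ord1 i) (ord1 j) h mxE. Qed.

Lemma tr_mx1 A : A^T = A.
Proof. by apply/matrixP => i j; rewrite mxE (ord1 i) (ord1 j). Qed.

Lemma form_tr n (x : 'cV[K]_n) (A : 'M[K]_n) (y : 'cV[K]_n) :
  x^T *m A *m y = y^T *m A^T *m x.
Proof. by rewrite -[LHS]tr_mx1 !trmx_mul trmxK mulmxA. Qed.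

End OneByOne.

Section ModelPolarisation.
Variables (R : realType) (s r : nat).
Local Notation C := (Cx R).
Local Notation N := (1 + (s + r))%N.
Local Notation VN := 'cV[C]_N.
Local Notation V2 := 'cV[C]_(r + r).
Variables (H S : 'cV[C]_r -> 'cV[C]_r -> 'M[C]_s).

Definition HH (Z : V2) : 'M[C]_s := H (usubmx Z) (dsubmx Z).
Definition SS (Z : V2) : 'M[C]_s := S (usubmx Z) (dsubmx Z).
(** The polarisation of the conjugate of S: TT(x, conj x) is the conjugate of
    S(x, conj x). Applied to H, it polarises the conjugate of H. *)
Definition TT (Z : V2) : 'M[C]_s := conj_mx (S (conj_mx (dsubmx Z)) (conj_mx (usubmx Z))).

Implicit Types (X : 'cV[C]_(N + N)) (p q v : VN) (Z : V2).

Definition zX X : 'cV[C]_s := zcoord (usubmx X).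
Definition uX X : 'cV[C]_s := zcoord (dsubmx X).
Definition piX X : V2 := col_mx (zetacoord (usubmx X)) (zetacoord (dsubmx X)).
Definition wm p : 'cV[C]_1 := usubmx p.

Lemma sel_zX : is_sel zX.
Proof. by apply/is_sel_usub/is_sel_dsub/is_sel_usub/is_sel_id. Qed.
Lemma sel_uX : is_sel uX.
Proof. by apply/is_sel_usub/is_sel_dsub/is_sel_dsub/is_sel_id. Qed.
Lemma sel_piX : is_sel piX.
Proof.
apply: is_sel_col; apply/is_sel_dsub/is_sel_dsub.
  exact/is_sel_usub/is_sel_id.
exact/is_sel_dsub/is_sel_id.
Qed.
Lemma sel_wX : is_sel (fun X => wm (usubmx X)).
Proof. by apply/is_sel_usub/is_sel_usub/is_sel_id. Qed.
Lemma sel_wX' : is_sel (fun X => wm (dsubmx X)).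
Proof. by apply/is_sel_usub/is_sel_dsub/is_sel_id. Qed.

(** The polarised defining function, as a 1 x 1 matrix so that matrix calculus applies. *)
Definition RhoM X : 'M[C]_1 :=
  2^-1 *: (wm (usubmx X) + wm (dsubmx X))
  - ((zX X)^T *m HH (piX X) *m uX X
     + 2^-1 *: ((uX X)^T *m SS (piX X) *m uX X + (zX X)^T *m TT (piX X) *m zX X)).

Lemma zcoord_mk w (z : 'cV[C]_s) (x : 'cV[C]_r) : zcoord (mk_vec w z x) = z.
Proof. by rewrite /zcoord /mk_vec col_mxKd col_mxKu. Qed.
Lemma zetacoord_mk w (z : 'cV[C]_s) (x : 'cV[C]_r) : zetacoord (mk_vec w z x) = x.
Proof. by rewrite /zetacoord /mk_vec !col_mxKd. Qed.
Lemma wcoord_mk w (z : 'cV[C]_s) (x : 'cV[C]_r) : wcoord (mk_vec w z x) = w.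
Proof. by rewrite /wcoord /mk_vec col_mxKu mxE eqxx. Qed.

Lemma zX_pb p : zX (pb p) = zcoord p. Proof. by rewrite /zX col_mxKu. Qed.
Lemma uX_pb p : uX (pb p) = conj_mx (zcoord p).
Proof. by rewrite /uX /pb col_mxKd /zcoord; apply/colP => i; rewrite !mxE. Qed.
Lemma piX_pb p : piX (pb p) = col_mx (zetacoord p) (conj_mx (zetacoord p)).
Proof.
rewrite /piX /pb col_mxKu col_mxKd; congr col_mx.
by apply/colP => i; rewrite !mxE.
Qed.

Lemma model_rhoE p : model_rho H S p = RhoM (pb p) 0 0.
Proof.
have ReC (c : C) : 'Re c = 2^-1 * (c + c^*) by rewrite ReE mulrC.
rewrite /model_rho /RhoM zX_pb uX_pb piX_pb /HH /SS /TT !col_mxKu !col_mxKd conj_mxK.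
rewrite !ReC !(mx1D, mx1N, mx1Z); congr (_ * (_ + _) - (_ + _ * (_ + _))).
  by rewrite /wm /wcoord !mxE.
have -> : (zcoord p)^T *m conj_mx (S (zetacoord p) (conj_mx (zetacoord p))) *m zcoord p
  = conj_mx ((conj_mx (zcoord p))^T *m S (zetacoord p) (conj_mx (zetacoord p)) *m conj_mx (zcoord p)).
  by rewrite !conj_mxM conj_mxT !conj_mxK.
by rewrite [RHS]mxE.
Qed.

Variable e : R.
Hypotheses (e0 : 0 < e) (AH : mAn e HH) (AS : mAn e SS) (AT : mAn e TT).

Local Notation Hd v Z := (mdif HH Z (col_mx v 0)).
Local Notation Sd v Z := (mdif SS Z (col_mx v 0)).
Local Notation Td v Z := (mdif TT Z (col_mx v 0)).
Local Notation Hb y Z := (mdif HH Z (col_mx 0 y)).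
Local Notation Tb y Z := (mdif TT Z (col_mx 0 y)).
Local Notation Hdb v y Z := (mdif (fun W => Hd v W) Z (col_mx 0 y)).
Local Notation Sdb v y Z := (mdif (fun W => Sd v W) Z (col_mx 0 y)).
Local Notation Tdb v y Z := (mdif (fun W => Td v W) Z (col_mx 0 y)).

Lemma mAn_RhoM : mAn e RhoM.
Proof.
have aH := mAn_comp sel_piX AH; have aS := mAn_comp sel_piX AS.
have aT := mAn_comp sel_piX AT.
have az := mAn_sel e sel_zX; have au := mAn_sel e sel_uX.
have aw := mAn_sel e sel_wX; have aw' := mAn_sel e sel_wX'.
apply: mAnD; first exact: mAnZ (mAnD aw aw').
apply/mAnN/mAnD; first exact: mAnM (mAnM (mAn_tr az) aH) au.
apply/mAnZ/mAnD; first exact: mAnM (mAnM (mAn_tr au) aS) au.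
exact: mAnM (mAnM (mAn_tr az) aT) az.
Qed.

(** The derivative of RhoM in the direction (v, 0). *)
Definition dRho v X : 'M[C]_1 :=
  2^-1 *: wm v
  - ((((zcoord v)^T *m HH (piX X) + (zX X)^T *m Hd (zetacoord v) (piX X)) *m uX X)
     + 2^-1 *: ((uX X)^T *m Sd (zetacoord v) (piX X) *m uX X
       + (((zcoord v)^T *m TT (piX X) + (zX X)^T *m Td (zetacoord v) (piX X)) *m zX X
          + (zX X)^T *m TT (piX X) *m zcoord v))).

Lemma zX_hol v : zX (col_mx v 0) = zcoord v. Proof. by rewrite /zX col_mxKu. Qed.
Lemma uX_hol v : uX (col_mx v 0) = 0.
Proof. by rewrite /uX col_mxKd /zcoord; apply/colP => i; rewrite !mxE. Qed.
Lemma piX_hol v : piX (col_mx v 0) = col_mx (zetacoord v) 0.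
Proof.
rewrite /piX col_mxKu col_mxKd; congr col_mx.
by apply/colP => i; rewrite !mxE.
Qed.
Lemma zX_anti v : zX (col_mx 0 v) = 0.
Proof. by rewrite /zX col_mxKu /zcoord; apply/colP => i; rewrite !mxE. Qed.
Lemma uX_anti v : uX (col_mx 0 v) = zcoord v. Proof. by rewrite /uX col_mxKd. Qed.
Lemma piX_anti v : piX (col_mx 0 v) = col_mx 0 (zetacoord v).
Proof.
rewrite /piX col_mxKu col_mxKd; congr col_mx.
by apply/colP => i; rewrite !mxE.
Qed.

Lemma is_mdif_pi a b (F : V2 -> 'M[C]_(a, b)) X : mAn e F -> dlt e X ->
  is_mdif (fun Y => F (piX Y)) X (fun h => mdif F (piX X) (piX h)).
Proof.
move=> hF hX; apply: is_mdif_comp sel_piX _.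
by apply: mAn_is_mdif hF e0 _; exact: (dlt_sel sel_piX e0).
Qed.

Lemma mdif_RhoM v X : dlt e X -> mdif RhoM X (col_mx v 0) = dRho v X.
Proof.
move=> hX.
have dH := is_mdif_pi AH hX; have dS := is_mdif_pi AS hX; have dT := is_mdif_pi AT hX.
have dz := is_mdif_sel X sel_zX; have du := is_mdif_sel X sel_uX.
have dw := is_mdif_sel X sel_wX; have dw' := is_mdif_sel X sel_wX'.
rewrite (is_mdifE (is_mdifD (is_mdifZ 2^-1 (is_mdifD dw dw'))
  (is_mdifN (is_mdifD (is_mdifM (is_mdifM (is_mdif_tr dz) dH) du)
    (is_mdifZ 2^-1 (is_mdifD (is_mdifM (is_mdifM (is_mdif_tr du) dS) du)
      (is_mdifM (is_mdifM (is_mdif_tr dz) dT) dz))))))) /=.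
rewrite zX_hol uX_hol piX_hol col_mxKu col_mxKd trmx0 /dRho.
have -> : wm 0 = 0 by apply/colP => i; rewrite !mxE.
move: (zX X) (uX X) (HH _) (SS _) (TT _) (wm v); do ![move: (mdif _ _ _) => ?] => ? ? ? ? ? ?.
by rewrite !(mul0mx, mulmx0, add0r, addr0).
Qed.

Lemma mdif_RhoM_anti y X : dlt e X -> zetacoord y = 0 ->
  mdif RhoM X (col_mx 0 y) = 2^-1 *: wm y
    - ((zX X)^T *m HH (piX X) *m zcoord y
       + 2^-1 *: ((zcoord y)^T *m SS (piX X) *m uX X + (uX X)^T *m SS (piX X) *m zcoord y)).
Proof.
move=> hX hzeta.
have dH := is_mdif_pi AH hX; have dS := is_mdif_pi AS hX; have dT := is_mdif_pi AT hX.
have dz := is_mdif_sel X sel_zX; have du := is_mdif_sel X sel_uX.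
have dw := is_mdif_sel X sel_wX; have dw' := is_mdif_sel X sel_wX'.
rewrite (is_mdifE (is_mdifD (is_mdifZ 2^-1 (is_mdifD dw dw'))
  (is_mdifN (is_mdifD (is_mdifM (is_mdifM (is_mdif_tr dz) dH) du)
    (is_mdifZ 2^-1 (is_mdifD (is_mdifM (is_mdifM (is_mdif_tr du) dS) du)
      (is_mdifM (is_mdifM (is_mdif_tr dz) dT) dz))))))) /=.
rewrite zX_anti uX_anti piX_anti hzeta col_mxKu col_mxKd col_mx0 trmx0.
have hp : dlt e (piX X) by exact: (dlt_sel sel_piX e0).
rewrite (mdif0 e0 AH hp) (mdif0 e0 AS hp) (mdif0 e0 AT hp).
have -> : wm 0 = 0 by apply/colP => i; rewrite !mxE.
move: (zX X) (uX X) (HH _) (SS _) (TT _) (wm y) (zcoord y) => ? ? ? ? ? ? ?.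
by rewrite !(mul0mx, mulmx0, add0r, addr0, scaler0, oppr0).
Qed.

(** The derivative of dRho v in the direction (0, y): the Levi form of the model,
    up to a constant factor. *)
Definition dbRho v y X : 'M[C]_1 :=
  - ((((zcoord v)^T *m Hb (zetacoord y) (piX X)
       + (zX X)^T *m Hdb (zetacoord v) (zetacoord y) (piX X)) *m uX X
      + ((zcoord v)^T *m HH (piX X) + (zX X)^T *m Hd (zetacoord v) (piX X)) *m zcoord y)
     + 2^-1 *: ((((zcoord y)^T *m Sd (zetacoord v) (piX X)
                  + (uX X)^T *m Sdb (zetacoord v) (zetacoord y) (piX X)) *m uX X
         + (uX X)^T *m Sd (zetacoord v) (piX X) *m zcoord y)
       + (((zcoord v)^T *m Tb (zetacoord y) (piX X)
           + (zX X)^T *m Tdb (zetacoord v) (zetacoord y) (piX X)) *m zX X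
          + (zX X)^T *m Tb (zetacoord y) (piX X) *m zcoord v))).

Lemma mdif_dRho v y X : dlt e X -> mdif (dRho v) X (col_mx 0 y) = dbRho v y X.
Proof.
move=> hX.
have dH := is_mdif_pi AH hX; have dT := is_mdif_pi AT hX.
have dHd := is_mdif_pi (mAn_mdif (col_mx (zetacoord v) 0) e0 AH) hX.
have dSd := is_mdif_pi (mAn_mdif (col_mx (zetacoord v) 0) e0 AS) hX.
have dTd := is_mdif_pi (mAn_mdif (col_mx (zetacoord v) 0) e0 AT) hX.
have dz := is_mdif_sel X sel_zX; have du := is_mdif_sel X sel_uX.
have cz := is_mdif_cst (zcoord v)^T X; have cz' := is_mdif_cst (zcoord v) X.
rewrite (is_mdifE (is_mdifD (is_mdif_cst (2^-1 *: wm v) X)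
  (is_mdifN (is_mdifD (is_mdifM (is_mdifD (is_mdifM cz dH) (is_mdifM (is_mdif_tr dz) dHd)) du)
    (is_mdifZ 2^-1 (is_mdifD (is_mdifM (is_mdifM (is_mdif_tr du) dSd) du)
      (is_mdifD (is_mdifM (is_mdifD (is_mdifM cz dT) (is_mdifM (is_mdif_tr dz) dTd)) dz)
        (is_mdifM (is_mdifM (is_mdif_tr dz) dT) cz')))))))) /=.
rewrite zX_anti uX_anti piX_anti trmx0 /dbRho.
move: (zX X) (uX X) (HH _) (TT _); do ![move: (mdif _ _ _) => ?] => ? ? ? ?.
by rewrite !(mul0mx, mulmx0, add0r, addr0).
Qed.

End ModelPolarisation.

(** Elimination of the z-component k of a Levi kernel vector from the second of its two
    equations. *)
Lemma schur_algebra (K : numFieldType) n (k z u : 'cV[K]_n) (Q M0 W : 'rV[K]_n)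
    (I Hb Tb Hdb Sd Sdb Tdb : 'M[K]_n) :
  k^T = - Q *m I -> z^T *m Tb *m k = k^T *m Tb *m z ->
  - ((k^T *m Hb + z^T *m Hdb) *m u + M0 *m (0 : 'cV_n)
     + 2^-1 *: (((0 : 'cV_n)^T *m Sd + u^T *m Sdb) *m u + W *m (0 : 'cV_n)
        + ((k^T *m Tb + z^T *m Tdb) *m z + z^T *m Tb *m k))) = 0 ->
  z^T *m Hdb *m u + 2^-1 *: (u^T *m Sdb *m u + z^T *m Tdb *m z)
  - Q *m I *m (Hb *m u + Tb *m z) = 0.
Proof.
rewrite mulNmx => hk hT; rewrite hT trmx0 !mul0mx !mulmx0 !addr0 add0r.
have -> : Q *m I = - k^T by rewrite hk opprK.
rewrite !mulmxDl mulNmx opprK mulmxDr !mulmxA.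
move: (k^T *m Hb *m u) (k^T *m Tb *m z) (z^T *m Hdb *m u) (u^T *m Sdb *m u)
  (z^T *m Tdb *m z) => a b c d f h.
apply/matrixP => i j; have := congr1 (fun A : 'M[K]_1 => A i j) h.
by rewrite !mxE => {}h; rewrite -[RHS]oppr0 -[in RHS]h; field.
Qed.

Section LeviOfModel.
Variables (R : realType) (s r : nat).
Local Notation C := (Cx R).
Local Notation N := (1 + (s + r))%N.
Local Notation VN := 'cV[C]_N.
Local Notation V2 := 'cV[C]_(r + r).
Variables (H S : 'cV[C]_r -> 'cV[C]_r -> 'M[C]_s) (e : R).
Local Notation HH := (HH H).
Local Notation SS := (SS S).
Local Notation TT := (TT S).
Local Notation RhoM := (RhoM H S).
Local Notation rho := (model_rho H S).
Hypotheses (e0 : 0 < e) (AH : mAn e HH) (AS : mAn e SS) (AT : mAn e TT).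
Hypothesis AI : mAn e (fun Z => invmx (HH Z)).
Hypothesis UH : forall Z, dlt e Z -> HH Z \in unitmx.
Hypothesis symS : forall Z, dlt e Z -> (SS Z)^T = SS Z.
Hypothesis symT : forall Z, dlt e Z -> (TT Z)^T = TT Z.
Hypothesis hermH : forall x : 'cV[C]_r, dlt e x ->
  (conj_mx (H x (conj_mx x)))^T = H x (conj_mx x).
Hypothesis levi_rho : forall p : VN, dlt e p -> rho p = 0 -> levi_rank rho p s.

Implicit Types (X : 'cV[C]_(N + N)) (p q : VN) (Z : V2).

Local Notation Hd v Z := (mdif HH Z (col_mx v 0)).
Local Notation Sd v Z := (mdif SS Z (col_mx v 0)).
Local Notation Td v Z := (mdif TT Z (col_mx v 0)).
Local Notation Hb y Z := (mdif HH Z (col_mx 0 y)).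
Local Notation Tb y Z := (mdif TT Z (col_mx 0 y)).
Local Notation Hdb v y Z := (mdif (fun W => Hd v W) Z (col_mx 0 y)).
Local Notation Sdb v y Z := (mdif (fun W => Sd v W) Z (col_mx 0 y)).
Local Notation Tdb v y Z := (mdif (fun W => Td v W) Z (col_mx 0 y)).

Let F X := RhoM X 0 0.
Let j0 : 'I_N := lshift (s + r) (ord0 : 'I_1).
Let hF : An e F := mAn_RhoM AH AS AT 0 0.
Let rhoF p : dlt e p -> rho p = F (pb p) := fun _ => model_rhoE H S p.

Lemma dif_F X h : dif F X h = mdif RhoM X h 0 0.
Proof. by rewrite mxE. Qed.

Lemma zcoord_j0 : zcoord (delta_mx j0 0 : VN) = 0.
Proof. by apply/colP => i; rewrite !mxE. Qed.

Lemma zetacoord_j0 : zetacoord (delta_mx j0 0 : VN) = 0.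
Proof. by apply/colP => i; rewrite !mxE. Qed.

Lemma wm_j0 : wm (delta_mx j0 0 : VN) 0 0 = 1.
Proof. by rewrite !mxE eqxx. Qed.

Lemma dlt_pi X : dlt e X -> dlt e (piX X).
Proof. exact: (dlt_sel (sel_piX R s r) e0). Qed.

Lemma F_w X : dlt e X -> dif F X (col_mx (delta_mx j0 0) 0) = 2^-1.
Proof.
move=> hX; have hp := dlt_pi hX.
rewrite dif_F (mdif_RhoM e0 AH AS AT _ hX) /dRho zcoord_j0 zetacoord_j0 col_mx0.
rewrite (mdif0 e0 AH hp) (mdif0 e0 AS hp) (mdif0 e0 AT hp) trmx0.
rewrite !(mul0mx, mulmx0, add0r, addr0, scaler0, subr0).
by rewrite mxE wm_j0 mulr1.
Qed.

Lemma F_wbar X : dlt e X -> dif F X (col_mx 0 (delta_mx j0 0)) = 2^-1.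
Proof.
move=> hX; rewrite dif_F (mdif_RhoM_anti e0 AH AS AT hX zetacoord_j0) zcoord_j0.
rewrite trmx0 !(mul0mx, mulmx0, add0r, addr0, scaler0, subr0).
by rewrite mxE wm_j0 mulr1.
Qed.

Lemma Kfib_dbRho p (v y : VN) : dlt e p -> Kfib rho p v -> dbRho H S v y (pb p) = 0.
Proof.
move=> hp hv; have hP := dlt_pb hp; apply: mx1_eq0.
have := Kfib_levi e0 hF rhoF F_w F_wbar y hp hv.
have hd := An_dif (col_mx v 0) hF e0.
have E X : dlt e X -> dif F X (col_mx v 0) = dRho H S v X 0 0.
  by move=> hX; rewrite dif_F (mdif_RhoM e0 AH AS AT).
rewrite (dif_near e0 hd hP E) => <-.
by rewrite -(mdif_dRho e0 AH AS AT v y hP) mxE.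
Qed.

(** The Levi kernel equation tested against the z-directions determines the z-component
    of a kernel vector from its zeta-component, since H is invertible. *)
Lemma Kfib_z p v : dlt e p -> Kfib rho p v ->
  (zcoord v)^T = - ((zcoord p)^T *m Hd (zetacoord v) (piX (pb p))
     + (conj_mx (zcoord p))^T *m Sd (zetacoord v) (piX (pb p)))
    *m invmx (HH (piX (pb p))).
Proof.
move=> hp hv; have hP := dlt_pi (dlt_pb hp).
suff h : (zcoord v)^T *m HH (piX (pb p)) + ((zcoord p)^T *m Hd (zetacoord v) (piX (pb p))
     + (conj_mx (zcoord p))^T *m Sd (zetacoord v) (piX (pb p))) = 0.
  apply: (can_inj (mulmxK (UH hP))); rewrite mulmxKV ?UH //.
  by apply/eqP; rewrite -subr_eq0 opprK; apply/eqP.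
apply/rowP => i; pose b : 'cV[C]_s := delta_mx i 0.
have := Kfib_dbRho (mk_vec 0 b 0) hp hv.
rewrite /dbRho zX_pb uX_pb.
rewrite zetacoord_mk zcoord_mk.
have AHd := mAn_mdif (col_mx (zetacoord v) 0) e0 AH.
have ASd := mAn_mdif (col_mx (zetacoord v) 0) e0 AS.
have ATd := mAn_mdif (col_mx (zetacoord v) 0) e0 AT.
rewrite col_mx0 (mdif0 e0 AH hP) (mdif0 e0 AT hP) (mdif0 e0 AHd hP) (mdif0 e0 ASd hP) (mdif0 e0 ATd hP).
rewrite [b^T *m _ + _]addrC.
have := form_tr b (Sd (zetacoord v) (piX (pb p))) (conj_mx (zcoord p)).
rewrite (sym_mdif e0 _ AS hP symS).
move: (mdif HH _ _) (mdif SS _ _) (HH _) (zcoord p) (conj_mx _) (zcoord v) => A B D z u w E.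
rewrite !(mul0mx, mulmx0, add0r, addr0, scaler0) E.
have -> : 2^-1 *: (u^T *m B *m b + u^T *m B *m b) = u^T *m B *m b.
  by rewrite scalerDr -scalerDl -[RHS]scale1r; congr (_ *: _); field.
move=> /eqP; rewrite oppr_eq0 -!mulmxDl -addrA => /eqP/matrixP/(_ 0 0).
have zz : (0 : 'M[C]_1) 0 0 = 0 by rewrite mxE.
have hb (M : 'rV[C]_s) : (M *m b) 0 0 = M 0 i by rewrite -colE mxE.
by rewrite hb zz => ->; rewrite mxE.
Qed.

Lemma Kfib_inj p v : dlt e p -> Kfib rho p v -> zetacoord v = 0 -> v = 0.
Proof.
move=> hp hv hzeta; have hP := dlt_pi (dlt_pb hp).
have hz : zcoord v = 0.
  apply: trmx_inj; rewrite (Kfib_z hp hv) hzeta col_mx0 (mdif0 e0 AH hP) (mdif0 e0 AS hP).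
  by rewrite !mulmx0 addr0 oppr0 mul0mx trmx0.
have [/(HfibE e0 hF rhoF v hp) + _] := hv.
rewrite dif_F (mdif_RhoM e0 AH AS AT _ (dlt_pb hp)) /dRho hz hzeta col_mx0.
rewrite (mdif0 e0 AH hP) (mdif0 e0 AS hP) (mdif0 e0 AT hP) trmx0.
rewrite !(mul0mx, mulmx0, add0r, addr0, scaler0, subr0) mxE => /eqP.
rewrite mulf_eq0 invr_eq0 pnatr_eq0 /= => /eqP hw.
rewrite -[v]vsubmxK -[dsubmx v]vsubmxK -/(zcoord v) -/(zetacoord v) hz hzeta col_mx0.
by rewrite (_ : usubmx v = 0) ?col_mx0 // -/(wm v) (mx1_eq0 hw).
Qed.

(** Constant rank s of the Levi form leaves a kernel whose dimension is the number of
    zeta variables, while kernel vectors are determined by their zeta-component. *)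
Lemma Kfib_zeta p (v : 'cV[C]_r) : dlt e p -> rho p = 0 ->
  exists2 k, Kfib rho p k & zetacoord k = v.
Proof.
move=> hp hr; pose P : 'M[C]_(N, r) := col_mx 0 (col_mx 0 1%:M).
have hP (k : VN) : k^T *m P = (zetacoord k)^T.
  rewrite -{1}[k]vsubmxK -{1}[dsubmx k]vsubmxK !tr_col_mx !mul_row_col.
  by rewrite !mulmx0 !add0r mulmx1.
have [|k hk hkv] := Kfib_surj e0 hF rhoF F_w (P := P) erefl hp (levi_rho hp hr) _ v^T.
  move=> k hk hkP; apply: (Kfib_inj hp hk); apply: trmx_inj.
  by rewrite -hP hkP trmx0.
by exists k => //; apply: trmx_inj; rewrite -hP.
Qed.

(** The Schur complement of the block H in the Levi form, in the directions v and y. *)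
Definition Sch (v y : 'cV[C]_r) X : 'M[C]_1 :=
  (zX X)^T *m Hdb v y (piX X) *m uX X
  + 2^-1 *: ((uX X)^T *m Sdb v y (piX X) *m uX X + (zX X)^T *m Tdb v y (piX X) *m zX X)
  - ((zX X)^T *m Hd v (piX X) + (uX X)^T *m Sd v (piX X)) *m invmx (HH (piX X))
    *m (Hb y (piX X) *m uX X + Tb y (piX X) *m zX X).

Lemma mAn_Sch v y : mAn e (Sch v y).
Proof.
have aHd := mAn_mdif (col_mx v 0) e0 AH; have aSd := mAn_mdif (col_mx v 0) e0 AS.
have aTd := mAn_mdif (col_mx v 0) e0 AT.
have bHd := mAn_comp (sel_piX R s r) (mAn_mdif (col_mx 0 y) e0 aHd).
have bSd := mAn_comp (sel_piX R s r) (mAn_mdif (col_mx 0 y) e0 aSd).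
have bTd := mAn_comp (sel_piX R s r) (mAn_mdif (col_mx 0 y) e0 aTd).
have aHb := mAn_comp (sel_piX R s r) (mAn_mdif (col_mx 0 y) e0 AH).
have aTb := mAn_comp (sel_piX R s r) (mAn_mdif (col_mx 0 y) e0 AT).
have aI := mAn_comp (sel_piX R s r) AI.
have {}aHd := mAn_comp (sel_piX R s r) aHd.
have {}aSd := mAn_comp (sel_piX R s r) aSd.
have az := mAn_sel e (sel_zX R s r); have au := mAn_sel e (sel_uX R s r).
have azt := mAn_tr az; have aut := mAn_tr au.
apply: mAnD.
  apply: mAnD; first exact: mAnM (mAnM azt bHd) au.
  apply/mAnZ/mAnD; first exact: mAnM (mAnM aut bSd) au.
  exact: mAnM (mAnM azt bTd) az.
apply: mAnN; apply: mAnM; last exact: mAnD (mAnM aHb au) (mAnM aTb az).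
by apply: mAnM aI; exact: mAnD (mAnM azt aHd) (mAnM aut aSd).
Qed.

(** Existence of a Levi kernel vector above v forces the Schur complement to vanish. *)
Lemma Sch_on_M p v y : dlt e p -> rho p = 0 -> Sch v y (pb p) = 0.
Proof.
move=> hp hr; have [k hk hkv] := Kfib_zeta v hp hr.
have hP := dlt_pi (dlt_pb hp).
have := Kfib_dbRho (mk_vec 0 0 y) hp hk; rewrite /dbRho /Sch zetacoord_mk zcoord_mk hkv.
have := form_tr (zX (pb p)) (Tb y (piX (pb p))) (zcoord k).
rewrite (sym_mdif e0 _ AT hP symT).
have := Kfib_z hp hk; rewrite -uX_pb -(zX_pb p) hkv.
exact: schur_algebra.
Qed.

(** The Schur complement does not involve w, and every (z, zeta) near 0 is completed by
    w = z^T H conj z + Re (conj z^T S conj z), which is real and small, to a point of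
    M near 0. *)
Lemma Sch_near0 : exists2 d : R, 0 < d & forall q, dlt d q -> forall v y, Sch v y (pb q) = 0.
Proof.
have e20 : 0 < e / 2 by rewrite divr_gt0.
have e2e : e / 2 < e by lra.
have [B [d [B0 d0 hB]]] := An_lip hF e20 e2e.
have B1 : 0 < B + 1 by rewrite ltr_wpDl.
pose d' := Num.min (Num.min d e) (e / (B + 1)).
have d'0 : 0 < d' by rewrite !lt_min d0 e0 divr_gt0.
have d'd : d' <= d by rewrite !ge_min lexx.
have d'e : d' <= e by rewrite !ge_min lexx orbT.
have d'B : d' * (B + 1) <= e by rewrite -ler_pdivlMr // ge_min lexx orbT.
exists d' => // q hq v y.
pose z := zcoord q; pose x := zetacoord q.
pose Q := (z^T *m H x (conj_mx x) *m conj_mx z) 0 0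
  + 'Re (((conj_mx z)^T *m S x (conj_mx x) *m conj_mx z) 0 0).
have sel_zeta : is_sel (fun p : VN => zetacoord p) by apply/is_sel_dsub/is_sel_dsub/is_sel_id.
have hx : dlt e x by apply: dltW d'e _; exact: (dlt_sel sel_zeta d'0 hq).
have Qreal : 'Re Q = Q.
  apply/Creal_ReP; apply: rpredD; last exact: Creal_Re.
  apply/CrealP; set A := H _ _.
  have -> : ((z^T *m A *m conj_mx z) 0 0)^* = (conj_mx (z^T *m A *m conj_mx z)) 0 0.
    by rewrite [RHS]mxE.
  rewrite !conj_mxM conj_mxT conj_mxK form_tr -/A.
  have := hermH hx; rewrite -/A => E.
  by rewrite E.
(* rho vanishes at p because Q is real. *)
pose q0 : VN := mk_vec 0 z x; pose p : VN := mk_vec Q z x.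
have rho_mk w : rho (mk_vec w z x) = 'Re w - Q.
  by rewrite /model_rho zcoord_mk zetacoord_mk wcoord_mk.
have hrp : rho p = 0 by rewrite rho_mk Qreal subrr.
have hq0 : dlt d' q0.
  have sel0 : is_sel (fun p : VN => col_mx (0 : 'cV[C]_1) (col_mx (zcoord p) (zetacoord p))).
    apply: is_sel_col; first exact: is_sel0.
    by apply: is_sel_col => //; apply/is_sel_usub/is_sel_dsub/is_sel_id.
  have := dlt_sel sel0 d'0 hq; congr dlt; rewrite /q0 /mk_vec; congr col_mx.
  by apply/colP => i; rewrite !mxE mul0rn.
have F0 : F 0 = 0.
  have -> : (0 : 'cV[C]_(N + N)) = pb 0.
    rewrite /pb (_ : conj_mx 0 = 0) ?col_mx0 //.
    by apply/colP => i; rewrite !mxE conjC0.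
  rewrite -rhoF; last exact: dlt0.
  rewrite (_ : (0 : VN) = mk_vec 0 0 0); last first.
    rewrite /mk_vec !col_mx0 (_ : 0%:M = 0 :> 'M[C]_1) ?col_mx0 //.
    by apply/matrixP => i j; rewrite !mxE mul0rn.
  rewrite /model_rho zcoord_mk zetacoord_mk wcoord_mk trmx0 !mul0mx.
  have -> : conj_mx (0 : 'cV[C]_s) = 0 by apply/colP => i; rewrite !mxE conjC0.
  by rewrite trmx0 !mul0mx !mxE raddf0 addr0 subr0.
have hQ : nrm Q < e.
  have -> : nrm Q = nrm (rho q0) by rewrite rho_mk raddf0 sub0r nrmN.
  have hq0e : dlt e q0 by exact: dltW hq0.
  have := hB 0 (pb q0) d' (dle0 (ltW e20)) (ltW d'0) d'd (fun i => ltW (dlt_pb hq0 i)).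
  rewrite -/F add0r F0 subr0 -rhoF // => h.
  apply: le_lt_trans h _; apply: lt_le_trans d'B.
  by rewrite mulrDr mulr1 mulrC ltrDl.
have hp : dlt e p.
  apply: dlt_col => i; first by rewrite (ord1 i) mxE eqxx.
  have := hq0 (rshift 1 i); rewrite /q0 /mk_vec col_mxEd => /lt_le_trans; exact.
have := Sch_on_M v y hp hrp.
by rewrite /Sch !zX_pb !uX_pb !piX_pb /p zcoord_mk zetacoord_mk.
Qed.

Lemma Sch_polarised : exists d : R, [/\ 0 < d, d <= e &
  forall X, dlt d X -> forall v y, Sch v y X = 0].
Proof.
have [d d0 hd] := Sch_near0.
exists (Num.min e d / 8); split.
- by rewrite divr_gt0 // lt_min e0.
- by apply: (@le_trans _ _ (Num.min e d)); [rewrite ler_pdivrMr // ler_peMr ?ler1n // le_min !ltW | rewrite ge_min lexx].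
move=> X hX v y; apply: mx1_eq0.
apply: (An_real_slice e0 d0 (mAn_Sch v y 0 0)) hX => q hq.
by rewrite -/(pb q) (hd q hq v y) mxE.
Qed.

End LeviOfModel.

(** * The differential equations satisfied by H and S *)

Section QuadraticForms.
Variables (K : numFieldType) (n : nat).
Implicit Types (M : 'M[K]_n) (z u : 'cV[K]_n).

Lemma form_delta M i j : ((delta_mx i 0 : 'cV[K]_n)^T *m M *m (delta_mx j 0 : 'cV[K]_n)) 0 0 = M i j.
Proof. by rewrite trmx_delta -rowE -colE !mxE. Qed.

Lemma quad_form0 M : (forall z, z^T *m M *m z = 0) -> M + M^T = 0.
Proof.
move=> h; apply/matrixP => i j; rewrite !mxE.
have hd k : M k k = 0 by rewrite -form_delta h mxE.
have := congr1 (fun A : 'M[K]_1 => A 0 0) (h (delta_mx i 0 + delta_mx j 0)).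
rewrite mulmxDr [(_ + _)^T]linearD /= !mulmxDl.
by rewrite !mx1D !form_delta !hd mxE add0r addr0 addrC.
Qed.

Lemma bilin_form0 M : (forall z u, z^T *m M *m u = 0) -> M = 0.
Proof. by move=> h; apply/matrixP => i j; rewrite -form_delta h !mxE. Qed.

(** A form in (z, u) that vanishes identically has vanishing mixed part and vanishing
    symmetrised pure parts. *)
Lemma schur_extract (A B D Hd Sd I Hb Tb : 'M[K]_n) : B^T = B -> D^T = D ->
  (forall z u, z^T *m A *m u + 2^-1 *: (u^T *m B *m u + z^T *m D *m z)
     - (z^T *m Hd + u^T *m Sd) *m I *m (Hb *m u + Tb *m z) = 0) ->
  [/\ A = Hd *m I *m Hb + (Sd *m I *m Tb)^T,
      B = Sd *m I *m Hb + (Sd *m I *m Hb)^T &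
      D = Hd *m I *m Tb + (Hd *m I *m Tb)^T].
Proof.
move=> symB symD h.
have half (X Y : 'M[K]_n) : X^T = X ->
    (forall z, 2^-1 *: (z^T *m X *m z) - z^T *m Y *m z = 0) -> X = Y + Y^T.
  move=> symX hX; apply/eqP; rewrite -subr_eq0; apply/eqP.
  have -> : X - (Y + Y^T) = (2^-1 *: X - Y) + (2^-1 *: X - Y)^T.
    by rewrite linearB linearZ /= symX; apply/matrixP => i j; rewrite !mxE; field.
  apply: quad_form0 => z.
  by rewrite mulmxBr mulmxBl -scalemxAr -scalemxAl hX.
have hB u : 2^-1 *: (u^T *m B *m u) - u^T *m (Sd *m I *m Hb) *m u = 0.
  have := h 0 u; rewrite trmx0 !mul0mx !mulmx0 add0r addr0 add0r addr0.
  by rewrite !mulmxA.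
have hD z : 2^-1 *: (z^T *m D *m z) - z^T *m (Hd *m I *m Tb) *m z = 0.
  have := h z 0; rewrite trmx0 !mul0mx !mulmx0 !add0r addr0.
  by rewrite !mulmxA.
split; [|exact: half|exact: half].
apply/eqP; rewrite -subr_eq0; apply/eqP/bilin_form0 => z u.
have E1 : z^T *m (Sd *m I *m Tb)^T *m u = u^T *m (Sd *m I *m Tb) *m z.
  by rewrite form_tr trmxK.
rewrite mulmxBr mulmxBl mulmxDr mulmxDl E1.
have := h z u; have := hB u; have := hD z.
rewrite !mulmxDl !mulmxDr !mulmxA.
move: (z^T *m D *m z) (z^T *m Hd *m I *m Tb *m z) (u^T *m B *m u)
  (u^T *m Sd *m I *m Hb *m u) (z^T *m A *m u) (z^T *m Hd *m I *m Hb *m u)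
  (u^T *m Sd *m I *m Tb *m z) => d t b w a x y h1 h2 h3.
apply/matrixP => i j.
have {}h1 := congr1 (fun E : 'M[K]_1 => E i j) h1.
have {}h2 := congr1 (fun E : 'M[K]_1 => E i j) h2.
have {}h3 := congr1 (fun E : 'M[K]_1 => E i j) h3.
rewrite !mxE in h1 h2 h3 *.
rewrite -[RHS]subr0 -[in X in _ = X - _]h3 -[in X in _ = _ - X](addr0 0).
by rewrite -[in X in _ = _ - (X + _)]h1 -[in X in _ = _ - (_ + X)]h2; field.
Qed.

End QuadraticForms.

Section SchurIdentities.
Variables (R : realType) (s r : nat).
Local Notation C := (Cx R).
Local Notation N := (1 + (s + r))%N.
Variables (H S : 'cV[C]_r -> 'cV[C]_r -> 'M[C]_s) (e : R).
Local Notation HH := (HH H).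
Local Notation SS := (SS S).
Local Notation TT := (TT S).
Hypotheses (e0 : 0 < e) (AS : mAn e SS) (AT : mAn e TT).
Hypothesis symS : forall Z, dlt e Z -> (SS Z)^T = SS Z.
Hypothesis symT : forall Z, dlt e Z -> (TT Z)^T = TT Z.
Variable d : R.
Hypotheses (d0 : 0 < d) (de : d <= e).
Hypothesis hSch : forall X : 'cV[C]_(N + N), dlt d X -> forall v y, Sch H S v y X = 0.

(** The Schur complement is homogeneous of degree 2 in (z, u), so that its vanishing
    for small z and u extends to all of them. *)
Lemma Sch_forms Z v y (z u : 'cV[C]_s) : dlt d Z ->
  z^T *m mdif (fun W => mdif HH W (col_mx v 0)) Z (col_mx 0 y) *m u
  + 2^-1 *: (u^T *m mdif (fun W => mdif SS W (col_mx v 0)) Z (col_mx 0 y) *m u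
             + z^T *m mdif (fun W => mdif TT W (col_mx v 0)) Z (col_mx 0 y) *m z)
  - (z^T *m mdif HH Z (col_mx v 0) + u^T *m mdif SS Z (col_mx v 0)) *m invmx (HH Z)
    *m (mdif HH Z (col_mx 0 y) *m u + mdif TT Z (col_mx 0 y) *m z) = 0.
Proof.
move=> hZ; have [V V0 hV] := dle_ge (col_mx z u).
pose t : R := d / (2 * V).
have t0 : 0 < t by rewrite divr_gt0 // mulr_gt0.
have tV : t * V < d.
  have -> : t * V = d / 2 by rewrite /t; field; rewrite gt_eqF.
  by rewrite ltr_pdivrMr // ltr_pMr // ltr1n.
pose X : 'cV[C]_(N + N) := col_mx (mk_vec 0 (RtoC t *: z) (usubmx Z))
  (mk_vec 0 (RtoC t *: u) (dsubmx Z)).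
have hX : dlt d X.
  have small (w : 'cV[C]_s) (x : 'cV[C]_r) : dle V w -> dlt d x ->
      dlt d (mk_vec 0 (RtoC t *: w) x).
    move=> hw hx; apply: dlt_col => [i|]; first by rewrite mxE mul0rn nrm0.
    apply: dlt_col => // i; apply: le_lt_trans tV.
    by have := dleZ (RtoC t) hw; rewrite nrm_RtoC gtr0_norm.
  apply: dlt_col; apply: small => i; try by rewrite mxE.
    by have := hV (lshift s i); rewrite col_mxEu.
  by have := hV (rshift s i); rewrite col_mxEd.
have := hSch hX v y; rewrite /Sch.
have -> : zX X = RtoC t *: z by rewrite /zX col_mxKu zcoord_mk.
have -> : uX X = RtoC t *: u by rewrite /uX col_mxKd zcoord_mk.
have -> : piX X = Z by rewrite /piX col_mxKu col_mxKd !zetacoord_mk vsubmxK.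
move: (mdif _ _ _) (mdif _ _ _) (mdif _ _ _) (mdif _ _ _) (mdif _ _ _) (mdif _ _ _)
  (mdif _ _ _) (invmx _) => A1 A2 A3 A4 A5 A6 A7 I.
have trZ (w : 'cV[C]_s) : (RtoC t *: w)^T = RtoC t *: w^T by rewrite linearZ.
rewrite !trZ; move: z^T u^T => zt ut.
have sc (x : 'rV[C]_s) (M : 'M[C]_s) (w : 'cV[C]_s) :
    (RtoC t *: x) *m M *m (RtoC t *: w) = RtoC t *: (RtoC t *: (x *m M *m w)).
  by rewrite -scalemxAr -!scalemxAl.
have scl M M' : (RtoC t *: zt) *m M + (RtoC t *: ut) *m M' = RtoC t *: (zt *m M + ut *m M').
  by rewrite -!scalemxAl scalerDr.
have scr (M M' : 'M[C]_s) : M *m (RtoC t *: u) + M' *m (RtoC t *: z) = RtoC t *: (M *m u + M' *m z).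
  by rewrite -!scalemxAr scalerDr.
have -> : ((RtoC t *: zt) *m A4 + (RtoC t *: ut) *m A3) *m I
    *m (A2 *m (RtoC t *: u) + A1 *m (RtoC t *: z))
  = RtoC t *: (RtoC t *: ((zt *m A4 + ut *m A3) *m I *m (A2 *m u + A1 *m z))).
  by rewrite scl scr sc.
rewrite !sc.
move: (zt *m A7 *m u) (ut *m A6 *m u) (zt *m A5 *m z) (_ *m I *m _) => x1 b1 b2 c.
have -> : 2^-1 *: (RtoC t *: (RtoC t *: b1) + RtoC t *: (RtoC t *: b2))
    = RtoC t *: (RtoC t *: (2^-1 *: (b1 + b2))).
  by rewrite -!scalerDr !scalerA; congr (_ *: _); ring.
rewrite -!scalerDr -!scalerBr => /eqP; rewrite !scaler_eq0 -nrm_eq0 nrm_RtoC.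
by rewrite normr_eq0 gt_eqF //= => /eqP.
Qed.

Hypothesis AH : mAn e HH.

Lemma schur_identities Z v y : dlt d Z ->
  let Hd := mdif HH Z (col_mx v 0) in let Sd := mdif SS Z (col_mx v 0) in
  let Hb := mdif HH Z (col_mx 0 y) in let Tb := mdif TT Z (col_mx 0 y) in
  let I := invmx (HH Z) in
  [/\ mdif (fun W => mdif HH W (col_mx v 0)) Z (col_mx 0 y)
       = Hd *m I *m Hb + (Sd *m I *m Tb)^T,
      mdif (fun W => mdif SS W (col_mx v 0)) Z (col_mx 0 y)
       = Sd *m I *m Hb + (Sd *m I *m Hb)^T &
      mdif (fun W => mdif TT W (col_mx v 0)) Z (col_mx 0 y)
       = Hd *m I *m Tb + (Hd *m I *m Tb)^T].
Proof.
move=> hZ /=; have hZe := dltW de hZ; apply: schur_extract.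
- apply: (sym_mdif e0 _ (mAn_mdif _ e0 AS) hZe) => W hW.
  exact: (sym_mdif e0 _ AS hW symS).
- apply: (sym_mdif e0 _ (mAn_mdif _ e0 AT) hZe) => W hW.
  exact: (sym_mdif e0 _ AT hW symT).
- by move=> z u; exact: Sch_forms.
Qed.

End SchurIdentities.

(** * The Goursat problem *)

Section Goursat.
Variables (R : realType) (s r : nat).
Local Notation C := (Cx R).
Local Notation V2 := 'cV[C]_(r + r).
Variables (d : R) (Hm Sm Tm I : V2 -> 'M[C]_s) (g k : V2 -> 'rV[C]_s).
Hypotheses (d0 : 0 < d) (AH : mAn d Hm) (AS : mAn d Sm) (AT : mAn d Tm) (AI : mAn d I).
Hypotheses (Ag : mAn d g) (Ak : mAn d k).
Hypothesis HI : forall Z, dlt d Z -> Hm Z *m I Z = 1%:M.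
Hypothesis symS : forall Z, dlt d Z -> (Sm Z)^T = Sm Z.
Hypothesis symT : forall Z, dlt d Z -> (Tm Z)^T = Tm Z.
Hypothesis g_hol : forall Z y, dlt d Z -> mdif g Z (col_mx 0 y) = 0.
Hypothesis k_anti : forall Z v, dlt d Z -> mdif k Z (col_mx v 0) = 0.
Hypothesis schur : forall Z v y, dlt d Z ->
  let Hd := mdif Hm Z (col_mx v 0) in let Sd := mdif Sm Z (col_mx v 0) in
  let Hb := mdif Hm Z (col_mx 0 y) in let Tb := mdif Tm Z (col_mx 0 y) in
  [/\ mdif (fun W => mdif Hm W (col_mx v 0)) Z (col_mx 0 y)
       = Hd *m I Z *m Hb + (Sd *m I Z *m Tb)^T,
      mdif (fun W => mdif Sm W (col_mx v 0)) Z (col_mx 0 y)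
       = Sd *m I Z *m Hb + (Sd *m I Z *m Hb)^T &
      mdif (fun W => mdif Tm W (col_mx v 0)) Z (col_mx 0 y)
       = Hd *m I Z *m Tb + (Hd *m I Z *m Tb)^T].

Implicit Types (Z : V2) (v y : 'cV[C]_r).

(** Tangency of the symmetry says that Phi does not depend on the second group of
    variables; Phi' is the polarisation of its conjugate. *)
Definition Phi Z : 'rV[C]_s := g Z *m Tm Z + k Z *m (Hm Z)^T.
Definition Phi' Z : 'rV[C]_s := k Z *m Sm Z + g Z *m Hm Z.
Definition Psi y Z := mdif Phi Z (col_mx 0 y).
Definition Psi' v Z := mdif Phi' Z (col_mx v 0).

Hypothesis Psi0 : forall Z y, dlt d Z -> usubmx Z = 0 -> Psi y Z = 0.
Hypothesis Psi'0 : forall Z v, dlt d Z -> dsubmx Z = 0 -> Psi' v Z = 0.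

Lemma mAn_Phi : mAn d Phi.
Proof. exact: mAnD (mAnM Ag AT) (mAnM Ak (mAn_tr AH)). Qed.

Lemma mAn_Phi' : mAn d Phi'.
Proof. exact: mAnD (mAnM Ak AS) (mAnM Ag AH). Qed.

Lemma PsiE y Z : dlt d Z -> Psi y Z = g Z *m mdif Tm Z (col_mx 0 y)
  + (mdif k Z (col_mx 0 y) *m (Hm Z)^T + k Z *m (mdif Hm Z (col_mx 0 y))^T).
Proof.
move=> hZ.
have dg := mAn_is_mdif Ag d0 hZ; have dk := mAn_is_mdif Ak d0 hZ.
have dH := mAn_is_mdif AH d0 hZ; have dT := mAn_is_mdif AT d0 hZ.
rewrite /Psi (is_mdifE (is_mdifD (is_mdifM dg dT) (is_mdifM dk (is_mdif_tr dH)))).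
by rewrite g_hol // mul0mx add0r.
Qed.

Lemma Psi'E v Z : dlt d Z -> Psi' v Z = k Z *m mdif Sm Z (col_mx v 0)
  + (mdif g Z (col_mx v 0) *m Hm Z + g Z *m mdif Hm Z (col_mx v 0)).
Proof.
move=> hZ.
have dg := mAn_is_mdif Ag d0 hZ; have dk := mAn_is_mdif Ak d0 hZ.
have dH := mAn_is_mdif AH d0 hZ; have dS := mAn_is_mdif AS d0 hZ.
rewrite /Psi' (is_mdifE (is_mdifD (is_mdifM dk dS) (is_mdifM dg dH))).
by rewrite k_anti // mul0mx add0r.
Qed.

(** The second derivatives of H and T in the derivative of Psi are eliminated by the
    Schur identities; what remains is linear in Psi and Psi'. *)
Lemma mdif_Psi y v Z : dlt d Z -> mdif (Psi y) Z (col_mx v 0) =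
  Psi' v Z *m I Z *m mdif Tm Z (col_mx 0 y)
  + Psi y Z *m (I Z)^T *m (mdif Hm Z (col_mx v 0))^T.
Proof.
move=> hZ.
have ATb := mAn_mdif (col_mx 0 y) d0 AT; have AHb := mAn_mdif (col_mx 0 y) d0 AH.
have Akb := mAn_mdif (col_mx 0 y) d0 Ak.
rewrite (mdif_near d0 (mAn_mdif _ d0 mAn_Phi) hZ (PsiE y)).
have dg := mAn_is_mdif Ag d0 hZ; have dk := mAn_is_mdif Ak d0 hZ.
have dH := mAn_is_mdif AH d0 hZ; have dTb := mAn_is_mdif ATb d0 hZ.
have dkb := mAn_is_mdif Akb d0 hZ; have dHb := mAn_is_mdif AHb d0 hZ.
rewrite (is_mdifE (is_mdifD (is_mdifM dg dTb)
  (is_mdifD (is_mdifM dkb (is_mdif_tr dH)) (is_mdifM dk (is_mdif_tr dHb))))).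
rewrite k_anti // mul0mx add0r.
rewrite (mdif_sym d0 Ak _ _ hZ) (mdif_sym d0 AH _ _ hZ) (mdif_sym d0 AT _ _ hZ).
have -> : mdif (fun W => mdif k W (col_mx v 0)) Z (col_mx 0 y) = 0.
  rewrite (mdif_near (G := fun=> 0) d0 (mAn_mdif _ d0 Ak) hZ) => [|W hW].
    by rewrite (is_mdifE (is_mdif_cst _ _)).
  exact: k_anti.
rewrite mul0mx add0r PsiE // Psi'E //.
have [-> _ ->] := schur v y hZ.
have eI := HI hZ; have eIt : (Hm Z)^T *m (I Z)^T = 1%:M.
  by rewrite -trmx_mul (mulmx1C eI) trmx1.
have sT : (mdif Tm Z (col_mx 0 y))^T = mdif Tm Z (col_mx 0 y) by exact: (sym_mdif d0 _ AT hZ symT).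
move: (mdif Tm _ _) (mdif Hm _ (col_mx 0 y)) (mdif Hm _ (col_mx v 0)) (mdif Sm _ _)
  (mdif g _ _) (mdif k _ _) (g Z) (k Z) (Hm Z) (I Z) eI eIt sT
  => Tb Hb Hd Sd gd kb G K H J eI eIt sT.
rewrite !linearD /= !trmx_mul !trmxK sT.
rewrite !(mulmxDl, mulmxDr) !mulmxA.
have e1 : gd *m H *m J = gd by rewrite -mulmxA eI mulmx1.
have e2 : kb *m H^T *m J^T = kb by rewrite -mulmxA eIt mulmx1.
have mxD (A B : 'rV[C]_s) i j : (A + B) i j = A i j + B i j by rewrite mxE.
rewrite e1 e2.
move: (gd *m Tb) (G *m Hd *m J *m Tb) (G *m Tb *m J^T *m Hd^T) (kb *m Hd^T)
  (K *m Hb^T *m J^T *m Hd^T) (K *m Sd *m J *m Tb) => p1 p2 p3 p4 p5 p6.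
by apply/matrixP => i j; rewrite !mxD; ring.
Qed.

Lemma mdif_Psi' v y Z : dlt d Z -> mdif (Psi' v) Z (col_mx 0 y) =
  Psi y Z *m (I Z)^T *m mdif Sm Z (col_mx v 0)
  + Psi' v Z *m I Z *m mdif Hm Z (col_mx 0 y).
Proof.
move=> hZ.
have ASd := mAn_mdif (col_mx v 0) d0 AS; have AHd := mAn_mdif (col_mx v 0) d0 AH.
have Agd := mAn_mdif (col_mx v 0) d0 Ag.
rewrite (mdif_near d0 (mAn_mdif _ d0 mAn_Phi') hZ (Psi'E v)).
have dg := mAn_is_mdif Ag d0 hZ; have dk := mAn_is_mdif Ak d0 hZ.
have dH := mAn_is_mdif AH d0 hZ; have dSd := mAn_is_mdif ASd d0 hZ.
have dgd := mAn_is_mdif Agd d0 hZ; have dHd := mAn_is_mdif AHd d0 hZ.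
rewrite (is_mdifE (is_mdifD (is_mdifM dk dSd)
  (is_mdifD (is_mdifM dgd dH) (is_mdifM dg dHd)))).
rewrite g_hol // mul0mx add0r.
have -> : mdif (fun W => mdif g W (col_mx v 0)) Z (col_mx 0 y) = 0.
  rewrite (mdif_sym d0 Ag _ _ hZ).
  rewrite (mdif_near (G := fun=> 0) d0 (mAn_mdif _ d0 Ag) hZ) => [|W hW].
    by rewrite (is_mdifE (is_mdif_cst _ _)).
  exact: g_hol.
rewrite mul0mx add0r PsiE // Psi'E //.
have [-> -> _] := schur v y hZ.
have eI := HI hZ; have eIt : (Hm Z)^T *m (I Z)^T = 1%:M.
  by rewrite -trmx_mul (mulmx1C eI) trmx1.
have sT : (mdif Tm Z (col_mx 0 y))^T = mdif Tm Z (col_mx 0 y) by exact: (sym_mdif d0 _ AT hZ symT).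
have sS : (mdif Sm Z (col_mx v 0))^T = mdif Sm Z (col_mx v 0) by exact: (sym_mdif d0 _ AS hZ symS).
move: (mdif Tm _ _) (mdif Hm _ (col_mx 0 y)) (mdif Hm _ (col_mx v 0)) (mdif Sm _ _)
  (mdif g _ _) (mdif k _ _) (g Z) (k Z) (Hm Z) (I Z) eI eIt sT sS
  => Tb Hb Hd Sd gd kb G K H J eI eIt sT sS.
rewrite !trmx_mul sT sS.
rewrite !(mulmxDl, mulmxDr) !mulmxA.
have e1 : gd *m H *m J = gd by rewrite -mulmxA eI mulmx1.
have e2 : kb *m H^T *m J^T = kb by rewrite -mulmxA eIt mulmx1.
have mxD (A B : 'rV[C]_s) i j : (A + B) i j = A i j + B i j by rewrite mxE.
rewrite e1 e2.
move: (kb *m Sd) (K *m Sd *m J *m Hb) (K *m Hb^T *m J^T *m Sd) (gd *m Hb)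
  (G *m Hd *m J *m Hb) (G *m Tb *m J^T *m Sd) => p1 p2 p3 p4 p5 p6.
by apply/matrixP => i j; rewrite !mxD; ring.
Qed.

Lemma nrm_mulmx m n p (A : 'M[C]_(m, n)) (B : 'M[C]_(n, p)) (a b : R) : 0 <= a ->
  (forall i j, nrm (A i j) <= a) -> (forall i j, nrm (B i j) <= b) ->
  forall i j, nrm ((A *m B) i j) <= n%:R * (a * b).
Proof.
move=> a0 hA hB i j; rewrite mxE; apply: le_trans (ler_nrm_sum _ _ _) _.
rewrite -[n in leRHS]card_ord mulr_natl -sumr_const; apply: ler_sum => l _.
by rewrite nrmM ler_pM ?nrm_ge0.
Qed.

(** Psi vanishes for x = 0 and Psi' for y = 0, so by the mean value inequality both are
    bounded on the polydisc of radius a by a times a constant times a common bound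
    of the two; the constant does not depend on a. *)
Lemma goursat_contract : exists a, [/\ 0 < a, a < d, a <= 1 &
  forall M, 0 <= M ->
   (forall Z v y i j, dle a Z -> dle 1 v -> dle 1 y ->
      nrm (Psi y Z i j) <= M /\ nrm (Psi' v Z i j) <= M) ->
   (forall Z v y i j, dle a Z -> dle 1 v -> dle 1 y ->
      nrm (Psi y Z i j) <= M / 2 /\ nrm (Psi' v Z i j) <= M / 2)].
Proof.
pose b := d / 2; have b0 : 0 < b by rewrite divr_gt0.
have bd : b < d by rewrite /b ltr_pdivrMr // ltr_pMr // ltr1n.
have [B1 B10 hB1] := mdif_bound AH b0 bd.
have [B2 B20 hB2] := mdif_bound AS b0 bd.
have [B3 B30 hB3] := mdif_bound AT b0 bd.
have [C1 C10 hC1] := mAn_bound AI b0 bd.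
pose B := B1 + B2 + B3; have B0 : 0 <= B by rewrite !addr_ge0.
(* Entrywise bound of a product of a row and two matrices, as in the right-hand side of
   mdif_Psi; adding 1 makes it positive. *)
pose K := s%:R * (s%:R * C1 * B) + 1.
have K0 : 0 < K by rewrite ltr_wpDl // !mulr_ge0.
pose a := Num.min (Num.min b 1) (1 / (4 * K)).
have a0 : 0 < a by rewrite !lt_min b0 ltr01 divr_gt0 // mulr_gt0.
have ab : a <= b by rewrite !ge_min lexx.
have a1 : a <= 1 by rewrite !ge_min lexx orbT.
have aK : a * (4 * K) <= 1 by rewrite -ler_pdivlMr ?mulr_gt0 // ge_min lexx orbT.
have ad : a < d by exact: le_lt_trans bd.
have a0' := ltW a0.
exists a; split=> // M M0 hM.
have bnd2 (P Q : 'rV[C]_s) (J U W : 'M[C]_s) (m1 m2 : R) : 0 <= m1 -> 0 <= m2 ->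
    (forall i j, nrm (P i j) <= M * m1) -> (forall i j, nrm (Q i j) <= M) ->
    (forall i j, nrm (J i j) <= C1) ->
    (forall i j, nrm (U i j) <= B * m2) -> (forall i j, nrm (W i j) <= B * (m1 * m2)) ->
    forall i j, nrm ((P *m J *m U + Q *m J^T *m W) i j) <= 2 * (M * (m1 * m2) * K).
  move=> m10 m20 hP hQ hJ hU hW i j; rewrite mxE; apply: le_trans (ler_nrmD _ _) _.
  have hJt i' j' : nrm (J^T i' j') <= C1 by rewrite mxE.
  have Mm : 0 <= M * m1 by rewrite mulr_ge0.
  have e1 := nrm_mulmx Mm hP hJ; have e2 := nrm_mulmx M0 hQ hJt.
  have p1 : 0 <= s%:R * (M * m1 * C1) by rewrite !mulr_ge0.
  have p2 : 0 <= s%:R * (M * C1) by rewrite !mulr_ge0.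
  have := nrm_mulmx p1 e1 hU i j; have := nrm_mulmx p2 e2 hW i j.
  have : 0 <= M * (m1 * m2) by rewrite !mulr_ge0.
  by rewrite /K; nra.
have scaled (x : 'cV[C]_r) : dle a x -> exists2 x', dle 1 x' & x = RtoC a *: x'.
  move=> hx; exists (RtoC a^-1 *: x).
    move=> i; have := dleZ (RtoC a^-1) hx i; rewrite nrm_RtoC gtr0_norm ?invr_gt0 //.
    by rewrite mulVf // gt_eqF.
  by rewrite scalerA -RtoCM divff ?gt_eqF // RtoC1 scale1r.
have fin : 2 * (M * (a * 1) * K) <= M / 2.
  have := ler_wpM2l M0 aK; rewrite !mulr1; move: (a) (K) => a' K' h.
  rewrite (_ : 2 * (M * a' * K') = M * (a' * (4 * K')) / 2); last by field.
  by rewrite ler_pM2r // invr_gt0.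
move=> Z v y i j hZ hv hy.
pose x := usubmx Z; pose w := dsubmx Z.
have hx : dle a x by move=> l; rewrite mxE.
have hw : dle a w by move=> l; rewrite mxE.
have [x' hx' xE] := scaled x hx; have [w' hw' wE] := scaled w hw.
have hs (t : R) (p : 'cV[C]_r) : 0 <= t <= 1 -> dle a p -> dle a (RtoC t *: p).
  move=> /andP[t0 t1] hp l; have := dleZ (RtoC t) hp l; rewrite nrm_RtoC ger0_norm // => h.
  by apply: le_trans h _; rewrite ler_piMl.
have da (Y : V2) : dle a Y -> dlt d Y by exact: dle_dlt.
have d00 : dle a (0 : 'cV[C]_r) by exact: dle0.
have inB B' : B' = B1 \/ B' = B2 \/ B' = B3 -> B' <= B.
  by rewrite /B => -[->|[->|->]]; lra.
split.
- have ZE : Z = col_mx 0 w + col_mx x 0 by rewrite add_col_mx addr0 add0r vsubmxK.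
  have z0 : dlt d (col_mx 0 w : V2) by apply: da; exact: dle_col.
  have z1 : dlt d (col_mx 0 w + col_mx x 0 : V2) by rewrite -ZE; exact: da.
  have p0 : Psi y (col_mx 0 w) = 0 by rewrite Psi0 // col_mxKu.
  have := mAn_mvt d0 (mAn_mdif (col_mx 0 y) d0 mAn_Phi) z0 z1 (L := M / 2) _ i j.
  rewrite -/(Psi y _) -/(Psi y _) p0 subr0 -ZE; apply => t i' j' ht.
  set Y := col_mx 0 w + _.
  have hY : dle a Y.
    by rewrite /Y scale_col_mx scaler0 add_col_mx addr0 add0r; apply: dle_col => //; exact: hs.
  rewrite (mdif_Psi y x (da _ hY)); apply: le_trans fin.
  have hYb := dleW ab hY.
  apply: bnd2 => //.
  + move=> i1 j1; rewrite /Psi' xE.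
    have -> : col_mx (RtoC a *: x') 0 = RtoC a *: (col_mx x' 0 : V2).
      by rewrite scale_col_mx scaler0.
    rewrite (mdifZ d0 mAn_Phi' _ _ (da _ hY)) mxE nrmM nrm_RtoC gtr0_norm // mulrC.
    by rewrite ler_wpM2r //; have [] := hM Y x' y i1 j1 hY hx' hy.
  + by move=> i1 j1; have [] := hM Y x' y i1 j1 hY hx' hy.
  + by move=> i1 j1; exact: hC1.
  + move=> i1 j1; rewrite mulr1.
    have := hB3 Y (col_mx 0 y) 1 i1 j1 hYb ler01 (dle_col (dle0 ler01) hy).
    by rewrite mulr1 => /le_trans; apply; apply: inB; right; right.
  + move=> i1 j1; rewrite mulr1 mxE.
    have := hB1 Y (col_mx x 0) a j1 i1 hYb a0' (dle_col hx (dle0 a0')).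
    by move=> /le_trans; apply; rewrite ler_wpM2r //; apply: inB; left.
- have ZE : Z = col_mx x 0 + col_mx 0 w by rewrite add_col_mx addr0 add0r vsubmxK.
  have z0 : dlt d (col_mx x 0 : V2) by apply: da; exact: dle_col.
  have z1 : dlt d (col_mx x 0 + col_mx 0 w : V2) by rewrite -ZE; exact: da.
  have p0 : Psi' v (col_mx x 0) = 0 by rewrite Psi'0 // col_mxKd.
  have := mAn_mvt d0 (mAn_mdif (col_mx v 0) d0 mAn_Phi') z0 z1 (L := M / 2) _ i j.
  rewrite -/(Psi' v _) -/(Psi' v _) p0 subr0 -ZE; apply => t i' j' ht.
  set Y := col_mx x 0 + _.
  have hY : dle a Y.
    by rewrite /Y scale_col_mx scaler0 add_col_mx addr0 add0r; apply: dle_col => //; exact: hs.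
  rewrite (mdif_Psi' v w (da _ hY)); apply: le_trans fin.
  have hYb := dleW ab hY.
  have := bnd2 (Psi w Y) (Psi' v Y) (I Y)^T (mdif Sm Y (col_mx v 0))
    (mdif Hm Y (col_mx 0 w)) a 1.
  rewrite trmxK; apply => //.
  + move=> i1 j1; rewrite /Psi wE.
    have -> : col_mx 0 (RtoC a *: w') = RtoC a *: (col_mx 0 w' : V2).
      by rewrite scale_col_mx scaler0.
    rewrite (mdifZ d0 mAn_Phi _ _ (da _ hY)) mxE nrmM nrm_RtoC gtr0_norm // mulrC.
    by rewrite ler_wpM2r //; have [] := hM Y v w' i1 j1 hY hv hw'.
  + by move=> i1 j1; have [] := hM Y v y i1 j1 hY hv hy.
  + by move=> i1 j1; rewrite mxE; exact: hC1.
  + move=> i1 j1; rewrite mulr1.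
    have := hB2 Y (col_mx v 0) 1 i1 j1 hYb ler01 (dle_col hv (dle0 ler01)).
    by rewrite mulr1 => /le_trans; apply; apply: inB; right; left.
  + move=> i1 j1; rewrite mulr1.
    have := hB1 Y (col_mx 0 w) a i1 j1 hYb a0' (dle_col (dle0 a0') hw).
    by move=> /le_trans; apply; rewrite ler_wpM2r //; apply: inB; left.
Qed.

Lemma goursat_zero : exists a, [/\ 0 < a, a < d, a <= 1 &
  forall Z y, dle a Z -> Psi y Z = 0].
Proof.
have [a [a0 ad a1 hM]] := goursat_contract; have a0' := ltW a0.
have [B1 B10 hB1] := mdif_bound mAn_Phi a0 ad.
have [B2 B20 hB2] := mdif_bound mAn_Phi' a0 ad.
pose M := B1 + B2; have M0 : 0 <= M by rewrite addr_ge0.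
have iter n : forall Z v y i j, dle a Z -> dle 1 v -> dle 1 y ->
    nrm (Psi y Z i j) <= M * 2^-1 ^+ n /\ nrm (Psi' v Z i j) <= M * 2^-1 ^+ n.
  elim: n => [|n ih] Z v y i j hZ hv hy; last first.
    rewrite exprSr mulrA; apply: hM ih _ _ _ _ _ hZ hv hy.
    by rewrite mulr_ge0 // exprn_ge0 // invr_ge0.
  rewrite expr0 mulr1.
  have := hB1 Z (col_mx 0 y) 1 i j hZ ler01 (dle_col (dle0 ler01) hy).
  have := hB2 Z (col_mx v 0) 1 i j hZ ler01 (dle_col hv (dle0 ler01)).
  by rewrite !mulr1 /M /Psi /Psi'; lra.
exists a; split=> // Z y hZ.
have unit_dir w : dle 1 w -> Psi w Z = 0.
  move=> hw; apply/matrixP => i j; rewrite [RHS]mxE.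
  apply/eqP; rewrite -nrm_eq0 eq_le nrm_ge0 andbT; apply/ler_addgt0Pr => eps eps0.
  rewrite add0r; have M1 : 0 < M + 1 by rewrite ltr_wpDl.
  have : (fun n => (2^-1 : R) ^+ n) @ \oo --> 0.
    by apply: cvg_expr; rewrite ger0_norm ?invr_ge0 // invf_lt1 ?ltr1n.
  move=> /cvgrPdist_lt/(_ (eps / (M + 1))); rewrite divr_gt0 // => /(_ isT).
  case=> n _ /(_ n (leqnn _)); rewrite sub0r normrN ger0_norm ?exprn_ge0 ?invr_ge0 //.
  rewrite ltr_pdivlMr // => /ltW h.
  have [h1 _] := iter n Z 0 w i j hZ (dle0 ler01) hw.
  apply: le_trans h1 _; apply: le_trans h; by rewrite mulrC ler_wpM2l // lerDl.
have [V V0 hV] := dle_ge y.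
have hw : dle 1 (RtoC V^-1 *: y).
  move=> i; have := dleZ (RtoC V^-1) hV i; rewrite nrm_RtoC gtr0_norm ?invr_gt0 //.
  by rewrite mulVf // gt_eqF.
have -> : y = RtoC V *: (RtoC V^-1 *: y).
  by rewrite scalerA -RtoCM divff ?gt_eqF // RtoC1 scale1r.
have hZd := dle_dlt ad hZ; have := unit_dir _ hw; rewrite /Psi => h.
have -> : col_mx 0 (RtoC V *: (RtoC V^-1 *: y)) = RtoC V *: (col_mx 0 (RtoC V^-1 *: y) : V2).
  by rewrite scale_col_mx scaler0.
by rewrite (mdifZ d0 mAn_Phi _ _ hZd) h scaler0.
Qed.

Lemma Phi_indep : exists a, [/\ 0 < a, a < d &
  forall x y, dle a x -> dle a y -> Phi (col_mx x y) = Phi (col_mx x 0)].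
Proof.
have [a [a0 ad a1 h]] := goursat_zero; exists a; split; [exact: a0 | exact: ad | move=> x y hx hy].
have E : col_mx x y = col_mx x 0 + col_mx 0 y by rewrite add_col_mx addr0 add0r.
have z0 : dlt d (col_mx x 0 : V2) by apply: (dle_dlt ad); apply: dle_col => //; exact: dle0 (ltW a0).
have z1 : dlt d (col_mx x 0 + col_mx 0 y : V2) by rewrite -E; apply: (dle_dlt ad); exact: dle_col.
apply/eqP; rewrite -subr_eq0; apply/eqP/matrixP => i j; rewrite [RHS]mxE.
apply/eqP; rewrite -nrm_eq0 eq_le nrm_ge0 andbT E.
apply: (mAn_mvt d0 mAn_Phi z0 z1) => t i' j' /andP[t0 t1].
rewrite -/(Psi y _) h ?mxE ?nrm0 //.
rewrite scale_col_mx scaler0 add_col_mx addr0 add0r; apply: dle_col => // l.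
have := dleZ (RtoC t) hy l; rewrite nrm_RtoC ger0_norm // => hl.
by apply: le_trans hl _; rewrite ler_piMl // ltW.
Qed.

End Goursat.

(** * The data extracted from a model *)

Section ModelData.
Variables (R : realType) (s r : nat).
Local Notation C := (Cx R).
Local Notation N := (1 + (s + r))%N.
Local Notation V2 := 'cV[C]_(r + r).
Variables (H S : 'cV[C]_r -> 'cV[C]_r -> 'M[C]_s).

Lemma common_radius m p q (F : 'cV[C]_m -> 'M[C]_(p, q)) :
  (forall i j, exists2 e : R, 0 < e & An e (fun x => F x i j)) ->
  exists2 e : R, 0 < e & mAn e F.
Proof.
move=> h; have /choice[e he] : forall ij : 'I_p * 'I_q, exists e : R,
    0 < e /\ An e (fun x => F x ij.1 ij.2).
  by move=> [i j]; have [e e0 he] := h i j; exists e.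
exists (\big[Num.min/1]_ij e ij).
  elim/big_ind: _ => // [x y x0 y0|ij _]; first by rewrite lt_min x0.
  by have [] := he ij.
move=> i j; have [_ hij] := he (i, j); apply: An_le hij.
by rewrite (bigD1 (i, j)) //= ge_min lexx.
Qed.

Lemma mAn_TT (S' : 'cV[C]_r -> 'cV[C]_r -> 'M[C]_s) e : mAn e (SS S') -> mAn e (TT S').
Proof.
move=> hS i j.
have sel : is_sel (fun X : V2 => col_mx (dsubmx X) (usubmx X)).
  by apply: is_sel_col; [apply: is_sel_dsub | apply: is_sel_usub]; exact: is_sel_id.
apply: An_ext (An_conj (An_sel sel (hS i j))) => X _.
rewrite /SS /TT col_mxKu col_mxKd mxE.
by congr (S' _ _ i j)^*; apply/colP => k; rewrite !mxE.
Qed.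

Lemma mAn_slice_eq e a p q (F G : V2 -> 'M[C]_(p, q)) : 0 < e -> 0 < a ->
  mAn e F -> mAn e G -> (forall x : 'cV[C]_r, dlt a x -> F (pb x) = G (pb x)) ->
  forall X, dlt (Num.min e a / 8) X -> F X = G X.
Proof.
move=> e0 a0 hF hG h X hX; apply/matrixP => i j; apply/eqP; rewrite -subr_eq0; apply/eqP.
apply: (An_real_slice e0 a0 (An_sub (hF i j) (hG i j))) hX => x hx.
by rewrite -/(pb x) h // subrr.
Qed.

(** What the proof uses of a 2-nondegenerate model, on a common polydisc. *)
Record model_data (d : R) : Prop := ModelData {
  md_gt0 : 0 < d;
  md_H : mAn d (HH H);
  md_S : mAn d (SS S);
  md_T : mAn d (TT S);
  md_Hbar : mAn d (TT H);
  md_inv : mAn d (fun Z => invmx (HH H Z));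
  md_unit : forall Z, dlt d Z -> HH H Z \in unitmx;
  md_symS : forall Z, dlt d Z -> (SS S Z)^T = SS S Z;
  md_symT : forall Z, dlt d Z -> (TT S Z)^T = TT S Z;
  md_herm : forall Z, dlt d Z -> TT H Z = (HH H Z)^T;
  md_schur : forall Z v y, dlt d Z ->
    let Hd := mdif (HH H) Z (col_mx v 0) in let Sd := mdif (SS S) Z (col_mx v 0) in
    let Hb := mdif (HH H) Z (col_mx 0 y) in let Tb := mdif (TT S) Z (col_mx 0 y) in
    let I := invmx (HH H Z) in
    [/\ mdif (fun W => mdif (HH H) W (col_mx v 0)) Z (col_mx 0 y)
         = Hd *m I *m Hb + (Sd *m I *m Tb)^T,
        mdif (fun W => mdif (SS S) W (col_mx v 0)) Z (col_mx 0 y)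
         = Sd *m I *m Hb + (Sd *m I *m Hb)^T &
        mdif (fun W => mdif (TT S) W (col_mx v 0)) Z (col_mx 0 y)
         = Hd *m I *m Tb + (Hd *m I *m Tb)^T] }.

Lemma SS_pb x : SS S (pb x) = S x (conj_mx x).
Proof. by rewrite /SS /pb col_mxKu col_mxKd. Qed.

Lemma HH_pb x : HH H (pb x) = H x (conj_mx x).
Proof. by rewrite /HH /pb col_mxKu col_mxKd. Qed.

Lemma TT_pb (S' : 'cV[C]_r -> 'cV[C]_r -> 'M[C]_s) x : TT S' (pb x) = conj_mx (S' x (conj_mx x)).
Proof. by rewrite /TT /pb col_mxKu col_mxKd conj_mxK. Qed.

Lemma model_data_exists : two_nondegenerate_model H S -> exists d, model_data d.
Proof.
move=> [[aH aS] /nbhs0_dlt[a a0 hH] /nbhs0_dlt[b b0 hS] H0 /nbhs0_dlt[c c0 hM]].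
have [e1 e10 AH] : exists2 e : R, 0 < e & mAn e (HH H).
  by apply: common_radius => i j; exact: analytic_An (aH i j).
have [e2 e20 AS] : exists2 e : R, 0 < e & mAn e (SS S).
  by apply: common_radius => i j; exact: analytic_An (aS i j).
have u0 : HH H 0 \in unitmx by rewrite /HH !linear0.
have [e3 [e30 e31 AI UH]] := mAn_inv e10 AH u0.
pose f := Num.min e3 e2.
have f0 : 0 < f by rewrite lt_min e30.
have f3 : f <= e3 by rewrite ge_min lexx.
have f1 : f <= e1 := le_trans f3 e31.
have f2 : f <= e2 by rewrite ge_min lexx orbT.
have {}AH := mAn_le f1 AH; have {}AS := mAn_le f2 AS; have {}AI := mAn_le f3 AI.
have {}UH Z : dlt f Z -> HH H Z \in unitmx by move=> hZ; apply: UH; exact: dltW hZ.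
have AT := mAn_TT AS; have ATH := mAn_TT AH.
pose t := Num.min (Num.min a b) c.
have t0 : 0 < t by rewrite !lt_min a0 b0.
have ta : t <= a by rewrite !ge_min lexx.
have tb : t <= b by rewrite !ge_min lexx orbT.
have tc : t <= c by rewrite !ge_min lexx !orbT.
pose e := Num.min f t / 8.
have e0 : 0 < e by rewrite divr_gt0 // lt_min f0.
have e8 : e * 8 <= f by rewrite divfK ?pnatr_eq0 // ge_min lexx.
have e8t : e * 8 <= t by rewrite divfK ?pnatr_eq0 // ge_min lexx orbT.
have ef : e <= f by lra.
have et : e <= t by lra.
have symS Z : dlt e Z -> (SS S Z)^T = SS S Z.
  apply: (mAn_slice_eq f0 t0 (mAn_tr AS) AS) => x hx.
  by rewrite SS_pb hS //; exact: dltW hx.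
have symT Z : dlt e Z -> (TT S Z)^T = TT S Z.
  apply: (mAn_slice_eq f0 t0 (mAn_tr AT) AT) => x hx.
  by rewrite TT_pb -conj_mxT hS //; exact: dltW hx.
have herm Z : dlt e Z -> TT H Z = (HH H Z)^T.
  apply: (mAn_slice_eq f0 t0 ATH (mAn_tr AH)) => x hx.
  rewrite TT_pb HH_pb; have hxa : dlt a x by exact: dltW hx.
  by rewrite -{2}(hH x hxa) trmxK.
have AH' := mAn_le ef AH; have AS' := mAn_le ef AS; have AT' := mAn_le ef AT.
have AI' := mAn_le ef AI.
have UH' Z : dlt e Z -> HH H Z \in unitmx by move=> hZ; apply: UH; exact: dltW hZ.
have hermH (x : 'cV[C]_r) : dlt e x -> (conj_mx (H x (conj_mx x)))^T = H x (conj_mx x).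
  by move=> hx; apply: hH; apply: dltW hx; exact: le_trans ta.
have levi (p : 'cV[C]_N) : dlt e p -> model_rho H S p = 0 -> levi_rank (model_rho H S) p s.
  by move=> hp hr; have [|] := hM p _ hr; first by apply: dltW hp; exact: le_trans tc.
have [d [d0 de hSch]] := Sch_polarised e0 AH' AS' AT' AI' UH' symS symT hermH levi.
have df : d <= f := le_trans de ef.
exists d; split.
- exact: d0.
- exact: mAn_le df AH.
- exact: mAn_le df AS.
- exact: mAn_le df AT.
- exact: mAn_le df ATH.
- exact: mAn_le df AI.
- by move=> Z hZ; apply: UH; exact: dltW hZ.
- by move=> Z hZ; apply: symS; exact: dltW hZ.
- by move=> Z hZ; apply: symT; exact: dltW hZ.
- by move=> Z hZ; apply: herm; exact: dltW hZ.
- by move=> Z v y hZ; exact: (schur_identities e0 AS' AT' symS symT d0 de hSch).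
Qed.

End ModelData.

(** * The symmetry *)

Section Symmetry.
Variables (R : realType) (s r : nat).
Local Notation C := (Cx R).
Local Notation N := (1 + (s + r))%N.
Local Notation V2 := 'cV[C]_(r + r).
Variables (H S : 'cV[C]_r -> 'cV[C]_r -> 'M[C]_s) (d : R).
Hypothesis md : model_data H S d.
Variables (a : 'cV[C]_s) (b : R).
Local Notation rho := (model_rho H S).

Let abar : 'rV[C]_s := (conj_mx a)^T.

(** The d/dz coefficient of the symmetry, and the polarisation of its conjugate. *)
Definition gcoef (x : 'cV[C]_r) : 'rV[C]_s :=
  (a^T *m H 0 0 - abar *m S x 0 + abar *m S 0 0) *m invmx (H x 0).

Definition kcoef (y : 'cV[C]_r) : 'rV[C]_s :=
  (abar *m conj_mx (H 0 0) - a^T *m TT S (col_mx 0 y) + a^T *m conj_mx (S 0 0))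
    *m (invmx (HH H (col_mx 0 y)))^T.

Let d0 : 0 < d := md_gt0 md.

Lemma HH_x0 x : HH H (col_mx x 0) = H x 0.
Proof. by rewrite /HH col_mxKu col_mxKd. Qed.

Lemma SS_x0 x : SS S (col_mx x 0) = S x 0.
Proof. by rewrite /SS col_mxKu col_mxKd. Qed.

Lemma TT_x0 (S' : 'cV[C]_r -> 'cV[C]_r -> 'M[C]_s) x :
  TT S' (col_mx x 0) = conj_mx (S' 0 (conj_mx x)).
Proof. by rewrite /TT col_mxKu col_mxKd conj_mx0. Qed.

Lemma TT_0y (S' : 'cV[C]_r -> 'cV[C]_r -> 'M[C]_s) y :
  TT S' (col_mx 0 y) = conj_mx (S' (conj_mx y) 0).
Proof. by rewrite /TT col_mxKu col_mxKd conj_mx0. Qed.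

Lemma dlt_x0 (x : 'cV[C]_r) : dlt d x -> dlt d (col_mx x 0 : V2).
Proof. by move=> hx; apply: dlt_col => //; exact: dlt0. Qed.

Lemma dlt_0y (y : 'cV[C]_r) : dlt d y -> dlt d (col_mx 0 y : V2).
Proof. by move=> hy; apply: dlt_col => //; exact: dlt0. Qed.

Lemma H00_conj : conj_mx (H 0 0) = (H 0 0)^T.
Proof.
have := md_herm md (dlt_x0 (dlt0 d0)).
by rewrite TT_x0 HH_x0 conj_mx0.
Qed.

Lemma H00_unit : H 0 0 \in unitmx.
Proof. by rewrite -HH_x0; apply: (md_unit md); apply: dlt_x0 (dlt0 d0). Qed.

Lemma gcoef0 : gcoef 0 = a^T.
Proof. by rewrite /gcoef subrK mulmxK // H00_unit. Qed.

Lemma kcoef0 : kcoef 0 = abar.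
Proof.
rewrite /kcoef TT_0y conj_mx0 HH_x0 subrK H00_conj trmx_inv.
by rewrite mulmxK // unitmx_tr H00_unit.
Qed.

Lemma gcoefH x : dlt d x ->
  gcoef x *m H x 0 = a^T *m H 0 0 - abar *m S x 0 + abar *m S 0 0.
Proof.
move=> hx; rewrite /gcoef mulmxKV // -HH_x0.
by apply: (md_unit md); exact: dlt_x0.
Qed.

Lemma kcoefH y : dlt d y -> kcoef y *m (HH H (col_mx 0 y))^T
  = abar *m conj_mx (H 0 0) - a^T *m TT S (col_mx 0 y) + a^T *m conj_mx (S 0 0).
Proof.
move=> hy; rewrite /kcoef trmx_inv mulmxKV // unitmx_tr.
by apply: (md_unit md); exact: dlt_0y.
Qed.

Lemma conj_abar : conj_mx abar = a^T.
Proof. by rewrite /abar conj_mxT conj_mxK. Qed.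

Lemma conj_gcoef x : dlt d x -> conj_mx (gcoef x) = kcoef (conj_mx x).
Proof.
move=> hx; have hcx : dlt d (conj_mx x) by move=> i; rewrite mxE nrm_conj.
have hu : H x 0 \in unitmx by rewrite -HH_x0; apply: (md_unit md); exact: dlt_x0.
have hH : conj_mx (H x 0) = (HH H (col_mx 0 (conj_mx x)))^T.
  by rewrite -(md_herm md) ?TT_0y ?conj_mxK //; exact: dlt_0y.
rewrite /gcoef /kcoef conj_mxM conj_invmx // hH -trmx_inv; congr (_ *m _).
rewrite conj_mxD conj_mxD conj_mxN !conj_mxM conj_abar TT_0y conj_mxK.
by rewrite conj_mxT.
Qed.

Lemma mAn_gcoef m (L : 'cV[C]_m -> 'cV[C]_r) : is_sel L -> mAn d (fun q => gcoef (L q)).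
Proof.
move=> hL; have hL0 : is_sel (fun q => col_mx (L q) (0 : 'cV[C]_r)).
  by apply: is_sel_col => //; exact: is_sel0.
have h1 := mAn_comp hL0 (md_S md); have h2 := mAn_comp hL0 (md_inv md).
apply: (@mAn_ext _ _ _ _ _ (fun q => (a^T *m H 0 0 - abar *m SS S (col_mx (L q) 0)
   + abar *m S 0 0) *m invmx (HH H (col_mx (L q) 0)))).
  by move=> q _; rewrite /gcoef SS_x0 HH_x0.
apply: mAnM h2; apply: mAnD; last exact: mAn_cst.
by apply: mAnD; [exact: mAn_cst | apply: mAnN; exact: mAnM (mAn_cst _ _ _) h1].
Qed.

Lemma mAn_kcoef : mAn d (fun Z : V2 => kcoef (dsubmx Z)).
Proof.
have hL0 : is_sel (fun Z : V2 => col_mx (0 : 'cV[C]_r) (dsubmx Z)).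
  apply: is_sel_col; first exact: is_sel0.
  by apply: is_sel_dsub; exact: is_sel_id.
have h1 := mAn_comp hL0 (md_T md); have h2 := mAn_tr (mAn_comp hL0 (md_inv md)).
apply: mAnM h2; apply: mAnD; last exact: mAn_cst.
by apply: mAnD; [exact: mAn_cst | apply: mAnN; exact: mAnM (mAn_cst _ _ _) h1].
Qed.

Let gV (Z : V2) := gcoef (usubmx Z).
Let kV (Z : V2) := kcoef (dsubmx Z).

Lemma mAn_gV : mAn d gV.
Proof. by apply: mAn_gcoef; apply: is_sel_usub; exact: is_sel_id. Qed.

Lemma usub_line (Z : V2) (y : 'cV[C]_r) (c : C) :
  usubmx (Z + c *: col_mx 0 y) = usubmx Z.
Proof. by rewrite linearD linearZ /= col_mxKu scaler0 addr0. Qed.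

Lemma dsub_line (Z : V2) (v : 'cV[C]_r) (c : C) :
  dsubmx (Z + c *: col_mx v 0) = dsubmx Z.
Proof. by rewrite linearD linearZ /= col_mxKd scaler0 addr0. Qed.

Lemma Phi_at0 (Z : V2) : dlt d Z -> usubmx Z = 0 -> Phi (HH H) (TT S) gV kV Z
  = abar *m conj_mx (H 0 0) + a^T *m conj_mx (S 0 0).
Proof.
move=> hZ hu; rewrite /Phi /gV /kV hu gcoef0.
have hd : dlt d (dsubmx Z) by move=> i; rewrite mxE.
have {1 3}-> : Z = col_mx 0 (dsubmx Z) by rewrite -[LHS]vsubmxK hu.
rewrite kcoefH //; move: (abar *m _) (a^T *m TT S _) (a^T *m conj_mx _) => A B D.
by rewrite addrA (addrC B) subrK.
Qed.

Lemma Phi'_at0 (Z : V2) : dlt d Z -> dsubmx Z = 0 -> Phi' (HH H) (SS S) gV kV Z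
  = a^T *m H 0 0 + abar *m S 0 0.
Proof.
move=> hZ hu; rewrite /Phi' /gV /kV hu kcoef0.
have hd : dlt d (usubmx Z) by move=> i; rewrite mxE.
have {1 3}-> : Z = col_mx (usubmx Z) 0 by rewrite -[LHS]vsubmxK hu.
rewrite HH_x0 SS_x0 gcoefH //.
move: (abar *m S 0 0) (abar *m _) (a^T *m _) => D B A.
by rewrite addrA (addrC B) subrK.
Qed.

(** The right-hand side is Phi(x, conj x) and the left-hand side is Phi(x, 0), because
    k(0) is the conjugate of a^T. *)
Lemma coef_identity : exists e, [/\ 0 < e, e < d & forall x, dle e x ->
  abar *m conj_mx (H 0 (conj_mx x)) + gcoef x *m conj_mx (S 0 (conj_mx x))
  = gcoef x *m TT S (pb x) + kcoef (conj_mx x) *m (HH H (pb x))^T].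
Proof.
have AgV := mAn_gV; have AkV := mAn_kcoef.
have HI Z : dlt d Z -> HH H Z *m invmx (HH H Z) = 1%:M.
  by move=> hZ; rewrite mulmxV // (md_unit md).
have g_hol (Z : V2) (y : 'cV[C]_r) : dlt d Z -> mdif gV Z (col_mx 0 y) = 0.
  by move=> hZ; apply: (mdif_line0 d0 AgV hZ) => t _; rewrite /gV usub_line.
have k_anti (Z : V2) (v : 'cV[C]_r) : dlt d Z -> mdif kV Z (col_mx v 0) = 0.
  by move=> hZ; apply: (mdif_line0 d0 AkV hZ) => t _; rewrite /kV dsub_line.
have Psi0 (Z : V2) y : dlt d Z -> usubmx Z = 0 -> Psi (HH H) (TT S) gV kV y Z = 0.
  move=> hZ hu; apply: (mdif_line0 d0 (mAn_Phi (md_H md) (md_T md) AgV AkV) hZ) => t ht.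
  by rewrite !Phi_at0 // usub_line.
have Psi'0 (Z : V2) v : dlt d Z -> dsubmx Z = 0 -> Psi' (HH H) (SS S) gV kV v Z = 0.
  move=> hZ hu; apply: (mdif_line0 d0 (mAn_Phi' (md_H md) (md_S md) AgV AkV) hZ) => t ht.
  by rewrite !Phi'_at0 // dsub_line.
have [e [e0 ed he]] := Phi_indep d0 (md_H md) (md_S md) (md_T md) (md_inv md) AgV AkV
  HI (md_symS md) (md_symT md) g_hol k_anti (md_schur md) Psi0 Psi'0.
exists e; split; [exact: e0 | exact: ed | move=> x hx].
have hcx : dle e (conj_mx x) by move=> i; rewrite mxE nrm_conj.
have := he x _ hx hcx; rewrite -/(pb x) /Phi /gV /kV /pb !col_mxKu !col_mxKd => ->.
rewrite kcoef0 -(md_herm md) ?TT_x0 1?addrC //.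
by apply: dlt_x0; exact: dle_dlt hx.
Qed.

Definition sym_field (p : 'cV[C]_N) : 'cV[C]_N :=
  let z := zcoord p in
  let zeta := zetacoord p in
  let abarT := (conj_mx a)^T in
  let g := (a^T *m H 0 0 - abarT *m S zeta 0 + abarT *m S 0 0) *m invmx (H zeta 0) in
  mk_vec
    (2 * (RtoC b * 'i
          + ((abarT *m conj_mx (H 0 (conj_mx zeta))
              + g *m conj_mx (S 0 (conj_mx zeta))) *m z) 0 0))
    g^T
    0.

Lemma sel_zeta : is_sel (fun p : 'cV[C]_N => zetacoord p).
Proof. by apply/is_sel_dsub/is_sel_dsub/is_sel_id. Qed.

Lemma sel_z : is_sel (fun p : 'cV[C]_N => zcoord p).
Proof. by apply/is_sel_usub/is_sel_dsub/is_sel_id. Qed.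

Lemma An_sym_field j : An d (fun p => sym_field p j 0).
Proof.
have Ag := mAn_gcoef sel_zeta.
have sel0 : is_sel (fun p : 'cV[C]_N => col_mx (zetacoord p) (0 : 'cV[C]_r)).
  by apply: is_sel_col; [exact: sel_zeta | exact: is_sel0].
have AHb := mAn_comp sel0 (md_Hbar md); have AT := mAn_comp sel0 (md_T md).
have Az := mAn_sel d sel_z.
have Aw := mAnM (mAnD (mAnM (mAn_cst _ d abar) AHb) (mAnM Ag AT)) Az.
rewrite -(splitK j); case: (fintype.split j) => i /=.
  apply: (@An_ext _ _ _ (fun p => 2 * (RtoC b * 'i + ((abar *m TT H (col_mx (zetacoord p) 0)
     + gcoef (zetacoord p) *m TT S (col_mx (zetacoord p) 0)) *m zcoord p) 0 0))).
    by move=> p _; rewrite /sym_field /mk_vec col_mxEu (ord1 i) [RHS]mxE eqxx !TT_x0.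
  by apply: An_mul; [exact: An_cst | apply: An_add; [exact: An_cst | exact: Aw]].
rewrite -(splitK i); case: (fintype.split i) => k /=.
  apply: An_ext (Ag 0 k) => p _.
  by rewrite /sym_field /mk_vec col_mxEd col_mxEu [RHS]mxE.
apply: An_ext (An_cst _ d 0) => p _.
by rewrite /sym_field /mk_vec !col_mxEd mxE.
Qed.

(** The derivative of rho along the field is, in both halves, the sum of a z-linear and a
    conj z-linear part; the terms in b are purely imaginary, and the linear parts cancel
    by coef_identity and its conjugate. *)
Lemma sym_field_symmetry : infinitesimal_symmetry rho sym_field.
Proof.
have [e [e0 ed hid]] := coef_identity.
exists [set p | dlt e p]; first by split; [exact: open_dlt | exact: dlt0].
split=> [p hp j|p hp _].
  by apply: differentiable_quad (An_is_dif (An_sym_field j) d0 (dltW (ltW ed) hp)).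
have hpd : dlt d p := dltW (ltW ed) hp.
have AR := mAn_RhoM (md_H md) (md_S md) (md_T md).
pose F X := RhoM H S X 0 0.
have hF : An d F := AR 0 0.
have rhoF q : dlt d q -> rho q = F (pb q) by move=> _; exact: model_rhoE.
set v := sym_field p.
have -> : cvapply (re_field sym_field) rho p = 2^-1 * (dif F (pb p) (col_mx v 0)
     + dif F (pb p) (col_mx 0 (conj_mx v))).
  rewrite (dif_hol d0 v hF (dlt_pb hpd)) (dif_antihol d0 (conj_mx v) hF (dlt_pb hpd)).
  rewrite -big_split mulr_sumr; apply: eq_bigr => j _ /=.
  rewrite (slice_dZ d0 hF rhoF j hpd) (slice_dZbar d0 hF rhoF j hpd).
  by rewrite mxE [in X in _ + X]mxE -!mulrA -mulrDr.
have hzv : zetacoord v = 0 by rewrite /v /sym_field zetacoord_mk.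
have hzv' : zetacoord (conj_mx v) = 0.
  have -> : zetacoord (conj_mx v) = conj_mx (zetacoord v).
    by apply/colP => i; rewrite !mxE.
  by rewrite hzv conj_mx0.
have hP := dlt_pb hpd.
pose x := zetacoord p; pose z := zcoord p; pose zb := conj_mx z.
have hx : dle e x by move=> i; apply: ltW; exact: (dlt_sel sel_zeta e0 hp).
have hxd : dlt d x := dle_dlt ed hx.
pose g := gcoef x; pose k := kcoef (conj_mx x).
have zv : zcoord v = g^T by rewrite /v /sym_field zcoord_mk.
have zv' : zcoord (conj_mx v) = k^T.
  have -> : zcoord (conj_mx v) = conj_mx (zcoord v) by apply/colP => i; rewrite !mxE.
  by rewrite zv conj_mxT /k -conj_gcoef.
pose Az := ((g *m TT S (pb x) + k *m (HH H (pb x))^T) *m z) 0 0.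
have wv : wm v 0 0 = 2 * (RtoC b * 'i + Az).
  rewrite /Az /g /k -(hid x hx) /v /sym_field /wm /mk_vec col_mxKu [LHS]mxE eqxx //.
have wv' : wm (conj_mx v) 0 0 = 2 * (- (RtoC b * 'i) + Az^*).
  have -> : wm (conj_mx v) 0 0 = (wm v 0 0)^* by rewrite !mxE.
  have cM (u w : C) : (u * w)^* = u^* * w^* by exact: rmorphM.
  have cD (u w : C) : (u + w)^* = u^* + w^* by exact: rmorphD.
  by rewrite wv cM (conjC_nat _ 2) cD cM conjRtoC conjCi mulrN.
have piE : piX (pb p) = pb x by rewrite piX_pb.
have hpx : dlt d (pb x) by exact: dlt_pb.
have AzE : Az = (g *m TT S (pb x) *m z) 0 0 + (k *m (HH H (pb x))^T *m z) 0 0.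
  by rewrite /Az mulmxDl [LHS]mxE.
have AzcE : Az^* = (k *m SS S (pb x) *m zb) 0 0 + (g *m HH H (pb x) *m zb) 0 0.
  have -> : Az^* = conj_mx ((g *m TT S (pb x) + k *m (HH H (pb x))^T) *m z) 0 0.
    by rewrite [RHS]mxE.
  rewrite conj_mxM conj_mxD (conj_mxM g) (conj_mxM k) mulmxDl [LHS]mxE -/zb.
  have -> : conj_mx g = k by rewrite /g conj_gcoef.
  have -> : conj_mx k = g by rewrite /k -conj_gcoef // conj_mxK.
  have -> : conj_mx (TT S (pb x)) = SS S (pb x) by rewrite TT_pb SS_pb conj_mxK.
  have -> : conj_mx (HH H (pb x))^T = HH H (pb x).
    have := md_herm md hpx; rewrite TT_pb -HH_pb => hh.
    by rewrite -hh conj_mxK.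
  by [].
have E1 : dif F (pb p) (col_mx v 0) = RtoC b * 'i + Az
     - ((g *m HH H (pb x) *m zb) 0 0 + (g *m TT S (pb x) *m z) 0 0).
  rewrite dif_F (mdif_RhoM d0 (md_H md) (md_S md) (md_T md) v hP) /dRho.
  have hz0 : mdif (HH H) (pb x) (col_mx 0 0) = 0 by rewrite col_mx0 (mdif0 d0 (md_H md)).
  have hz1 : mdif (SS S) (pb x) (col_mx 0 0) = 0 by rewrite col_mx0 (mdif0 d0 (md_S md)).
  have hz2 : mdif (TT S) (pb x) (col_mx 0 0) = 0 by rewrite col_mx0 (mdif0 d0 (md_T md)).
  rewrite hzv piE hz0 hz1 hz2 zv trmxK uX_pb zX_pb -/z -/zb.
  have := form_tr z (TT S (pb x)) g^T; rewrite (md_symT md hpx) trmxK => ->.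
  rewrite !(mulmx0, mul0mx, addr0, add0r).
  rewrite !(mx1D, mx1N, mx1Z) wv; move: (Az) (_ 0 0) (_ 0 0) => A B D; by field.
have E2 : dif F (pb p) (col_mx 0 (conj_mx v)) = - (RtoC b * 'i) + Az^*
     - ((k *m (HH H (pb x))^T *m z) 0 0 + (k *m SS S (pb x) *m zb) 0 0).
  rewrite dif_F (mdif_RhoM_anti d0 (md_H md) (md_S md) (md_T md) hP hzv').
  rewrite piE zv' trmxK uX_pb zX_pb -/z -/zb.
  have := form_tr zb (SS S (pb x)) k^T; rewrite (md_symS md hpx) trmxK => ->.
  have := form_tr z (HH H (pb x)) k^T; rewrite trmxK => ->.
  rewrite !(mx1D, mx1N, mx1Z) wv'; move: (Az^*) (_ 0 0) (_ 0 0) => A B D; by field.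
rewrite E1 E2 AzcE AzE.
move: ((g *m TT S (pb x) *m z) 0 0) ((k *m (HH H (pb x))^T *m z) 0 0)
  ((k *m SS S (pb x) *m zb) 0 0) ((g *m HH H (pb x) *m zb) 0 0) => A B D E.
by ring.
Qed.

End Symmetry.

Theorem proposition4p1 (R : realType) (n s : nat) (hs : (s <= n)%N)
    (H S : 'cV[Cx R]_(n - s) -> 'cV[Cx R]_(n - s) -> 'M[Cx R]_s)
    (hM : two_nondegenerate_model H S) (a : 'cV[Cx R]_s) (b : R) :
  infinitesimal_symmetry (model_rho H S)
    (fun p : 'cV[Cx R]_(1 + (s + (n - s))) =>
       let z := zcoord p in
       let zeta := zetacoord p in
       let abarT := (conj_mx a)^T in
       let g := (a^T *m H 0 0 - abarT *m S zeta 0 + abarT *m S 0 0)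
                  *m invmx (H zeta 0) in
       mk_vec
         (2 * (RtoC b * 'i
               + ((abarT *m conj_mx (H 0 (conj_mx zeta))
                   + g *m conj_mx (S 0 (conj_mx zeta))) *m z) 0 0))
         g^T
         0).
Proof.
have [d md] := model_data_exists hM.
exact: (sym_field_symmetry md a b).
Qed.
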